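(* (Composition-Diamond Lemma) Let $\mathbf{k}$ be a unitary commutative ring, $\lambda\in\mathbf{k}$, $X$ a nonempty well-ordered set, $n\ge 1$, and $\mathcal{R}_n=\mathcal{R}(\Delta_nX)$ ordered by $<_n$. Let $S\subseteq\mathbf{k}\mathcal{R}_n$ be a set each of whose elements is monic or $0$, with $d(S)\subseteq S$, and let $\mathrm{Id}(S)$ be the differential Rota-Baxter ideal of $\mathbf{k}\mathcal{R}_n$ generated by $S$. Then the following are equivalent: (a) $S$ is a Gröbner-Shirshov basis in $\mathbf{k}\mathcal{R}_n$. (b) If $0\ne f\in\mathrm{Id}(S)$, then $\overline{f}=q|_{\overline{s}}$ for some $q\in\mathcal{R}_n^\star$ and $0\neq s\in S$ with $q|_s$ normal. (c) The set $\mathrm{Irr}(S)=\mathcal{R}_n\setminus\{q|_{\overline{s}}\mid q\in\mathcal{R}_n^\star,\ 0\ne s\in S,\ q|_s\text{ is normal}\}$ is a $\mathbf{k}$-basis of $\mathbf{k}\mathcal{R}_n/\mathrm{Id}(S)$; in other words, $\mathbf{k}\,\mathrm{Irr}(S)\oplus\mathrm{Id}(S)=\mathbf{k}\mathcal{R}_n$.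
   Context: Words. For a set $Y$, $\mathfrak{M}(Y)$ is the free monoid with one unary operator $P$ on $Y$: its elements (bracketed words) are finite words whose factors are letters of $Y$ or symbols $P(u)$, $u\in\mathfrak{M}(Y)$. $\mathcal{R}(Y)\subseteq\mathfrak{M}(Y)$ is the set of bracketed words in which, at every nesting level, no two factors of the form $P(a),P(b)$ are adjacent; $1\in\mathcal{R}(Y)$. Let $\Delta_nX=\{x^{(i)}\mid x\in X,0\le i\le n\}$, $x^{(0)}=x$, $\mathcal{R}_n=\mathcal{R}(\Delta_nX)$. Algebra. $\mathbf{k}\mathcal{R}_n$ is an associative algebra: $uv$ is concatenation unless $u=u'P(a)$, $v=P(b)v'$, in which case $uv=u'P(aP(b)+P(a)b+\lambda ab)v'$, recursively. With $u\mapsto P(u)$ it is the free Rota-Baxter algebra of weight $\lambda$ on $\Delta_nX$. $\mathrm{Red}:\mathbf{k}\mathfrak{M}(\Delta_nX)\to\mathbf{k}\mathcal{R}_n$ is the algebra homomorphism commuting with $P$ and fixing $\Delta_nX$. The operator $d$ on $\mathbf{k}\mathcal{R}_n$ is the linear map with $d(1)=0$, $d(ab)=d(a)b+a\,d(b)+\lambda d(a)d(b)$, $d(x^{(i)})=x^{(i+1)}$ for $i<n$, $d(x^{(n)})=0$, $d(P(u))=u$. A differential Rota-Baxter ideal is a two-sided ideal closed under $d$ and $P$. Order $<_n$. On letters: $x^{(i)}<_ny^{(j)}$ iff $x<y$, or $x=y$ and $i>j$. For $u\in\mathcal{R}_n$ let $\deg(u)=(a,b)$, with $a$ the total number of occurrences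 of letters and of $P$ in $u$ and $b$ the number of occurrences of $P$; degrees are compared lexicographically. If $\deg u<\deg v$ then $u<_nv$. If $\deg u=\deg v$: letters are compared by the rule $x^{(i)}<_ny^{(j)}$ iff $x<y$, or $x=y$ and $i>j$; $P(\tilde u)<_nP(\tilde v)$ iff $\tilde u<_n\tilde v$; otherwise write $u=u_0\cdots u_k$, $v=v_0\cdots v_\ell$ with all factors in $\Delta_nX\cup P(\mathcal{R}_n)$ (standard forms) and compare $(u_0,\dots,u_k)$, $(v_0,\dots,v_\ell)$ lexicographically. For $0\ne f\in\mathbf{k}\mathcal{R}_n$, $\overline{f}$ is the $<_n$-largest word occurring in $f$ with nonzero coefficient; $f$ is monic if that coefficient is $1$. The breadth $\mathrm{bre}(u)$ is the number of factors of the standard form. Substitution. $\mathcal{R}_n^\star$ is the set of words $q\in\mathcal{R}(\Delta_n(X\cup\{\star\}))$ with exactly one occurrence of $\star$, i.e. of exactly one of the letters $\star^{(\ell)}$, $0\le\ell\le n$. For $s\in\mathbf{k}\mathcal{R}_n$, $q|_s$ is obtained by replacing $\star^{(\ell)}$ by $d^\ell(s)$ (extended linearly), regarded as an element of $\mathbf{k}\mathcal{R}_n$ via $\mathrm{Red}$. For $s\neq0$, $q|_s$ is normal if $q|_{\overline{s}}$ needs no reduction to be a word of $\mathcal{R}_n$: for $\ell=0$, replacing $\star$ by the word $\overline{s}$ gives a word of $\mathcal{R}_n$; for $\ell\ge1$, $\overline{s}=x^{(i)}$ with $x\in X$ and $i+\ell\le n$ (then $\star^{(\ell)}$ becomes $x^{(i+\ell)}$).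 Compositions. Let $f,g\in S$ be nonzero (monic). - If $\overline f\in\mathcal{R}_nP(\mathcal{R}_n)$ (its last factor is a bracket), $fu$ with $u\in P(\mathcal{R}_n)\mathcal{R}_n$ a word in $\mathcal{R}_n$ starting with a bracket is a composition of right multiplication; compositions of left multiplication $uf$ are defined symmetrically. - If $u,v\in\mathcal{R}_n$ and $w=\overline fu=v\overline g$ (resp. $w=u\overline f=\overline gv$), as concatenations, lies in $\mathcal{R}_n$ with $\max\{\mathrm{bre}(\overline f),\mathrm{bre}(\overline g)\}<\mathrm{bre}(w)<\mathrm{bre}(\overline f)+\mathrm{bre}(\overline g)$, then $(f,g)_w=fu-vg$ (resp. $uf-gv$) is an intersection composition. - If $q\in\mathcal{R}_n^\star$ with $q|_g$ normal and $w=\overline f=q|_{\overline g}$, then $(f,g)_w=f-q|_g$ is an inclusion composition. Triviality. $h\in\mathbf{k}\mathcal{R}_n$ is trivial modulo $[S]$ if $h=0$ or $h=\sum_ic_iq_i|_{s_i}$ (finite) with $0\neq c_i\in\mathbf{k}$, $q_i\in\mathcal{R}_n^\star$, $0\ne s_i\in S$, $q_i|_{s_i}$ normal and $q_i|_{\overline{s_i}}\le_n\overline h$. $h\equiv0$ mod $[S,w]$ if $h=0$ or $h=\sum_ic_iq_i|_{s_i}$ with the same conditions except that $q_i|_{\overline{s_i}}<_nw$. $S$ is a Gröbner-Shirshov basis if all compositions of right and left multiplication of elements of $S$ are trivial modulo $[S]$ and all intersection and inclusion compositions $(f,g)_w$ with $f,g\in S$ are $\equiv 0$ mod $[S,w]$.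 *)

(* Defs.v *)
From HB Require Import structures.
From mathcomp Require Import all_boot all_order all_algebra.
From mathcomp Require Import finmap.
From mathcomp Require Import monalg zify.

Set Implicit Arguments.
Unset Strict Implicit.
Unset Printing Implicit Defensive.

Import Order.TTheory GRing.Theory.
Local Open Scope ring_scope.

(* Bracketed words over [Y]: [bword Y] is the free monoid with one operator,
   the product being [++], the unit [[::]] and the operator
   [w |-> [:: Bracket w]]. *)

Unset Elimination Schemes.
Inductive factor (Y : Type) : Type :=
  | Letter of Y
  | Bracket of seq (factor Y).
Set Elimination Schemes.

Notation bword Y := (seq (factor Y)).

Section FactorInd.
Variables (Y : Type) (K : factor Y -> Prop).
Hypothesis K_letter : forall y, K (Letter y).
Hypothesis K_bracket :
  forall w, foldr (fun f => and (K f)) True w -> K (Bracket w).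

Fixpoint factor_ind (f : factor Y) : K f :=
  match f with
  | Letter y => K_letter y
  | Bracket w => K_bracket
      ((fix iter (w : bword Y) : foldr (fun f => and (K f)) True w :=
          if w is g :: w' then conj (factor_ind g) (iter w') else I) w)
  end.
End FactorInd.

Section FactorChoice.
Variable Y : Type.

Fixpoint tree_of_factor (f : factor Y) : GenTree.tree Y :=
  match f with
  | Letter y => GenTree.Leaf y
  | Bracket w => GenTree.Node 0 (map tree_of_factor w)
  end.

Fixpoint factor_of_tree (t : GenTree.tree Y) : factor Y :=
  match t with
  | GenTree.Leaf y => Letter y
  | GenTree.Node _ ts => Bracket (map factor_of_tree ts)
  end.

Lemma tree_of_factorK : cancel tree_of_factor factor_of_tree.
Proof.
elim=> //= w IHw; congr Bracket.
by elim: w IHw => //= f w IH [-> /IH ->].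
Qed.
End FactorChoice.

HB.instance Definition _ (Y : eqType) :=
  Equality.copy (factor Y) (can_type (@tree_of_factorK Y)).
HB.instance Definition _ (Y : choiceType) :=
  Choice.copy (factor Y) (can_type (@tree_of_factorK Y)).

Section RBWords.
Variable Y : Type.

Definition is_bracket (f : factor Y) : bool :=
  if f is Bracket _ then true else false.

Definition no_adjacent_brackets (w : bword Y) : bool :=
  sorted (fun f g => ~~ (is_bracket f && is_bracket g)) w.

Fixpoint rb_factor (f : factor Y) : bool :=
  match f with
  | Letter _ => true
  | Bracket w => no_adjacent_brackets w && all rb_factor w
  end.

Definition is_rbword (w : bword Y) : bool :=
  no_adjacent_brackets w && all rb_factor w.

Record rbword := RBWord { rbword_val :> bword Y; _ : is_rbword rbword_val }.

HB.instance Definition _ := [isSub for rbword_val].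
End RBWords.

HB.instance Definition _ (Y : eqType) := [Equality of rbword Y by <:].
HB.instance Definition _ (Y : choiceType) := [Choice of rbword Y by <:].

Definition rb1 (Y : Type) : rbword Y := RBWord (isT : is_rbword [::]).

Definition rbP (Y : Type) (w : rbword Y) : rbword Y.
Proof.
exists [:: Bracket w]; rewrite /is_rbword /= andbT.
exact: (valP w).
Defined.

Definition bre (Y : Type) (w : bword Y) : nat := size w.
Definition starts_with_bracket (Y : Type) (w : bword Y) : bool :=
  if w is f :: _ then is_bracket f else false.
Definition ends_with_bracket (Y : Type) (w : bword Y) : bool :=
  starts_with_bracket (rev w).

(* [wdeg w] is the pair (letters and brackets, brackets). *)
Section Degree.
Variable Y : Type.

Fixpoint fsize (f : factor Y) : nat :=
  match f with
  | Letter _ => 1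
  | Bracket w => (sumn (map fsize w)).+1
  end.

Fixpoint fbrackets (f : factor Y) : nat :=
  match f with
  | Letter _ => 0
  | Bracket w => (sumn (map fbrackets w)).+1
  end.

Definition wsize (w : bword Y) : nat := sumn (map fsize w).
Definition wdeg (w : bword Y) : nat * nat :=
  (wsize w, sumn (map fbrackets w)).
End Degree.

Definition ltdeg (a b : nat * nat) : bool :=
  (a.1 < b.1)%N || (a.1 == b.1) && (a.2 < b.2)%N.

(* The k-module spanned by the Rota-Baxter words. Its scaling is redone because
   that of [{malg k[_]}] excludes the zero ring. *)

Section RBScale.
Variables (k : pzRingType) (K : choiceType).
Implicit Types f g : {malg k[K]}.

Definition rbscale (c : k) f : {malg k[K]} :=
  [malg w in msupp f => c * f@_w].

Lemma rbscaleE c f w : (rbscale c f)@_w = c * f@_w.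
Proof. by rewrite mcoeffE; case: msuppP; rewrite ?mulr0. Qed.

Fact rbscaleA a b f : rbscale a (rbscale b f) = rbscale (a * b) f.
Proof. by apply/malgP => w; rewrite !rbscaleE mulrA. Qed.

Fact rbscale1 f : rbscale 1 f = f.
Proof. by apply/malgP => w; rewrite rbscaleE mul1r. Qed.

Fact rbscaleDr c f g : rbscale c (f + g) = rbscale c f + rbscale c g.
Proof.
by apply/malgP => w; rewrite rbscaleE !mcoeffD !rbscaleE mulrDr.
Qed.

Fact rbscaleDl f a b : rbscale (a + b) f = rbscale a f + rbscale b f.
Proof. by apply/malgP => w; rewrite rbscaleE mcoeffD !rbscaleE mulrDl. Qed.
End RBScale.

Definition rbalg (k : pzRingType) (Y : choiceType) : Type :=
  {malg k[rbword Y]}.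

Section RBModule.
Variables (k : pzRingType) (Y : choiceType).

HB.instance Definition _ := GRing.Zmodule.on (rbalg k Y).
HB.instance Definition _ := GRing.Zmodule_isLmodule.Build k (rbalg k Y)
  (@rbscaleA k _) (@rbscale1 k _) (@rbscaleDr k _) (@rbscaleDl k _).

Definition linext (V : lmodType k) (phi : rbword Y -> V) (f : rbalg k Y) : V :=
  \sum_(w <- msupp f) f@_w *: phi w.

Definition mono (w : rbword Y) : rbalg k Y := << w >>.

(* Only used on words that lie in [rbword Y]. *)
Definition mon (w : bword Y) : rbalg k Y := mono (insubd (rb1 Y) w).

Definition opP : rbalg k Y -> rbalg k Y := linext (fun w => mono (rbP w)).
End RBModule.

Arguments mono {k Y} w.
Arguments mon {k Y} w.

Section RBProduct.
Variables (k : comPzRingType) (lam : k) (Y : choiceType).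
Local Notation A := (rbalg k Y).

(* [fuel] bounds the recursion depth; [mulwE] shows that [mulw] provides
   enough of it. *)
Fixpoint mulw_rec (fuel : nat) (u v : bword Y) : A :=
  if fuel is m.+1 then
    match rev u, v with
    | Bracket a :: ru, Bracket b :: v' =>
        linext (fun c : rbword Y => mon (rev ru ++ Bracket c :: v'))
          (mulw_rec m a [:: Bracket b] + mulw_rec m [:: Bracket a] b
           + lam *: mulw_rec m a b)
    | _, _ => mon (u ++ v)
    end
  else 0.

Definition mulw (u v : bword Y) : A := mulw_rec (wsize u + wsize v).+1 u v.

Definition rbmul (f g : A) : A :=
  \sum_(u <- msupp f) \sum_(v <- msupp g) (f@_u * g@_v) *: mulw u v.

Lemma wsize_rev (u : bword Y) : wsize (rev u) = wsize u.
Proof. by rewrite /wsize map_rev sumn_rev. Qed.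

Lemma wsize_bracket (a v : bword Y) :
  wsize (Bracket a :: v) = (wsize a + wsize v).+1.
Proof. by []. Qed.

Lemma mulw_recE m (u v : bword Y) :
  (wsize u + wsize v < m)%N -> mulw_rec m u v = mulw u v.
Proof.
suff rec_eq p q : (wsize u + wsize v < p)%N -> (wsize u + wsize v < q)%N ->
    mulw_rec p u v = mulw_rec q u v by move=> /rec_eq; apply.
elim: p q u v => [|p IHp] [|q] u v //= hp hq.
case Eu: (rev u) => [|[y|a] ru] //; case: v hp hq => [|[y|b] v'] //.
have -> : wsize u = (wsize a + wsize ru).+1 by rewrite -wsize_rev Eu.
rewrite wsize_bracket => hp hq.
have s0 : wsize ([::] : bword Y) = 0%N by [].
by rewrite !(IHp q) // ?wsize_bracket; lia.
Qed.

Lemma mulwE (u v : bword Y) :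
  mulw u v =
    match rev u, v with
    | Bracket a :: ru, Bracket b :: v' =>
        linext (fun c : rbword Y => mon (rev ru ++ Bracket c :: v'))
          (mulw a [:: Bracket b] + mulw [:: Bracket a] b + lam *: mulw a b)
    | _, _ => mon (u ++ v)
    end.
Proof.
rewrite {1}/mulw /=.
case Eu: (rev u) => [|[y|a] ru] //; case: v => [|[y|b] v'] //.
have Hu : wsize u = (wsize a + wsize ru).+1 by rewrite -wsize_rev Eu.
have s0 : wsize ([::] : bword Y) = 0%N by [].
by rewrite !mulw_recE // ?Hu !wsize_bracket; lia.
Qed.

Fixpoint Redf (f : factor Y) : A :=
  match f with
  | Letter y => mon [:: f]
  | Bracket w => opP (foldr (fun g h => rbmul (Redf g) h) (mono (rb1 Y)) w)
  end.

Definition Red (w : bword Y) : A :=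
  foldr (fun g h => rbmul (Redf g) h) (mono (rb1 Y)) w.
End RBProduct.

(* The pair [(x, i)] stands for the derivative x^(i). *)
Notation diffvar n X := (X * 'I_n.+1)%type.

Definition shiftv (n l : nat) (X : Type) (y : diffvar n X) :
    option (diffvar n X) :=
  omap (pair y.1) (insub (y.2 + l)%N).

Section Derivation.
Variables (k : comPzRingType) (lam : k) (X : choiceType) (n : nat).
Local Notation A := (rbalg k (diffvar n X)).
Local Notation "f ** g" := (rbmul lam f g) (at level 40, left associativity).

Definition derf (f : factor (diffvar n X)) : A :=
  match f with
  | Letter y => if shiftv 1 y is Some z then mon [:: Letter z] else 0
  | Bracket w => mon w
  end.

Fixpoint derw (w : bword (diffvar n X)) : A :=
  if w is f :: w' then
    derf f ** mon w' + mon [:: f] ** derw w' + lam *: (derf f ** derw w')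
  else 0.

Definition der : A -> A := linext (fun w => derw w).

Record drb_ideal (J : A -> Prop) : Prop := DRBIdeal {
  drb_ideal0 : J 0;
  drb_idealD : forall f g, J f -> J g -> J (f + g);
  drb_idealZ : forall c f, J f -> J (c *: f);
  drb_idealMl : forall f g, J g -> J (f ** g);
  drb_idealMr : forall f g, J f -> J (f ** g);
  drb_idealP : forall f, J f -> J (opP f);
  drb_idealDer : forall f, J f -> J (der f) }.

Definition Id (S : A -> Prop) (f : A) : Prop :=
  forall J : A -> Prop, drb_ideal J -> (forall s, S s -> J s) -> J f.
End Derivation.

Arguments der {k} lam {X n} _.

(* The adjoined symbol is [None : option X]; [(None, l)] is its l-th
   derivative. *)
Section StarWords.
Variables (X : Type) (n : nat).

Fixpoint fstars (f : factor (diffvar n (option X))) : seq 'I_n.+1 :=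
  match f with
  | Letter (None, l) => [:: l]
  | Letter (Some _, _) => [::]
  | Bracket w => flatten (map fstars w)
  end.

Definition stars (w : bword (diffvar n (option X))) : seq 'I_n.+1 :=
  flatten (map fstars w).

Record starword := StarWord {
  starword_val :> rbword (diffvar n (option X));
  star_order : 'I_n.+1;
  _ : stars starword_val = [:: star_order] }.

Fixpoint replf (v : bword (diffvar n X)) (f : factor (diffvar n (option X))) :
    bword (diffvar n X) :=
  match f with
  | Letter (None, _) => v
  | Letter (Some x, i) => [:: Letter (x, i)]
  | Bracket w => [:: Bracket (flatten (map (replf v) w))]
  end.

Definition repl (q : bword (diffvar n (option X))) (v : bword (diffvar n X)) :
    bword (diffvar n X) :=
  flatten (map (replf v) q).

(* The word put in the place of the l-th derivative of the star in a normal
   [q|_s] whose leading word is [v]. *)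
Definition shiftw (l : nat) (v : bword (diffvar n X)) :
    option (bword (diffvar n X)) :=
  if l is 0 then Some v
  else if v is [:: Letter y] then omap (fun z => [:: Letter z]) (shiftv l y)
  else None.

(* [subst_word q v] is [Some] of the word q|_v if no reduction is needed. *)
Definition subst_word (q : starword) (v : bword (diffvar n X)) :
    option (rbword (diffvar n X)) :=
  obind (fun v' => insub (repl q v')) (shiftw (star_order q) v).
End StarWords.

Section WordOrder.
Variables (disp : Order.disp_t) (X : orderType disp) (n : nat).
Local Notation Y := (diffvar n X).

Definition ltletter (y z : Y) : bool :=
  (y.1 < z.1)%O || (y.1 == z.1) && (z.2 < y.2)%N.

Fixpoint ltf (f g : factor Y) : bool :=
  match f, g with
  | Letter y, Letter z => ltletter y z
  | Bracket u, Bracket v =>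
      ltdeg (wdeg u) (wdeg v) || (wdeg u == wdeg v) &&
      (fix ltlex (u v : bword Y) : bool :=
         match u, v with
         | f' :: u', g' :: v' => ltf f' g' || (f' == g') && ltlex u' v'
         | [::], _ :: _ => true
         | _, [::] => false
         end) u v
  | _, _ => ltdeg (wdeg [:: f]) (wdeg [:: g])
  end.

Fixpoint ltlex (u v : bword Y) : bool :=
  match u, v with
  | f :: u', g :: v' => ltf f g || (f == g) && ltlex u' v'
  | [::], _ :: _ => true
  | _, [::] => false
  end.

Definition ltw (u v : bword Y) : bool :=
  ltdeg (wdeg u) (wdeg v) || (wdeg u == wdeg v) && ltlex u v.

Definition lew (u v : bword Y) : bool := (u == v) || ltw u v.

Definition maxw (u v : rbword Y) : rbword Y := if ltw u v then v else u.
End WordOrder.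

Definition well_ordered (disp : Order.disp_t) (X : orderType disp) : Prop :=
  forall B : X -> Prop, (exists x, B x) ->
  exists2 m, B m & forall x, B x -> (m <= x)%O.

Section GroebnerShirshov.
Variables (k : comPzRingType) (lam : k).
Variables (disp : Order.disp_t) (X : orderType disp) (n : nat).
Local Notation Y := (diffvar n X).
Local Notation A := (rbalg k Y).
Local Notation "f ** g" := (rbmul lam f g) (at level 40, left associativity).

(* The empty word [rb1] is the least word, so it is neutral for [maxw];
   it is also the value of [lead 0]. *)
Definition lead (f : A) : rbword Y := \big[@maxw _ X n/rb1 Y]_(w <- msupp f) w.

Definition is_monic (f : A) : Prop := f != 0 /\ f@_(lead f) = 1.

Definition subst (q : starword X n) (s : A) : A :=
  linext (fun w => Red lam (repl q w)) (iter (star_order q) (der lam) s).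

Definition normal (q : starword X n) (s : A) : bool :=
  subst_word q (lead s).

(* The word q|_v for v the leading word of s; meaningful when [normal q s]. *)
Definition subst_lead (q : starword X n) (s : A) : rbword Y :=
  odflt (rb1 Y) (subst_word q (lead s)).

Definition normal_combination (S : A -> Prop) (bound : rbword Y -> bool)
    (h : A) : Prop :=
  exists (m : nat) (c : 'I_m -> k) (q : 'I_m -> starword X n) (s : 'I_m -> A),
    (forall i, [/\ c i != 0, S (s i), s i != 0, normal (q i) (s i)
                 & bound (subst_lead (q i) (s i))]) /\
    h = \sum_(i < m) c i *: subst (q i) (s i).

Definition trivial_mod (S : A -> Prop) (h : A) : Prop :=
  h = 0 \/ normal_combination S (fun v => lew v (lead h)) h.

Definition trivial_mod_word (S : A -> Prop) (w : rbword Y) (h : A) : Prop :=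
  h = 0 \/ normal_combination S (fun v => ltw v w) h.

Definition multiplication_compositions_trivial (S : A -> Prop) : Prop :=
  forall f, S f -> f != 0 -> forall u : rbword Y,
    (ends_with_bracket (lead f) -> starts_with_bracket u ->
       trivial_mod S (f ** mono u)) /\
    (starts_with_bracket (lead f) -> ends_with_bracket u ->
       trivial_mod S (mono u ** f)).

Definition proper_overlap (f g : A) (w : rbword Y) : bool :=
  (maxn (bre (lead f)) (bre (lead g)) < bre w < bre (lead f) + bre (lead g))%N.

Definition intersection_compositions_trivial (S : A -> Prop) : Prop :=
  forall f g, S f -> S g -> f != 0 -> g != 0 ->
  forall u v w : rbword Y, proper_overlap f g w ->
    ((w : bword Y) = lead f ++ u -> (w : bword Y) = v ++ lead g ->
       trivial_mod_word S w (f ** mono u - mono v ** g)) /\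
    ((w : bword Y) = u ++ lead f -> (w : bword Y) = lead g ++ v ->
       trivial_mod_word S w (mono u ** f - g ** mono v)).

Definition inclusion_compositions_trivial (S : A -> Prop) : Prop :=
  forall f g, S f -> S g -> f != 0 -> g != 0 ->
  forall q : starword X n, normal q g -> lead f = subst_lead q g ->
    trivial_mod_word S (lead f) (f - subst q g).

Definition groebner_shirshov (S : A -> Prop) : Prop :=
  [/\ multiplication_compositions_trivial S,
      intersection_compositions_trivial S
    & inclusion_compositions_trivial S].

Definition Irr (S : A -> Prop) (w : rbword Y) : Prop :=
  ~ exists (q : starword X n) (s : A),
      [/\ S s, s != 0, normal q s & w = subst_lead q s].

Definition basis_of_quotient (B : rbword Y -> Prop) (J : A -> Prop) : Prop :=
  (forall (ws : seq (rbword Y)) (c : rbword Y -> k),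
     uniq ws -> (forall w, w \in ws -> B w) ->
     J (\sum_(w <- ws) c w *: mono w) -> forall w, w \in ws -> c w = 0) /\
  (forall f : A, exists (ws : seq (rbword Y)) (c : rbword Y -> k),
     (forall w, w \in ws -> B w) /\ J (f - \sum_(w <- ws) c w *: mono w)).

Definition kspan (B : rbword Y -> Prop) (f : A) : Prop :=
  forall w, w \in msupp f -> B w.

Definition direct_sum (V W : A -> Prop) : Prop :=
  (forall f, exists g h, [/\ V g, W h & f = g + h]) /\
  (forall f, V f -> W f -> f = 0).
End GroebnerShirshov.

(* Main.v *)
(* Since d(S) is contained in S, the star of a substitution q|_s can always be
   taken of order 0, so that normal substitutions become pairs of a polynomial and
   its leading word, built from s by multiplication with words and by P.

   Under (a) the span of the normal q|_s is a differential Rota-Baxter ideal. The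
   only delicate point is closure under multiplication by a word, which is proved
   together with a bound on the leading words. The bound is taken with respect to
   the product mx of words that replaces the sum in the Rota-Baxter relation by a
   maximum: mx bounds every word of a product, is strictly monotone in both
   arguments, and, unlike the leading word of a product, does not see cancellations
   in k. Two normal q|_s with the same leading word w then agree modulo normal ones
   below w: either the two occurrences are disjoint, or the difference comes from an
   inclusion or intersection composition. Well-founded induction on words gives (b).

   Conversely, (b) lets one subtract normal q|_s from an element of Id(S) until
   nothing is left, which makes all compositions trivial. For (c), every word is
   congruent modulo Id(S) to a combination of smaller irreducible words, and (b)
   says precisely that a nonzero combination of irreducible words is not in
   Id(S). *)

Require Import Defs.
From HB Require Import structures.
From mathcomp Require Import all_boot all_order all_algebra.
From mathcomp Require Import finmap.
From mathcomp Require Import monalg zify.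
From Stdlib Require Classical_Prop.

Set Implicit Arguments.
Unset Strict Implicit.
Unset Printing Implicit Defensive.

Import Order.TTheory GRing.Theory.
Local Open Scope ring_scope.

(** * Linear extension and the locked product *)

(** The product is only known through a recursion on words, so associativity and the Leibniz rule
    have to be earned. Both rest on one observation: a product of two words changes at most the two
    factors that meet. Where these are brackets, the claim becomes the Rota-Baxter relation itself.

    Leading words are not multiplicative. Already P(1)P(1) = 2P(P(1)) + lam P(1), whose leading word
    drops when 2 = 0 in [k]. In general P(aP(b)) and P(P(a)b) have the same degree and may cancel at
    the top, while P(ab) has one symbol fewer; this is why the maximum in [mx] has two entries.

    The derivation is not monotone either: it removes a bracket, d(P(u)) = u, and kills x^(n).
    Leading words are therefore followed through d at single letters only, and stability of the span
    under d comes from the Leibniz rule, without any bound.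

    Monic elements make division unnecessary: a leading coefficient is always removed by multiplying
    a monic element with it, so an arbitrary commutative ring of scalars does no harm. *)

Lemma scale_addrACA (k : comPzRingType) (V : lmodType k) (c lam : k)
    (a b d x y z : V) :
  c *: (a + b + lam *: d) + (x + y + lam *: z) =
  (c *: a + x) + (c *: b + y) + lam *: (c *: d + z).
Proof.
by rewrite !scalerDr !scalerA (mulrC lam) [LHS]addrACA; congr (_ + _); rewrite addrACA.
Qed.

Section LinearExtension.
Variables (k : comPzRingType) (Y : choiceType).
Local Notation A := (rbalg k Y).
Implicit Types (f g : A) (w : rbword Y).

Lemma rbalgP f g : (forall w, f@_w = g@_w) -> f = g.
Proof. by move=> fg; apply/malgP. Qed.

Lemma coeffD f g w : (f + g)@_w = f@_w + g@_w.
Proof. exact: mcoeffD. Qed.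

Lemma coeffN f w : (- f)@_w = - f@_w.
Proof. exact: mcoeffN. Qed.

Lemma coeff0 w : (0 : A)@_w = 0.
Proof. exact: mcoeff0. Qed.

Lemma coeffZ c f w : (c *: f)@_w = c * f@_w.
Proof. exact: rbscaleE. Qed.

Lemma coeff_mono u w : (mono u : A)@_w = (u == w)%:R.
Proof. exact: mcoeffU. Qed.

Lemma coeff_sum I (r : seq I) (P : pred I) (F : I -> A) w :
  (\sum_(i <- r | P i) F i)@_w = \sum_(i <- r | P i) (F i)@_w.
Proof. exact: (big_morph (fun f : A => f@_w) (fun f g => coeffD f g w) (coeff0 w)). Qed.

Definition bnd (B : rbword Y -> Prop) f := forall w, w \in msupp f -> B w.

Lemma bnd_coeff (B : rbword Y -> Prop) f :
  bnd B f <-> forall w, f@_w != 0 -> B w.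
Proof. by split=> Bf w; [rewrite mcoeff_neq0 | rewrite -mcoeff_neq0]; apply: Bf. Qed.

Lemma bnd0 B : bnd B 0.
Proof. by apply/bnd_coeff => w; rewrite coeff0 eqxx. Qed.

Lemma bndD B f g : bnd B f -> bnd B g -> bnd B (f + g).
Proof.
move=> /bnd_coeff Bf /bnd_coeff Bg; apply/bnd_coeff => w; rewrite coeffD.
have [->|/Bf //] := eqVneq f@_w 0; have [->|/Bg //] := eqVneq g@_w 0.
by rewrite addr0 eqxx.
Qed.

Lemma bndZ B c f : bnd B f -> bnd B (c *: f).
Proof.
move=> /bnd_coeff Bf; apply/bnd_coeff => w; rewrite coeffZ => cf0; apply: Bf.
by apply: contraNneq cf0 => ->; rewrite mulr0.
Qed.

Lemma bnd_mono (B : rbword Y -> Prop) w : B w -> bnd B (mono w).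
Proof.
move=> Bw; apply/bnd_coeff => u; rewrite coeff_mono.
by have [<- //|_] := eqVneq w u; rewrite eqxx.
Qed.

Lemma bnd_sum B I (r : seq I) (P : pred I) (F : I -> A) :
  (forall i, P i -> bnd B (F i)) -> bnd B (\sum_(i <- r | P i) F i).
Proof. by move=> BF; apply: big_ind BF; [exact: bnd0 | exact: bndD]. Qed.

Lemma bndS (B C : rbword Y -> Prop) f :
  (forall w, B w -> C w) -> bnd B f -> bnd C f.
Proof. by move=> BC Bf w /Bf /BC. Qed.

Lemma mono_expand f : f = \sum_(w <- msupp f) f@_w *: mono w.
Proof.
rewrite [LHS]monalgE; apply: eq_bigr => w _; apply/rbalgP => u.
by rewrite [RHS]coeffZ [LHS]mcoeffU coeff_mono mulr_natr.
Qed.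

Lemma bnd_ind (B : rbword Y -> Prop) (K : A -> Prop) :
  K 0 -> (forall c w f, B w -> K f -> K (c *: mono w + f)) ->
  forall f, bnd B f -> K f.
Proof.
move=> K0 KD f Bf; rewrite (mono_expand f) big_seq.
by apply: big_rec => // w g /Bf; apply: KD.
Qed.

Lemma rbalg_ind (K : A -> Prop) :
  K 0 -> (forall c w f, K f -> K (c *: mono w + f)) -> forall f, K f.
Proof.
by move=> K0 KD f; apply: (@bnd_ind (fun=> True)) => // c w g _; apply: KD.
Qed.

Section Linext.
Variables (V : lmodType k).
Implicit Types phi psi : rbword Y -> V.

(** Any finite set containing the support may index the sum, which gives two elements a common index
    set in [linextD]. *)
Lemma linextEw (D : {fset rbword Y}) phi f :
  (msupp f `<=` D)%fset -> linext phi f = \sum_(w <- D) f@_w *: phi w.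
Proof.
move=> fD; apply: big_fset_incl => // w _ wf.
by rewrite mcoeff_outdom // scale0r.
Qed.

Lemma linext0 phi : linext phi 0 = 0.
Proof. by rewrite /linext big1_seq // => w _; rewrite coeff0 scale0r. Qed.

Lemma linextD phi f g : linext phi (f + g) = linext phi f + linext phi g.
Proof.
pose D := (msupp f `|` msupp g)%fset.
rewrite !(@linextEw D) ?fsubsetUl ?fsubsetUr ?msuppD_le // -big_split /=.
by apply: eq_bigr => w _; rewrite coeffD scalerDl.
Qed.

Lemma linextZ phi c f : linext phi (c *: f) = c *: linext phi f.
Proof.
rewrite (@linextEw (msupp f)); last first.
  by apply/fsubsetP; apply: bndZ => w.
by rewrite scaler_sumr; apply: eq_bigr => w _; rewrite coeffZ scalerA.
Qed.

Lemma linext_mono phi w : linext phi (mono w) = phi w.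
Proof.
rewrite (@linextEw [fset w]%fset) ?msuppU_le // big_seq_fset1 coeff_mono eqxx.
exact: scale1r.
Qed.

Lemma eq_linext phi psi f : (forall w, w \in msupp f -> phi w = psi w) ->
  linext phi f = linext psi f.
Proof. by move=> e; apply: eq_big_seq => w /e ->. Qed.

Lemma linextDf phi psi f :
  linext (fun w => phi w + psi w) f = linext phi f + linext psi f.
Proof. by rewrite /linext -big_split; apply: eq_bigr => w _; rewrite scalerDr. Qed.

Lemma linextZf phi c f : linext (fun w => c *: phi w) f = c *: linext phi f.
Proof.
rewrite /linext scaler_sumr; apply: eq_bigr => w _.
by rewrite !scalerA mulrC.
Qed.
End Linext.

Lemma bnd_linext (B C : rbword Y -> Prop) (phi : rbword Y -> A) f :
  bnd B f -> (forall w, B w -> bnd C (phi w)) -> bnd C (linext phi f).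
Proof.
move=> Bf BC; rewrite /linext big_seq; apply: bnd_sum => w /Bf /BC.
exact: bndZ.
Qed.

End LinearExtension.

(* Locked copies of [rbmul], [opP] and [mon] (and [rbd] below for [der]):
   unification would otherwise unfold them and evaluate the well-formedness test
   on concrete words. *)
HB.lock Definition rbp (k : comPzRingType) (lam : k) (Y : choiceType)
  (f g : rbalg k Y) : rbalg k Y := rbmul lam f g.
HB.lock Definition rbo (k : comPzRingType) (Y : choiceType) (f : rbalg k Y) :
  rbalg k Y := opP f.
HB.lock Definition wd (k : comPzRingType) (Y : choiceType) (u : bword Y) :
  rbalg k Y := mon u.

Section Product.
Variables (k : comPzRingType) (lam : k) (Y : choiceType).
Local Notation A := (rbalg k Y).
Local Notation "f ** g" := (rbp lam f g) (at level 40, left associativity).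
Implicit Types (f g h : A) (u v w : rbword Y).

Lemma rboE f : rbo f = opP f.
Proof. by rewrite rbo.unlock. Qed.

Lemma rbo0 : rbo (0 : A) = 0.
Proof. by rewrite rboE; exact: linext0. Qed.

Lemma rboD f g : rbo (f + g) = rbo f + rbo g.
Proof. by rewrite !rboE; exact: linextD. Qed.

Lemma rboZ c f : rbo (c *: f) = c *: rbo f.
Proof. by rewrite !rboE; exact: linextZ. Qed.

Lemma rbo_mono u : rbo (mono u : A) = mono (rbP u).
Proof. by rewrite rboE; exact: linext_mono. Qed.

Lemma rbpE f g : f ** g = rbmul lam f g.
Proof. by rewrite rbp.unlock. Qed.

Lemma rbp_linext f g :
  f ** g = linext (fun u => linext (fun v => mulw lam u v) g) f.
Proof.
rewrite rbpE /rbmul /linext; apply: eq_bigr => u _; rewrite scaler_sumr.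
by apply: eq_bigr => v _; rewrite scalerA.
Qed.

Lemma mul0b g : 0 ** g = 0. Proof. by rewrite rbp_linext linext0. Qed.

Lemma mulDb f g h : (f + g) ** h = f ** h + g ** h.
Proof. by rewrite !rbp_linext linextD. Qed.

Lemma mulZb c f g : (c *: f) ** g = c *: (f ** g).
Proof. by rewrite !rbp_linext linextZ. Qed.

Lemma mulbD f g h : f ** (g + h) = f ** g + f ** h.
Proof.
rewrite !rbp_linext -linextDf; apply: eq_linext => u _; exact: linextD.
Qed.

Lemma mulbZ c f g : f ** (c *: g) = c *: (f ** g).
Proof.
rewrite !rbp_linext -linextZf; apply: eq_linext => u _; exact: linextZ.
Qed.

Lemma mulb0 f : f ** 0 = 0.
Proof. by rewrite -[X in _ ** X](scale0r 0) mulbZ scale0r. Qed.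

Lemma mulNb f g : (- f) ** g = - (f ** g).
Proof. by rewrite -scaleN1r mulZb scaleN1r. Qed.

Lemma mulbN f g : f ** (- g) = - (f ** g).
Proof. by rewrite -scaleN1r mulbZ scaleN1r. Qed.

Lemma mulBb f g h : (f - g) ** h = f ** h - g ** h.
Proof. by rewrite mulDb mulNb. Qed.

Lemma mulbB f g h : f ** (g - h) = f ** g - f ** h.
Proof. by rewrite mulbD mulbN. Qed.

Lemma mul_mono u v : mono u ** mono v = mulw lam u v.
Proof. by rewrite rbp_linext !linext_mono. Qed.
End Product.

(** * Associativity of the Rota-Baxter product *)

Section Junction.
Variable Y : Type.
Implicit Types (u v w : bword Y) (f g : factor Y).

(** The condition under which concatenating two Rota-Baxter words needs no reduction, see [rb_cat];
    its failure exposes the two brackets that get merged. *)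
Definition junction u v : bool :=
  ~~ (ends_with_bracket u && starts_with_bracket v).

Lemma ends_rcons u f : ends_with_bracket (rcons u f) = is_bracket f.
Proof. by rewrite /ends_with_bracket rev_rcons. Qed.

Lemma starts_cat u v :
  starts_with_bracket (u ++ v) =
  if nilp u then starts_with_bracket v else starts_with_bracket u.
Proof. by case: u. Qed.

Lemma ends_cat u v :
  ends_with_bracket (u ++ v) =
  if nilp v then ends_with_bracket u else ends_with_bracket v.
Proof.
by case/lastP: v => [|v f]; rewrite ?cats0 // -rcons_cat !ends_rcons; case: v.
Qed.

Lemma ends_cons f v :
  ends_with_bracket (f :: v) = if nilp v then is_bracket f else ends_with_bracket v.
Proof. by rewrite -cat1s ends_cat. Qed.

Lemma no_adjacent_cat u v :
  no_adjacent_brackets (u ++ v) =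
  [&& no_adjacent_brackets u, no_adjacent_brackets v & junction u v].
Proof.
rewrite /junction; case/lastP: u => [|u f]; first by rewrite /= andbT.
case: v => [|g v] /=; first by rewrite cats0 andbF andbT.
rewrite ends_rcons /no_adjacent_brackets cat_rcons.
case: u => [|h u] /=; first by rewrite andbC.
by rewrite cat_path rcons_path /= -!andbA; do !bool_congr; rewrite andbC.
Qed.

Lemma rb_cat u v :
  is_rbword (u ++ v) = [&& is_rbword u, is_rbword v & junction u v].
Proof.
rewrite /is_rbword no_adjacent_cat all_cat.
by case: (no_adjacent_brackets u); case: (no_adjacent_brackets v);
  case: (all _ u); case: (all _ v); rewrite ?andbT ?andbF.
Qed.

Lemma rb_bracket u : is_rbword [:: Bracket u] = is_rbword u.
Proof. by rewrite /is_rbword /= andbT. Qed.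

(** Adjacency sees only that a factor is a bracket, so the content of a bracket can be exchanged
    freely. *)
Lemma rb_subst_bracket u b c v : is_rbword c ->
  is_rbword (u ++ Bracket b :: v) -> is_rbword (u ++ Bracket c :: v).
Proof.
move=> rc; rewrite -(cat1s _ v) -[Bracket c :: v]cat1s !rb_cat !rb_bracket rc.
case/and3P=> -> /and3P [_ -> j1 j2] /=.
by apply/andP.
Qed.

Lemma not_junction u v : ~~ junction u v ->
  exists u' a b v', u = u' ++ [:: Bracket a] /\ v = Bracket b :: v'.
Proof.
rewrite negbK; case/lastP: u => [|u f] //; rewrite ends_rcons.
case: f => [//|a]; case: v => [|[//|b] v] // _.
by exists u, a, b, v; rewrite cats1.
Qed.
End Junction.

Section WordProduct.
Variables (k : comPzRingType) (lam : k) (Y : choiceType).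
Local Notation A := (rbalg k Y).
Local Notation "f ** g" := (rbp lam f g) (at level 40, left associativity).
Implicit Types (f g h : A) (u v w : bword Y) (r : rbword Y).

Local Notation wd := (@wd k Y).

Lemma wdE u : wd u = mon u.
Proof. by rewrite wd.unlock. Qed.

Lemma wd_val r : wd r = mono r.
Proof. by rewrite wdE /mon valKd. Qed.

Lemma rbval_insubd u : is_rbword u -> insubd (rb1 Y) u = u :> bword Y.
Proof. by move=> ru; rewrite insubdK. Qed.

Lemma wd_mul u v : is_rbword u -> is_rbword v ->
  wd u ** wd v = mulw lam u v.
Proof. by move=> ru rv; rewrite !wdE /mon mul_mono !rbval_insubd. Qed.

Lemma wd_cat u v : is_rbword (u ++ v) -> wd u ** wd v = wd (u ++ v).
Proof.
rewrite rb_cat => /and3P [ru rv]; rewrite wd_mul // wdE mulwE /junction.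
rewrite /ends_with_bracket; case: (rev u) => [|[y|a] ru'] //.
by case: v rv => [|[]].
Qed.

Lemma wd_catr u r : is_rbword (u ++ r) -> wd u ** mono r = wd (u ++ r).
Proof. by rewrite -wd_val; apply: wd_cat. Qed.

Lemma wd_catl r v : is_rbword (r ++ v) -> mono r ** wd v = wd (r ++ v).
Proof. by rewrite -wd_val; apply: wd_cat. Qed.

(** The linear map c -> uP(c)v, which describes what stands around a merged pair of brackets. *)
Definition wrap u v (f : A) : A :=
  linext (fun c : rbword Y => wd (u ++ Bracket c :: v)) f.

Lemma wd_bracket_mul u a b v :
  is_rbword (u ++ [:: Bracket a]) -> is_rbword (Bracket b :: v) ->
  wd (u ++ [:: Bracket a]) ** wd (Bracket b :: v) =
  wrap u v (wd a ** wd [:: Bracket b] + wd [:: Bracket a] ** wd b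
            + lam *: (wd a ** wd b)).
Proof.
move=> ru rv; rewrite wd_mul // mulwE rev_cat /= revK /wrap.
move: ru rv; rewrite -[Bracket b :: v]cat1s !rb_cat !rb_bracket.
move=> /and3P [_ ra _] /andP [rb _].
by rewrite !wd_mul ?rb_bracket //; apply: eq_linext => c _; rewrite wdE.
Qed.

Lemma rbo_wd u : is_rbword u -> rbo (wd u) = wd [:: Bracket u] :> A.
Proof.
move=> ru; rewrite !wdE /mon rbo_mono; congr mono; apply: val_inj.
by rewrite /= !rbval_insubd // rb_bracket.
Qed.

Lemma rbo_mono_wd r : rbo (mono r) = wd [:: Bracket r] :> A.
Proof. by rewrite -wd_val rbo_wd //; apply: valP. Qed.

Lemma wrap_nil f : wrap [::] [::] f = rbo f.
Proof. by rewrite rboE; apply: eq_linext => c _; rewrite -rbo_mono_wd rbo_mono. Qed.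

Lemma mul1b f : mono (rb1 Y) ** f = f.
Proof.
elim/rbalg_ind: f => [|c w f IH].
  by rewrite mulb0.
by rewrite mulbD mulbZ IH -(wd_val (rb1 Y)) wd_catr ?wd_val //; apply: valP.
Qed.

Lemma mulb1 f : f ** mono (rb1 Y) = f.
Proof.
elim/rbalg_ind: f => [|c w f IH].
  by rewrite mul0b.
rewrite mulDb mulZb IH -(wd_val (rb1 Y)) wd_catl ?cats0 ?wd_val //.
exact: valP.
Qed.

Lemma wd_nil : wd [::] = mono (rb1 Y) :> A.
Proof. by rewrite -wd_val. Qed.

Definition linE :=
  (@rboD k Y, @rboZ k Y, @mulDb k lam Y, @mulbD k lam Y, @mulZb k lam Y,
   @mulbZ k lam Y).

Lemma rbo_mul_mono r s :
  rbo (mono r) ** rbo (mono s) =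
  rbo (mono r ** rbo (mono s) + rbo (mono r) ** mono s
       + lam *: (mono r ** mono s)).
Proof.
rewrite !rbo_mono_wd -wrap_nil -!(wd_val r, wd_val s) -wd_bracket_mul ?rb_bracket //.
  exact: valP.
exact: valP.
Qed.

Lemma rbo_mul f g :
  rbo f ** rbo g = rbo (f ** rbo g + rbo f ** g + lam *: (f ** g)).
Proof.
rewrite !linE; elim/rbalg_ind: f => [|c u f IHf].
  by rewrite rbo0 !mul0b rbo0 scaler0 !addr0.
rewrite !linE {}IHf; have -> : rbo (mono u) ** rbo g = rbo (mono u ** rbo g) +
    rbo (rbo (mono u) ** g) + lam *: rbo (mono u ** g).
  elim/rbalg_ind: g => [|d v g IHg].
    by rewrite rbo0 !mulb0 rbo0 scaler0 !addr0.
  by rewrite !linE {}IHg rbo_mul_mono !linE scale_addrACA.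
exact: scale_addrACA.
Qed.

Lemma wrapD u v f g : wrap u v (f + g) = wrap u v f + wrap u v g.
Proof. exact: linextD. Qed.

Lemma wrapZ u v c f : wrap u v (c *: f) = c *: wrap u v f.
Proof. exact: linextZ. Qed.

Lemma wrap0 u v : wrap u v 0 = 0.
Proof. exact: linext0. Qed.

Lemma wrap_mono u v r : wrap u v (mono r) = wd (u ++ Bracket r :: v).
Proof. exact: linext_mono. Qed.

Lemma bnd_wrap (B C : rbword Y -> Prop) u v f : bnd B f ->
  (forall r, B r -> is_rbword (u ++ Bracket r :: v)) ->
  (forall r (s : rbword Y), B r -> s = u ++ Bracket r :: v :> bword Y -> C s) ->
  bnd C (wrap u v f).
Proof.
move=> Bf rB BC; apply: (bnd_linext Bf) => r Br.
by rewrite wdE; apply: bnd_mono; apply: BC Br (rbval_insubd (rB _ Br)).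
Qed.

Lemma bnd_wd (B : rbword Y -> Prop) u : is_rbword u ->
  (forall r, r = u :> bword Y -> B r) -> bnd B (wd u).
Proof. by move=> ru Bu; rewrite wdE; apply: bnd_mono; apply: Bu; apply: rbval_insubd. Qed.

Lemma wrap_mulr u b v w f : is_rbword (u ++ Bracket b :: v ++ w) ->
  wrap u v f ** wd w = wrap u (v ++ w) f.
Proof.
move=> rw; elim/rbalg_ind: f => [|c r f IH]; first by rewrite !wrap0 mul0b.
rewrite !wrapD !wrapZ mulDb mulZb IH !wrap_mono wd_cat -?catA //.
exact: rb_subst_bracket (valP r) rw.
Qed.

Lemma wrap_mull u b v w f : is_rbword ((w ++ u) ++ Bracket b :: v) ->
  wd w ** wrap u v f = wrap (w ++ u) v f.
Proof.
move=> rw; elim/rbalg_ind: f => [|c r f IH]; first by rewrite !wrap0 mulb0.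
rewrite !wrapD !wrapZ mulbD mulbZ IH !wrap_mono wd_cat ?catA //.
exact: rb_subst_bracket (valP r) rw.
Qed.

(** A reduction takes place only between the last factor of [u] and the first factor of [v1]; with
    or without it, [v2] is attached unchanged. *)
Lemma wd_mul_catr u v1 v2 : is_rbword u -> is_rbword (v1 ++ v2) -> v1 != [::] ->
  wd u ** wd (v1 ++ v2) = (wd u ** wd v1) ** wd v2.
Proof.
move=> ru rv nv; have := rv; rewrite rb_cat => /and3P [rv1 rv2 j].
have [ju|/not_junction [u' [a [b [v' [eu ev]]]]]] := boolP (junction u v1).
  have ruv : is_rbword (u ++ v1 ++ v2).
    rewrite rb_cat ru rv; move: ju; rewrite /junction starts_cat.
    by case: (v1) nv.
  rewrite wd_cat // (wd_cat (u := u)) ?rb_cat ?ru ?rv1 // wd_cat -?catA //.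
move: rv rv1; rewrite ev cat_cons => rv rv1; move: ru; rewrite eu => ru.
rewrite (wd_bracket_mul ru rv) (wd_bracket_mul ru rv1) (@wrap_mulr _ b) //.
move: ru; rewrite rb_cat => /and3P [ru' _ ju'].
by rewrite rb_cat ru' rv.
Qed.

Lemma wd_mul_catl u1 u2 v : is_rbword v -> is_rbword (u1 ++ u2) -> u2 != [::] ->
  wd (u1 ++ u2) ** wd v = wd u1 ** (wd u2 ** wd v).
Proof.
move=> rv ru nu; have := ru; rewrite rb_cat => /and3P [ru1 ru2 j].
have [ju|/not_junction [u' [a [b [v' [eu ev]]]]]] := boolP (junction u2 v).
  have ruv : is_rbword (u1 ++ u2 ++ v).
    rewrite catA rb_cat ru rv; move: ju; rewrite /junction ends_cat.
    by case: (u2) nu.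
  rewrite [RHS](_ : _ = wd u1 ** wd (u2 ++ v)); last first.
    by rewrite (wd_cat (u := u2)) // rb_cat ru2 rv.
  by rewrite !wd_cat ?catA // -catA.
move: ru ru2; rewrite eu catA => ru ru2; move: rv; rewrite ev => rv.
rewrite (wd_bracket_mul ru rv) (wd_bracket_mul ru2 rv) (@wrap_mull _ b) //.
move: ru rv; rewrite -[Bracket b :: v']cat1s !rb_cat !rb_bracket.
move=> /and3P [/and3P [-> -> ->] ra j'] /and3P [-> -> jb] /=.
by rewrite jb; exact: j'.
Qed.

Lemma rbp_mul_catr f v1 v2 : is_rbword (v1 ++ v2) -> v1 != [::] ->
  f ** wd (v1 ++ v2) = (f ** wd v1) ** wd v2.
Proof.
move=> rv nv; elim/rbalg_ind: f => [|c r f IH]; first by rewrite !mul0b.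
by rewrite !mulDb !mulZb IH -wd_val wd_mul_catr //; apply: valP.
Qed.

Lemma rbp_mul_catl u1 u2 f : is_rbword (u1 ++ u2) -> u2 != [::] ->
  wd (u1 ++ u2) ** f = wd u1 ** (wd u2 ** f).
Proof.
move=> ru nu; elim/rbalg_ind: f => [|c r f IH]; first by rewrite !mulb0.
by rewrite !mulbD !mulbZ IH -wd_val wd_mul_catl //; apply: valP.
Qed.

(** If no word of [f] reduces against [v], their product is a concatenation, from which [v] can be
    cut off again. The next three lemmas treat the other positions of an unreduced junction. *)
Lemma assoc_junctionl f v g : is_rbword v -> v != [::] ->
  bnd (fun r => junction r v) f -> (f ** wd v) ** g = f ** (wd v ** g).
Proof.
move=> rv nv; elim/bnd_ind: f / => [|c r f jr IH]; first by rewrite !mul0b.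
have rrv : is_rbword (r ++ v) by rewrite rb_cat (valP r) rv.
by rewrite !mulDb !mulZb IH -wd_val wd_cat // rbp_mul_catl.
Qed.

Lemma assoc_junctionr f v g : is_rbword v -> v != [::] ->
  bnd (fun r => junction v r) g -> f ** (wd v ** g) = (f ** wd v) ** g.
Proof.
move=> rv nv; elim/bnd_ind: g / => [|c r g jr IH]; first by rewrite !mulb0.
have rrv : is_rbword (v ++ r) by rewrite rb_cat (valP r) rv.
by rewrite !mulbD !mulbZ IH -wd_val wd_cat // rbp_mul_catr.
Qed.

Lemma assoc_inner_junctionl u f g : is_rbword u ->
  bnd (fun r => r != [::] :> bword Y /\ junction u r) f ->
  (wd u ** f) ** g = wd u ** (f ** g).
Proof.
move=> ru; elim/bnd_ind: f / => [|c r f [nr jr] IH]; first by rewrite !(mulb0, mul0b).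
have rur : is_rbword (u ++ r) by rewrite rb_cat (valP r) ru.
by rewrite !(mulbD, mulDb, mulbZ, mulZb) IH -wd_val wd_cat // rbp_mul_catl.
Qed.

Lemma assoc_inner_junctionr w f g : is_rbword w ->
  bnd (fun r => r != [::] :> bword Y /\ junction r w) f ->
  (g ** f) ** wd w = g ** (f ** wd w).
Proof.
move=> rw; elim/bnd_ind: f / => [|c r f [nr jr] IH]; first by rewrite !(mulb0, mul0b).
have rrw : is_rbword (r ++ w) by rewrite rb_cat (valP r) rw.
by rewrite !(mulbD, mulDb, mulbZ, mulZb) IH -wd_val wd_cat // rbp_mul_catr.
Qed.

(** Merging two brackets leaves a bracket, so the outer ends keep their kind. A junction known for
    one factor is thus known for every word of a product. *)
Lemma bnd_mul_ends u v : is_rbword u -> is_rbword v -> u != [::] -> v != [::] ->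
  bnd (fun r => [/\ r != [::] :> bword Y,
                    starts_with_bracket r = starts_with_bracket u
                  & ends_with_bracket r = ends_with_bracket v]) (wd u ** wd v).
Proof.
move=> ru rv nu nv.
have [ju|/not_junction [u' [a [b [v' [eu ev]]]]]] := boolP (junction u v).
  have ruv : is_rbword (u ++ v) by rewrite rb_cat ru rv.
  rewrite wd_cat //; apply: bnd_wd => // r ->.
  by rewrite starts_cat ends_cat; case: (u) nu => //; case: (v) nv.
move: ru rv; rewrite eu ev => ru rv; rewrite (wd_bracket_mul ru rv).
apply: (@bnd_wrap (fun=> True)) => // [r _|r s _ ->].
  apply: (rb_subst_bracket (b := b) (valP r)).
  by move: ru; rewrite !rb_cat rv => /and3P [-> _].
split; first by case: (u').
- by rewrite !starts_cat.
- by rewrite ends_cat /= !ends_cons.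
Qed.

Lemma single_or_split u : u != [::] ->
  (exists x, u = [:: x]) \/
  exists x v, u = x :: v /\ v != [::].
Proof.
by case: u => [|x [|y v]] // _; [left; exists x | right; exists x, (y :: v)].
Qed.

(** Applying the Rota-Baxter relation twice expands each side into P of the same seven products, one
    for each way of stripping at least one of the three brackets; the hypotheses match them one by
    one. *)
Lemma assoc_brackets a b c : is_rbword a -> is_rbword b -> is_rbword c ->
  let Pa := wd [:: Bracket a] in let Pb := wd [:: Bracket b] in
  let Pc := wd [:: Bracket c] in
  let assoc x y z := (x ** y) ** z = x ** (y ** z) in
  assoc (wd a) Pb Pc -> assoc Pa (wd b) Pc -> assoc Pa Pb (wd c) ->
  assoc (wd a) (wd b) Pc -> assoc (wd a) Pb (wd c) -> assoc Pa (wd b) (wd c) ->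
  assoc (wd a) (wd b) (wd c) -> assoc Pa Pb Pc.
Proof.
move=> ra rb rc Pa Pb Pc assoc e1 e2 e3 e4 e5 e6 e7; rewrite /assoc.
have [da db dc] : [/\ Pa = rbo (wd a), Pb = rbo (wd b) & Pc = rbo (wd c)].
  by rewrite /Pa /Pb /Pc !rbo_wd.
have mab : Pa ** Pb = rbo (wd a ** Pb + Pa ** wd b + lam *: (wd a ** wd b)).
  by rewrite da db rbo_mul.
have mbc : Pb ** Pc = rbo (wd b ** Pc + Pb ** wd c + lam *: (wd b ** wd c)).
  by rewrite dc db rbo_mul.
set t := wd a ** Pb + _ + _ in mab; set t' := wd b ** Pc + _ + _ in mbc.
have -> : (Pa ** Pb) ** Pc = rbo (t ** Pc + (Pa ** Pb) ** wd c + lam *: (t ** wd c)).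
  by rewrite mab {1}dc rbo_mul -dc.
have -> : Pa ** (Pb ** Pc) =
    rbo (wd a ** (Pb ** Pc) + Pa ** t' + lam *: (wd a ** t')).
  by rewrite mbc {1}da rbo_mul -da.
rewrite /t /t' !(mulDb, mulbD, mulZb, mulbZ) e1 e2 e3 e4 e5 e6 e7 !scalerDr.
congr rbo; rewrite -!addrA; do 2!congr (_ + _).
rewrite addrCA; congr (_ + _); rewrite [RHS]addrCA; congr (_ + _).
exact: addrCA.
Qed.

Lemma rb_inv_cons x u : is_rbword (x :: u) -> is_rbword [:: x] /\ is_rbword u.
Proof. by rewrite -cat1s rb_cat => /and3P []. Qed.

Lemma fsize_gt0 (x : factor Y) : (0 < fsize x)%N.
Proof. by case: x. Qed.

Lemma wsize_cat u v : wsize (u ++ v) = (wsize u + wsize v)%N.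
Proof. by rewrite /wsize map_cat sumn_cat. Qed.

Lemma wsize_cons x u : wsize (x :: u) = (fsize x + wsize u)%N.
Proof. by []. Qed.

Lemma junction_eqr u v v' : starts_with_bracket v = starts_with_bracket v' ->
  junction u v = junction u v'.
Proof. by rewrite /junction => ->. Qed.

Lemma junction_eql u u' v : ends_with_bracket u = ends_with_bracket u' ->
  junction u v = junction u' v.
Proof. by rewrite /junction => ->. Qed.

(* Cutting a word between two factors never triggers a reduction, so words with
   several factors are split until three single brackets remain. *)
Lemma wd_mulA u v w : is_rbword u -> is_rbword v -> is_rbword w ->
  (wd u ** wd v) ** wd w = wd u ** (wd v ** wd w).
Proof.
have [N] := ubnP (wsize u + wsize v + wsize w).
elim: N u v w => // N IH u v w; rewrite ltnS => le_N ru rv rw.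
have [->|nu] := eqVneq u [::]; first by rewrite wd_nil !mul1b.
have [->|nv] := eqVneq v [::]; first by rewrite wd_nil !(mul1b, mulb1).
have [->|nw] := eqVneq w [::]; first by rewrite wd_nil !mulb1.
have [[x eu]|[x [u2 [eu nu2]]]] := single_or_split nu; last first.
  have [rx ru2] : is_rbword [:: x] /\ is_rbword u2 by apply: rb_inv_cons; rewrite -eu.
  have jx : junction [:: x] u2 by move: ru; rewrite eu -cat1s rb_cat => /and3P [].
  rewrite eu -cat1s !(@rbp_mul_catl [:: x] u2) ?cat1s -?eu //.
  rewrite assoc_inner_junctionl // ?IH //.
    apply: leq_trans le_N; rewrite !ltn_add2r eu wsize_cons.
    by rewrite -[X in (X < _)%N]add0n ltn_add2r fsize_gt0.
  apply: bndS (bnd_mul_ends ru2 rv nu2 nv) => r [nr sr _]; split=> //.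
  by rewrite (junction_eqr _ sr).
have [[z ew]|[w1 [z [ew nw1]]]] :
    (exists z, w = [:: z]) \/ exists w1 z, w = rcons w1 z /\ w1 != [::].
  case/lastP: (w) nw => [//|w1 z] _; case: w1 => [|z1 w1]; first by left; exists z.
  by right; exists (z1 :: w1), z.
all: swap 1 2.
  have [rw1 rz jz] : [/\ is_rbword w1, is_rbword [:: z] & junction w1 [:: z]].
    by move: rw; rewrite ew -cats1 rb_cat => /and3P [].
  rewrite ew -cats1 !(fun f => @rbp_mul_catr f w1 [:: z]) ?cats1 -?ew //.
  rewrite -assoc_inner_junctionr // ?IH //.
    apply: leq_trans le_N; rewrite ltn_add2l ew -cats1 wsize_cat wsize_cons.
    by rewrite -[X in (X < _)%N]addn0 ltn_add2l addn0 fsize_gt0.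
  apply: bndS (bnd_mul_ends rv rw1 nv nw1) => r [nr _ sr]; split=> //.
  by rewrite (junction_eql _ sr).
have [[y ev]|[y [v2 [ev nv2]]]] := single_or_split nv; last first.
  have [ry rv2] : is_rbword [:: y] /\ is_rbword v2 by apply: rb_inv_cons; rewrite -ev.
  have jy : junction [:: y] v2 by move: rv; rewrite ev -cat1s rb_cat => /and3P [].
  rewrite ev -cat1s (@rbp_mul_catr _ [:: y] v2) ?cat1s -?ev //.
  rewrite -[wd v]/(wd v) ev -cat1s (@rbp_mul_catl [:: y] v2) ?cat1s -?ev //.
  rewrite assoc_junctionl //; first rewrite [RHS]assoc_junctionr //.
    apply: bndS (bnd_mul_ends rv2 rw nv2 nw) => r [nr sr _].
    by rewrite (junction_eqr _ sr).
  apply: bndS (bnd_mul_ends ru ry nu isT) => r [nr _ sr].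
  by rewrite (junction_eql _ sr).
move: ru rv rw le_N; rewrite eu ev ew => ru rv rw le_N.
(* Three single factors remain. A letter among them makes a junction inert, so that only three
   brackets need the Rota-Baxter relation. *)
case: y rv le_N {ev} => [y|b] rv le_N.
  apply: assoc_junctionl => //; apply: bnd_wd => // r ->.
  by rewrite /junction andbF.
case: x ru le_N {eu} => [x|a] ru le_N.
  apply: assoc_inner_junctionl => //; apply: bnd_wd => // r ->.
  by rewrite /junction.
case: z rw le_N {ew} => [z|c] rw le_N.
  apply: assoc_inner_junctionr => //; apply: bnd_wd => // r ->.
  by rewrite /junction andbF.
move: ru rv rw le_N; rewrite !rb_bracket !wsize_bracket => ra rb rc le_N.
have s0 : wsize ([::] : bword Y) = 0%N by [].
apply: assoc_brackets => //; apply: IH; rewrite ?rb_bracket ?wsize_bracket //;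
  rewrite ?s0 in le_N *; lia.
Qed.

Lemma rbpA f g h : (f ** g) ** h = f ** (g ** h).
Proof.
elim/rbalg_ind: f => [|c u f IHf]; first by rewrite !mul0b.
rewrite !(mulDb, mulZb) {}IHf; congr (_ *: _ + _).
elim/rbalg_ind: g => [|d v g IHg]; first by rewrite !(mul0b, mulb0).
rewrite !(mulDb, mulZb, mulbD, mulbZ) {}IHg; congr (_ *: _ + _).
elim/rbalg_ind: h => [|e w h IHh]; first by rewrite !mulb0.
rewrite !(mulbD, mulbZ) {}IHh; congr (_ *: _ + _).
by rewrite -!wd_val wd_mulA //; apply: valP.
Qed.
End WordProduct.

(** * The derivation and the reduction map *)

HB.lock Definition rbd (k : comPzRingType) (lam : k) (X : choiceType) (n : nat)
  (f : rbalg k (diffvar n X)) : rbalg k (diffvar n X) := der lam f.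

Lemma assoc_leibniz (k : comPzRingType) (V : lmodType k) (lam : k)
    (a b c ab bc ac abc : V) :
  (a + b + lam *: ab) + c + lam *: (ac + bc + lam *: abc) =
  a + (b + c + lam *: bc) + lam *: (ab + ac + lam *: abc).
Proof.
rewrite !scalerDr -!addrA; do 2!congr (_ + _).
rewrite addrCA; congr (_ + _); rewrite [RHS]addrCA; congr (_ + _).
exact: addrCA.
Qed.

Section DerivationLaws.
Variables (k : comPzRingType) (lam : k) (X : choiceType) (n : nat).
Local Notation Y := (diffvar n X).
Local Notation A := (rbalg k Y).
Local Notation "f ** g" := (rbp lam f g) (at level 40, left associativity).
Local Notation wd := (@wd k Y).
Local Notation rbd := (@rbd k lam X n).
Implicit Types (f g h : A) (u v w : bword Y) (r : rbword Y).

Lemma rbdE f : rbd f = der lam f.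
Proof. by rewrite rbd.unlock. Qed.

Lemma rbd0 : rbd 0 = 0.
Proof. by rewrite rbdE; exact: linext0. Qed.

Lemma rbdD f g : rbd (f + g) = rbd f + rbd g.
Proof. by rewrite !rbdE; exact: linextD. Qed.

Lemma rbdZ c f : rbd (c *: f) = c *: rbd f.
Proof. by rewrite !rbdE; exact: linextZ. Qed.

Lemma rbd_wd u : is_rbword u -> rbd (wd u) = derw lam u.
Proof.
by move=> ru; rewrite rbdE wdE /mon /der linext_mono rbval_insubd.
Qed.

Lemma rbd_nil : rbd (wd [::]) = 0.
Proof. by rewrite rbd_wd. Qed.

Lemma derw1 (x : factor Y) : derw lam [:: x] = derf k x.
Proof. by rewrite /= -!rbpE -wdE wd_nil mulb1 !mulb0 scaler0 !addr0. Qed.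

Lemma rbd_letter y :
  rbd (wd [:: Letter y]) = if shiftv 1 y is Some z then wd [:: Letter z] else 0.
Proof. by rewrite rbd_wd // derw1 /=; case: shiftv => // z; rewrite wdE. Qed.

Lemma rbd_rbo f : rbd (rbo f) = f.
Proof.
elim/rbalg_ind: f => [|c u f IH]; first by rewrite rbo0 rbd0.
rewrite rboD rboZ rbdD rbdZ IH; congr (_ *: _ + _).
have ru : is_rbword [:: Bracket u] by rewrite rb_bracket; apply: valP.
by rewrite rbo_mono_wd (rbd_wd ru) derw1 -wd_val wdE.
Qed.

Definition leibniz f g : Prop :=
  rbd (f ** g) = rbd f ** g + f ** rbd g + lam *: (rbd f ** rbd g).

Lemma leibniz_cons x u : is_rbword (x :: u) -> leibniz (wd [:: x]) (wd u).
Proof.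
move=> rxu; have [rx ru] := rb_inv_cons rxu; rewrite /leibniz wd_cat //.
rewrite (rbd_wd rxu) (rbd_wd ru) (rbd_wd rx) derw1.
by rewrite /= -!rbpE -!wdE.
Qed.

Lemma leibniz0l g : leibniz 0 g.
Proof. by rewrite /leibniz !(rbd0, mul0b, scaler0, addr0). Qed.

Lemma leibniz0r f : leibniz f 0.
Proof. by rewrite /leibniz !(rbd0, mulb0, scaler0, addr0). Qed.

Lemma leibnizDl c f f' g : leibniz f g -> leibniz f' g -> leibniz (c *: f + f') g.
Proof.
rewrite /leibniz !(rbdD, rbdZ, mulDb, mulZb) => -> ->.
exact: scale_addrACA.
Qed.

Lemma leibnizDr c f g g' : leibniz f g -> leibniz f g' -> leibniz f (c *: g + g').
Proof.
rewrite /leibniz !(rbdD, rbdZ, mulbD, mulbZ) => -> ->.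
exact: scale_addrACA.
Qed.

(** Both sides give the symmetric seven-term formula for d(fgh). This lets the cut in a product of
    three be moved. *)
Lemma leibniz_assoc f g h : leibniz f g -> leibniz g h ->
  leibniz (f ** g) h <-> leibniz f (g ** h).
Proof.
move=> fg gh; rewrite /leibniz fg gh rbpA.
rewrite !(mulDb, mulbD, mulZb, mulbZ, rbpA) assoc_leibniz.
by split=> ->.
Qed.

Lemma leibniz_cat u v : is_rbword (u ++ v) -> leibniz (wd u) (wd v).
Proof.
elim: u => [|x u IH] ruv.
  by rewrite /leibniz rbd_nil wd_nil !(mul1b, mul0b) scaler0 add0r addr0.
have [_ ruv'] := rb_inv_cons ruv.
have rxu : is_rbword (x :: u) by move: ruv; rewrite rb_cat => /andP [].
rewrite -[x :: u]cat1s -(wd_cat lam) //.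
apply/(leibniz_assoc (leibniz_cons rxu) (IH ruv')).
by rewrite wd_cat //; apply: leibniz_cons.
Qed.

Lemma leibniz_bndl u g : is_rbword u -> bnd (fun r => junction u r) g ->
  leibniz (wd u) g.
Proof.
move=> ru; elim/bnd_ind: g / => [|c r g jr IH]; first exact: leibniz0r.
apply: leibnizDr IH; rewrite -wd_val; apply: leibniz_cat.
by rewrite rb_cat ru (valP r).
Qed.

Lemma leibniz_bndr f v : is_rbword v -> bnd (fun r => junction r v) f ->
  leibniz f (wd v).
Proof.
move=> rv; elim/bnd_ind: f / => [|c r f jr IH]; first exact: leibniz0l.
apply: leibnizDl IH; rewrite -wd_val; apply: leibniz_cat.
by rewrite rb_cat rv (valP r).
Qed.

(** Since d(P(u)) = u, the Leibniz rule of weight lam on two brackets is the image of the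
    Rota-Baxter relation under d. *)
Lemma leibniz_rbo f g : leibniz (rbo f) (rbo g).
Proof. by rewrite /leibniz rbo_mul !rbd_rbo. Qed.

(** For u = u'P(a) and v = P(b)v', [leibniz_assoc] moves the cut until P(a)P(b) stands alone. The
    other cuts need no reduction, because the words of P(a)P(b) begin and end with brackets as the
    factors do. *)
Lemma leibniz_wd u v : is_rbword u -> is_rbword v -> leibniz (wd u) (wd v).
Proof.
move=> ru rv.
have [ju|/not_junction [u' [a [b [v' [eu ev]]]]]] := boolP (junction u v).
  by apply: leibniz_cat; rewrite rb_cat ru rv.
move: (ru) (rv); rewrite eu ev -[Bracket b :: v']cat1s !rb_cat !rb_bracket.
move=> /and3P [ru' ra ju] /and3P [rb rv' jv].
have rPa : is_rbword [:: Bracket a] by rewrite rb_bracket.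
have rPb : is_rbword [:: Bracket b] by rewrite rb_bracket.
rewrite -(wd_cat lam (u := u')) ?rb_cat ?ru' ?ju ?rPa //.
have lPab : leibniz (wd [:: Bracket a]) (wd [:: Bracket b]).
  by rewrite -!rbo_wd //; apply: leibniz_rbo.
have lu : leibniz (wd u') (wd [:: Bracket a]).
  by apply: leibniz_cat; rewrite rb_cat ru' rPa ju.
have rPbv : is_rbword ([:: Bracket b] ++ v') by rewrite rb_cat rPb rv' jv.
rewrite -(wd_cat lam rPbv).
apply/(leibniz_assoc (f := wd u' ** wd [:: Bracket a])).
- apply/(leibniz_assoc lu lPab); apply: leibniz_bndl => //.
  apply: bndS (bnd_mul_ends rPa rPb isT isT) => r [_ sr _].
  by rewrite (junction_eqr _ sr).
- exact: leibniz_cat.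
have ruPa : is_rbword (u' ++ [:: Bracket a]) by rewrite rb_cat ru' rPa ju.
rewrite wd_cat //; apply: leibniz_bndr => //.
apply: bndS (bnd_mul_ends ruPa rPb _ isT) => [r [_ _ sr]|].
  by rewrite (junction_eql _ sr).
by case: (u').
Qed.

Lemma rbdM f g : rbd (f ** g) = rbd f ** g + f ** rbd g + lam *: (rbd f ** rbd g).
Proof.
elim/rbalg_ind: f => [|c u f IHf]; first exact: leibniz0l.
apply: leibnizDl IHf; elim/rbalg_ind: g => [|d v g IHg]; first exact: leibniz0r.
by apply: leibnizDr IHg; rewrite -!wd_val; apply: leibniz_wd; apply: valP.
Qed.
End DerivationLaws.

Section Reduction.
Variables (k : comPzRingType) (lam : k) (Y : choiceType).
Local Notation A := (rbalg k Y).
Local Notation "f ** g" := (rbp lam f g) (at level 40, left associativity).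
Implicit Types (u v w : bword Y).

Lemma Red_nil : Red lam [::] = wd k [::] :> A.
Proof. by rewrite wd_nil. Qed.

Lemma Red_cons x u : Red lam (x :: u) = Redf lam x ** Red lam u.
Proof. by rewrite rbpE. Qed.

Lemma Red1 (x : factor Y) : Red lam [:: x] = Redf lam x.
Proof. by rewrite Red_cons Red_nil wd_nil mulb1. Qed.

Lemma Red_cat u v : Red lam (u ++ v) = Red lam u ** Red lam v.
Proof.
elim: u => [|x u IH]; first by rewrite Red_nil wd_nil mul1b.
by rewrite cat_cons !Red_cons IH rbpA.
Qed.

Lemma Red_bracket u : Red lam [:: Bracket u] = rbo (Red lam u).
Proof. by rewrite Red1 rboE. Qed.

Lemma Red_letter (y : Y) : Red lam [:: Letter y] = wd k [:: Letter y].
Proof. by rewrite Red1 wdE. Qed.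

Lemma Red_rb u : is_rbword u -> Red lam u = wd k u.
Proof.
have Red_factors v :
    foldr (fun x => and (is_rbword [:: x] -> Red lam [:: x] = wd k [:: x])) True v ->
    is_rbword v -> Red lam v = wd k v.
  elim: v => [|x v IH]; first by rewrite Red_nil.
  move=> [Rx Rv] rxv; have [rx rv] := rb_inv_cons rxv.
  by rewrite -cat1s Red_cat Rx // IH // wd_cat.
have Red_factor (x : factor Y) : is_rbword [:: x] -> Red lam [:: x] = wd k [:: x].
  elim: x => [y|w IH]; first by rewrite Red_letter.
  by rewrite rb_bracket Red_bracket => rw; rewrite (Red_factors _ IH) // rbo_wd.
by apply: Red_factors; elim: u => [|x u IH] //; split=> [|//]; apply: Red_factor.
Qed.
End Reduction.

(** * The order on words *)

Section WordOrderTheory.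
Variables (disp : Order.disp_t) (X : orderType disp) (n : nat).
Local Notation Y := (diffvar n X).
Implicit Types (f g h : factor Y) (u v w : bword Y).

Definition wbrackets u : nat := sumn (map (@fbrackets Y) u).

Lemma wbrackets_cat u v : wbrackets (u ++ v) = (wbrackets u + wbrackets v)%N.
Proof. by rewrite /wbrackets map_cat sumn_cat. Qed.

Lemma wbrackets_cons f u : wbrackets (f :: u) = (fbrackets f + wbrackets u)%N.
Proof. by []. Qed.

Lemma ltdeg_irr a : ltdeg a a = false.
Proof. by rewrite /ltdeg !ltnn andbF. Qed.

Lemma ltdeg_trans b a c : ltdeg a b -> ltdeg b c -> ltdeg a c.
Proof. case: a b c => [a1 a2] [b1 b2] [c1 c2]; rewrite /ltdeg /=; lia. Qed.

Lemma ltdeg_total a b : [\/ ltdeg a b, a = b | ltdeg b a].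
Proof.
case: a b => [a1 a2] [b1 b2]; rewrite /ltdeg /=.
have [->|] := eqVneq a1 b1; have [->|] := eqVneq a2 b2.
- by constructor 2.
- by rewrite !ltnn !andTb; case: ltngtP => // _ _; [constructor 1 | constructor 3].
- by case: ltngtP => // _ _; [constructor 1 | constructor 3].
- by case: (ltngtP a1) => // _ _ _; [constructor 1 | constructor 3].
Qed.

(** The local fixpoint inside [ltf] is convertible to [ltlex]. Words are thus compared as the
    brackets around them, and transitivity and totality of [ltw] are read off from [ltf]. *)
Lemma ltf_bracket u v : ltf (Bracket u) (Bracket v) = ltw u v.
Proof. by []. Qed.

Lemma ltf_letter_bracket y u : ltf (Letter y) (Bracket u : factor Y).
Proof. rewrite /= /ltdeg /= /wsize /=; lia. Qed.

Lemma ltf_bracket_letter y u : ltf (Bracket u : factor Y) (Letter y) = false.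
Proof. rewrite /= /ltdeg /= /wsize /=; lia. Qed.

Lemma fsize_mem f u : f \in u -> (fsize f <= wsize u)%N.
Proof.
by move=> fu; rewrite /wsize sumnE big_map (big_rem f fu) /= leq_addr.
Qed.

Lemma ltletter_irr (y : Y) : ltletter y y = false.
Proof. by rewrite /ltletter ltxx ltnn andbF. Qed.

Lemma ltletter_trans (z y t : Y) : ltletter y z -> ltletter z t -> ltletter y t.
Proof.
rewrite /ltletter => /orP [yz|/andP [/eqP -> yz]] /orP [zt|/andP [/eqP e zt]].
- by rewrite (lt_trans yz zt).
- by rewrite -e yz.
- by rewrite zt.
- by rewrite e eqxx (ltn_trans zt yz) orbT.
Qed.

Lemma ltletter_total (y z : Y) : [\/ ltletter y z, y = z | ltletter z y].
Proof.
case: y z => [x i] [y j]; rewrite /ltletter /=.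
case: (ltgtP x y) => [_|_|->]; [by constructor 1|by constructor 3|].
by case: (ltngtP i j) => [_|_|/val_inj ->]; [constructor 3|constructor 1|constructor 2].
Qed.

Lemma ltf_irr f : ltf f f = false.
Proof.
have [N] := ubnP (fsize f); elim: N f => // N IH [y|u] /=; first by rewrite ltletter_irr.
rewrite ltnS => le_u; rewrite ltdeg_irr eqxx /= -/(ltlex u u).
have {le_u} : {in u, forall f, ltf f f = false}.
  by move=> f fu; apply: IH; apply: leq_ltn_trans (fsize_mem fu) le_u.
elim: u => //= f u IHu irr; rewrite irr ?mem_head // eqxx /=.
by apply: IHu => g gu; apply: irr; rewrite inE gu orbT.
Qed.

Lemma ltlex_irr u : ltlex u u = false.
Proof. by elim: u => //= f u ->; rewrite ltf_irr andbF. Qed.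

Lemma ltw_irr u : ltw u u = false.
Proof. by rewrite /ltw ltdeg_irr eqxx ltlex_irr. Qed.

Lemma ltf_trans g f h : ltf f g -> ltf g h -> ltf f h.
Proof.
have [N] := ubnP (fsize g); elim: N f g h => // N IH.
case=> [x|u] [y|v] [z|w] leN;
  rewrite ?ltf_letter_bracket ?ltf_bracket_letter ?ltf_bracket //.
  exact: ltletter_trans.
have lex_trans : ltlex u v -> ltlex v w -> ltlex u w.
  have : {in v, forall f, fsize f < N}%N.
    by move=> f fv; apply: leq_ltn_trans (fsize_mem fv) leN.
  elim: v u w {leN} => [|g v IHv] [|f u] [|h w] //= lev.
  have IHg : (fsize g < N)%N by apply: lev; rewrite mem_head.
  move=> /orP [fg|/andP [/eqP -> uv]] /orP [gh|/andP [/eqP e vw]].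
  - by rewrite (IH _ _ _ IHg fg gh).
  - by rewrite -e fg.
  - by rewrite gh.
  - rewrite e eqxx (IHv u w) ?orbT // => f' f'v; apply: lev.
    by rewrite inE f'v orbT.
rewrite /ltw => /orP [uv|/andP [/eqP -> uv]] /orP [vw|/andP [/eqP e vw]].
- by rewrite (ltdeg_trans uv vw).
- by rewrite -e uv.
- by rewrite vw.
- by rewrite e eqxx lex_trans ?orbT.
Qed.

Lemma ltw_trans v u w : ltw u v -> ltw v w -> ltw u w.
Proof. by rewrite -!ltf_bracket; apply: ltf_trans. Qed.

Lemma ltf_total f g : [\/ ltf f g, f = g | ltf g f].
Proof.
have [N] := ubnP (fsize f); elim: N f g => // N IH [y|u] [z|v] leN.
- by have [|->|] := ltletter_total y z; [constructor 1|constructor 2|constructor 3].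
- by constructor 1; apply: ltf_letter_bracket.
- by constructor 3; apply: ltf_letter_bracket.
have lex_total : [\/ ltlex u v, u = v | ltlex v u].
  have : {in u, forall f, fsize f < N}%N.
    by move=> f fu; apply: leq_ltn_trans (fsize_mem fu) leN.
  elim: u v {leN} => [|f u IHu] [|g v] leu; [by constructor 2|by constructor 1|by constructor 3|].
  have [fg|->|gf] := IH f g (leu _ (mem_head _ _)).
  - by constructor 1; rewrite /= fg.
  - have [||->|] := IHu v.
    + by move=> f' f'u; apply: leu; rewrite inE f'u orbT.
    + by move=> uv; constructor 1; rewrite /= eqxx uv orbT.
    + by constructor 2.
    + by move=> vu; constructor 3; rewrite /= eqxx vu orbT.
  - by constructor 3; rewrite /= gf.
rewrite !ltf_bracket /ltw.
have [->|e|->] := ltdeg_total (wdeg u) (wdeg v); [by constructor 1| |by constructor 3].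
rewrite e eqxx; case: lex_total => [->|->|->]; rewrite ?orbT;
  [by constructor 1|by constructor 2|by constructor 3].
Qed.

Lemma ltw_total u v : [\/ ltw u v, u = v | ltw v u].
Proof.
have [lt_uv|[->]|lt_vu] := ltf_total (Bracket u) (Bracket v);
  [by constructor 1|by constructor 2|by constructor 3].
Qed.

Lemma lewW u v : ltw u v -> lew u v.
Proof. by rewrite /lew => ->; rewrite orbT. Qed.

Lemma lew_refl u : lew u u.
Proof. by rewrite /lew eqxx. Qed.

Lemma lew_trans v u w : lew u v -> lew v w -> lew u w.
Proof.
rewrite /lew => /orP [/eqP -> //|uv] /orP [/eqP <-|vw]; first by rewrite uv orbT.
by rewrite (ltw_trans uv vw) orbT.
Qed.

Lemma lew_ltw_trans v u w : lew u v -> ltw v w -> ltw u w.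
Proof. by move=> /orP [/eqP -> //|]; apply: ltw_trans. Qed.

Lemma ltw_lew_trans v u w : ltw u v -> lew v w -> ltw u w.
Proof. by move=> uv /orP [/eqP <- //|]; apply: ltw_trans. Qed.

Lemma ltw_lew_false u v : ltw u v -> lew v u -> False.
Proof. by move=> uv /(ltw_lew_trans uv); rewrite ltw_irr. Qed.

Lemma lew_total u v : ltw u v \/ lew v u.
Proof.
have [uv|->|vu] := ltw_total u v; [by left|right; exact: lew_refl|right].
exact: lewW.
Qed.

Definition wmax u v := if ltw u v then v else u.

Lemma lew_maxl u v : lew u (wmax u v).
Proof. by rewrite /wmax; case: ifP => [/lewW|_] //; apply: lew_refl. Qed.

Lemma lew_maxr u v : lew v (wmax u v).
Proof.
rewrite /wmax; case: ifP => [_|uv]; first exact: lew_refl.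
by case: (lew_total u v); rewrite ?uv.
Qed.

Lemma wmax_lt u v w : ltw u w -> ltw v w -> ltw (wmax u v) w.
Proof. by rewrite /wmax; case: ifP. Qed.

Lemma ltlex_catl p u v : ltlex (p ++ u) (p ++ v) = ltlex u v.
Proof. by elim: p => //= f p ->; rewrite ltf_irr eqxx. Qed.

Lemma size_leq_wsize u : (size u <= wsize u)%N.
Proof.
elim: u => //= f u IH; rewrite wsize_cons -add1n; apply: leq_add IH.
exact: fsize_gt0.
Qed.

Lemma wsize0 u : wsize u = 0%N -> u = [::].
Proof. by move=> u0; apply/nilP; rewrite /nilp -leqn0 -u0 size_leq_wsize. Qed.

(** Equal sizes exclude that one word is a proper prefix of the other, since every factor has
    positive size; so a first differing factor exists. *)
Lemma ltlex_split u v : wsize u = wsize v -> ltlex u v ->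
  exists p f g u1 v1, [/\ u = p ++ f :: u1, v = p ++ g :: v1 & ltf f g].
Proof.
elim: u v => [|f u IH] [|g v] //; first by move/esym/wsize0.
rewrite !wsize_cons /= => e /orP [fg|/andP [/eqP fg uv]].
  by exists [::], f, g, u, v.
move: e; rewrite fg => /addnI e; have [p [f' [g' [u1 [v1 [-> -> lt]]]]]] := IH _ e uv.
by exists (g :: p), f', g', u1, v1.
Qed.

Lemma wdeg_wsize u v : wdeg u = wdeg v -> wsize u = wsize v.
Proof. by case. Qed.

Lemma wdeg_cat u v :
  wdeg (u ++ v) = ((wdeg u).1 + (wdeg v).1, (wdeg u).2 + (wdeg v).2)%N.
Proof. by rewrite /wdeg wsize_cat map_cat sumn_cat. Qed.

Lemma ltdeg_add a b c d : ltdeg a b -> (c == d) || ltdeg c d ->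
  ltdeg (a.1 + c.1, a.2 + c.2)%N (b.1 + d.1, b.2 + d.2)%N.
Proof.
case: a b c d => [a1 a2] [b1 b2] [c1 c2] [d1 d2]; rewrite /ltdeg xpair_eqE /=; lia.
Qed.

Lemma ltw_catl p u v : ltw (p ++ u) (p ++ v) = ltw u v.
Proof.
rewrite /ltw ltlex_catl !wdeg_cat; congr (_ || _ && _).
  by rewrite /ltdeg /= ltn_add2l eqn_add2l ltn_add2l.
by rewrite xpair_eqE !eqn_add2l.
Qed.

Lemma ltw_catr t u v : ltw u v -> ltw (u ++ t) (v ++ t).
Proof.
rewrite /ltw !wdeg_cat => /orP [uv|/andP [/eqP e uv]].
  by rewrite (@ltdeg_add _ _ (wdeg t) (wdeg t)) ?eqxx.
have [p [f [g [u1 [v1 [eu ev fg]]]]]] := ltlex_split (wdeg_wsize e) uv.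
by rewrite e eqxx eu ev -!catA ltlex_catl /= fg !orbT.
Qed.

Lemma lew_cat a b u v : lew u v -> lew (a ++ u ++ b) (a ++ v ++ b).
Proof.
move=> /orP [/eqP -> |uv]; first exact: lew_refl.
by apply: lewW; rewrite ltw_catl; apply: ltw_catr.
Qed.

Lemma ltw_wsize u v : ltw u v -> (wsize u <= wsize v)%N.
Proof.
rewrite /ltw /ltdeg => /orP [/orP [/ltnW //|/andP [/eqP e _]]|/andP [/eqP e _]].
  by move: e => /= ->.
by rewrite (wdeg_wsize e).
Qed.

Lemma wsize_ltw u v : (wsize u < wsize v)%N -> ltw u v.
Proof. by rewrite /ltw /ltdeg /= => ->. Qed.

Lemma ltf_fsize f g : ltf f g -> (fsize f <= fsize g)%N.
Proof.
case: f g => [x|u] [y|v]; rewrite ?ltf_bracket_letter ?ltf_bracket //.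
exact: ltw_wsize.
Qed.

Lemma fsize_ltf f g : (fsize f < fsize g)%N -> ltf f g.
Proof.
case: f g => [x|u] [y|v]; rewrite ?ltf_letter_bracket ?ltf_bracket //.
by rewrite /= !ltnS; apply: wsize_ltw.
Qed.

(** Bracketing adds one to both components of the degree, which keeps their order and leaves ties to
    the contents. *)
Lemma ltw_bracket u v : ltw [:: Bracket u] [:: Bracket v] = ltw u v.
Proof.
rewrite [LHS]/ltw /= andbF orbF -/(ltw u v) {1}/ltw /ltdeg /wdeg /wsize /= !addn0.
rewrite !ltnS !eqSS !xpair_eqE /= !eqSS; apply/idP/idP; last first.
  rewrite /ltw /ltdeg /wdeg /wsize xpair_eqE /= => /orP [-> //|/andP [-> lex]].
  by rewrite lex !orbT.
rewrite {1}/ltw /ltdeg /wdeg /wsize xpair_eqE /=.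
by move=> /orP [-> //|/andP [_]].
Qed.

Lemma lew_bracket u v : lew u v -> lew [:: Bracket u] [:: Bracket v].
Proof.
by move=> /orP [/eqP -> |uv]; [apply: lew_refl | apply: lewW; rewrite ltw_bracket].
Qed.

Lemma lew_nil u : lew [::] u.
Proof.
have [->|nu] := eqVneq u [::]; first exact: lew_refl.
apply/lewW/wsize_ltw; rewrite lt0n; apply: contraNneq nu.
by move=> /wsize0 ->.
Qed.

(** * Well-foundedness of the order on words *)

Definition ltw_bounded L a u v :=
  [&& ltlex u v, (size u <= L)%N & all (fun f => fsize f <= a)%N u].
Local Notation ltfr := (fun f g : factor Y => is_true (ltf f g)).
Local Notation ltwr := (fun u v : bword Y => is_true (ltw u v)).
Local Notation ltw_boundedr L a :=
  (fun u v : bword Y => is_true (ltw_bounded L a u v)).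

(** On words of unbounded length a lexicographic order has infinite descents, hence the bounds on
    the smaller word. The induction is on [L], then on the first factor, then on the remaining
    factors, which are bounded by the predecessor of the length bound. *)
Lemma acc_ltw_bounded a L v :
  (forall f, (fsize f <= a)%N -> Acc ltfr f) ->
  all (fun f => fsize f <= a)%N v -> Acc (ltw_boundedr L a) v.
Proof.
move=> acc_ltf; elim: L v => [|L IHL] v small_v.
  constructor=> u /and3P [lt_uv]; rewrite leqn0 => /nilP u0; rewrite {}u0 in lt_uv *.
  by move=> _; constructor=> -[|g w] /and3P [].
have acc_nil : Acc (ltw_boundedr L.+1 a) [::] by constructor=> -[|g w] /and3P [].
case: v small_v => [_|f v /= /andP [small_f small_v]]; first exact: acc_nil.
have {small_f} acc_f := acc_ltf f small_f.
elim/Acc_ind: f / acc_f v small_v => f _ IHf v small_v.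
have {small_v} acc_v := IHL v small_v.
elim/Acc_ind: v / acc_v => v _ IHv.
constructor=> -[_|g u]; first exact: acc_nil.
move=> /and3P [/= /orP [gf|/andP [/eqP -> uv]] size_u /andP [_ small_u]].
  exact: IHf.
by apply: IHv; rewrite /ltw_bounded uv small_u andbT.
Qed.

(** Nested inductions on the size, on the number of brackets and on [ltw_bounded]: the breadth and
    all factor sizes are at most the size, so at constant degree the lexicographic comparison is a
    bounded one. *)
Lemma acc_ltw_wsize N :
  (forall f, (fsize f <= N)%N -> Acc ltfr f) ->
  forall v, (wsize v <= N)%N -> Acc ltwr v.
Proof.
move=> acc_ltf v; move: {2}(wsize v) (leqnn (wsize v)) => a.
elim/ltn_ind: a v => a IHa v le_va le_aN.
move: {2}(wbrackets v) (leqnn (wbrackets v)) => b.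
elim/ltn_ind: b v le_va le_aN => b IHb v le_va le_aN le_vb.
have small_v w : all (fun f => fsize f <= wsize w)%N w.
  by apply/allP => f /fsize_mem.
have acc_v : Acc (ltw_boundedr (wsize v) (wsize v)) v.
  apply: acc_ltw_bounded (small_v v) => f fv.
  exact/acc_ltf/(leq_trans fv).
(* The bounds are frozen at [c]: while [v] descends at constant degree, its size stays [c]. *)
move: {2 3 4}(wsize v) (erefl (wsize v)) acc_v => c ec acc_v.
move: le_va le_aN le_vb ec; elim/Acc_ind: v / acc_v => v _ IHv le_va le_aN le_vb ec.
constructor=> u /orP [/orP [lt_uv|/andP [/eqP e lt_uv]]|/andP [/eqP [e1 e2] uv]].
- apply: (IHa _ (leq_trans lt_uv le_va) u (leqnn _)).
  exact: leq_trans (ltnW lt_uv) le_aN.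
- by apply: (IHb _ (leq_trans lt_uv le_vb) u _ _ (leqnn _)); rewrite (e : wsize u = _).
- apply: IHv; rewrite ?e1 // /wbrackets ?e2 //.
  by rewrite /ltw_bounded uv -ec -e1 size_leq_wsize small_v.
Qed.

Lemma ltw_wf (ltletter_wf : forall y : Y, Acc (fun y z : Y => ltletter y z) y) u : Acc ltwr u.
Proof.
have acc_letter y : Acc ltfr (Letter y : factor Y).
  elim/Acc_ind: y / (ltletter_wf y) => y _ IH; constructor=> -[z|w]; first exact: IH.
  by rewrite ltf_bracket_letter.
suff acc_ltf N f : (fsize f <= N)%N -> Acc ltfr f.
  by apply: (acc_ltw_wsize (N := wsize u)) (leqnn _) => f; apply: acc_ltf.
elim: N f => [|N IH] f; first by rewrite leqNgt fsize_gt0.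
case: f => [y _|w le_wN]; first exact: acc_letter.
(* The content is one symbol smaller than the bracket, so the induction on [N] makes it
   accessible. *)
have {le_wN} acc_w := acc_ltw_wsize IH (v := w) le_wN.
elim/Acc_ind: w / acc_w => w _ IHw.
by constructor=> -[y _|v]; [apply: acc_letter | rewrite ltf_bracket => /IHw].
Qed.

(** * A monotone bound for the words of a product *)

Fixpoint mx_rec (fuel : nat) u v : bword Y :=
  if fuel is m.+1 then
    match rev u, v with
    | Bracket a :: ru, Bracket b :: v' =>
        rev ru ++ Bracket (wmax (mx_rec m a [:: Bracket b])
                                (mx_rec m [:: Bracket a] b)) :: v'
    | _, _ => u ++ v
    end
  else [::].

(* The largest word that can occur in the product of [u] and [v]; unlike the
   leading word of the product, it is insensitive to cancellation in [k]. *)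
Definition mx u v := mx_rec (wsize u + wsize v).+1 u v.

Lemma mx_recE m u v : (wsize u + wsize v < m)%N -> mx_rec m u v = mx u v.
Proof.
suff rec_eq p q : (wsize u + wsize v < p)%N -> (wsize u + wsize v < q)%N ->
    mx_rec p u v = mx_rec q u v by move=> /rec_eq; apply.
elim: p q u v => [|p IHp] [|q] u v //= hp hq.
case Eu: (rev u) => [|[y|a] ru] //; case: v hp hq => [|[y|b] v'] //.
have -> : wsize u = (wsize a + wsize ru).+1 by rewrite -wsize_rev Eu.
rewrite wsize_bracket => hp hq.
have s0 : wsize ([::] : bword Y) = 0%N by [].
by congr (_ ++ Bracket (wmax _ _) :: _); apply: IHp; rewrite ?wsize_bracket s0;
  move: hp hq; move: (wsize a) (wsize b) (wsize ru) (wsize v'); lia.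
Qed.

Lemma mx_cat u v : junction u v -> mx u v = u ++ v.
Proof.
rewrite /junction /ends_with_bracket /mx /=; case: (rev u) => [|[y|a] ru] //.
by case: v => [|[y|b] v].
Qed.

Lemma mxE u v :
  mx u v =
    match rev u, v with
    | Bracket a :: ru, Bracket b :: v' =>
        rev ru ++ Bracket (wmax (mx a [:: Bracket b]) (mx [:: Bracket a] b)) :: v'
    | _, _ => u ++ v
    end.
Proof.
rewrite {1}/mx /=; case Eu: (rev u) => [|[y|a] ru] //; case: v => [|[y|b] v'] //.
have Hu : wsize u = (wsize a + wsize ru).+1 by rewrite -wsize_rev Eu.
have s0 : wsize ([::] : bword Y) = 0%N by [].
by rewrite !mx_recE // ?Hu !wsize_bracket ?s0;
  move: (wsize a) (wsize b) (wsize ru) (wsize v'); lia.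
Qed.

Lemma mx_brackets u a b v :
  mx (u ++ [:: Bracket a]) (Bracket b :: v) =
  u ++ Bracket (wmax (mx a [:: Bracket b]) (mx [:: Bracket a] b)) :: v.
Proof.
by rewrite mxE rev_cat /= revK.
Qed.

Lemma mx_catl u1 u2 v : u2 != [::] -> mx (u1 ++ u2) v = u1 ++ mx u2 v.
Proof.
move=> nu; have [ju|/not_junction [u' [a [b [v' [eu ev]]]]]] := boolP (junction u2 v).
  rewrite !mx_cat ?catA // /junction ends_cat; move: ju; rewrite /junction.
  by case: (u2) nu.
by rewrite eu ev catA !mx_brackets catA.
Qed.

Lemma mx_catr u v1 v2 : v1 != [::] -> mx u (v1 ++ v2) = mx u v1 ++ v2.
Proof.
move=> nv; have [ju|/not_junction [u' [a [b [v' [eu ev]]]]]] := boolP (junction u v1).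
  rewrite !mx_cat ?catA // /junction starts_cat; move: ju; rewrite /junction.
  by case: (v1) nv.
by rewrite eu ev cat_cons !mx_brackets -catA.
Qed.

(** P(aP(b)) and P(P(a)b) have the same letters and as many brackets as P(a)P(b), so degrees add up
    as for a concatenation. *)
Lemma wdeg_mx u v :
  wdeg (mx u v) = ((wdeg u).1 + (wdeg v).1, (wdeg u).2 + (wdeg v).2)%N.
Proof.
have [N] := ubnP (wsize u + wsize v); elim: N u v => // N IH u v leN.
have [ju|/not_junction [u' [a [b [v' [eu ev]]]]]] := boolP (junction u v).
  by rewrite mx_cat // wdeg_cat.
rewrite {}eu {}ev wsize_cat !wsize_bracket in leN *.
rewrite mx_brackets -[Bracket _ :: v']cat1s -[Bracket b :: v']cat1s.
have s0 : wsize ([::] : bword Y) = 0%N by [].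
have e1 : wdeg (mx a [:: Bracket b]) =
    ((wdeg a).1 + (wdeg b).1.+1, (wdeg a).2 + (wdeg b).2.+1)%N.
  rewrite IH ?wsize_bracket /= ?wsize_bracket ?s0 ?addn0 //.
  by move: leN; rewrite s0; move: (wsize a) (wsize b) (wsize u') (wsize v'); lia.
have e2 : wdeg (mx [:: Bracket a] b) =
    ((wdeg a).1.+1 + (wdeg b).1, (wdeg a).2.+1 + (wdeg b).2)%N.
  rewrite IH ?wsize_bracket /= ?wsize_bracket ?s0 ?addn0 //.
  by move: leN; rewrite s0; move: (wsize a) (wsize b) (wsize u') (wsize v'); lia.
have : wdeg (wmax (mx a [:: Bracket b]) (mx [:: Bracket a] b)) =
    ((wdeg a).1 + (wdeg b).1.+1, (wdeg a).2 + (wdeg b).2.+1)%N.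
  by rewrite /wmax; case: ifP; rewrite ?e1 ?e2 // !addnS.
have wdeg1 w : wdeg [:: Bracket w : factor Y] = ((wdeg w).1.+1, (wdeg w).2.+1).
  by rewrite /wdeg /wsize /= !addn0.
rewrite !wdeg_cat !wdeg1 => -> /=; congr (_, _); lia.
Qed.

Lemma wsize_mx u v : wsize (mx u v) = (wsize u + wsize v)%N.
Proof. by have [] := wdeg_mx u v. Qed.

Lemma ltw_shift c u u' v v' :
  ltw u u' ->
  wdeg v = ((wdeg u).1 + c.1, (wdeg u).2 + c.2)%N ->
  wdeg v' = ((wdeg u').1 + c.1, (wdeg u').2 + c.2)%N ->
  (wdeg u = wdeg u' -> ltlex v v') -> ltw v v'.
Proof.
rewrite /ltw => lt_u -> ->; case/orP: lt_u => [lt_u|/andP [/eqP e _]] lex.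
  by rewrite (@ltdeg_add _ _ c c) ?eqxx.
by rewrite e eqxx lex // orbT.
Qed.

Lemma ltw_deg_lex u v : wdeg u = wdeg v -> ltw u v = ltlex u v.
Proof. by rewrite /ltw => ->; rewrite ltdeg_irr eqxx. Qed.

Lemma wsize_wmax_mx a b :
  wsize (wmax (mx a [:: Bracket b]) (mx [:: Bracket a] b)) =
  (wsize a + wsize b).+1.
Proof.
have s0 : wsize ([::] : bword Y) = 0%N by [].
by rewrite /wmax; case: ifP => _; rewrite wsize_mx wsize_bracket s0 addn0 ?addnS.
Qed.

(** The case of two meeting brackets in [mx_mono], on either side: each entry of the maximum grows
    strictly with [a], hence so does the maximum. *)
Lemma ltw_brackets_mx N
  (IH : forall u u' v, (wsize u' + wsize v < N)%N -> ltw u u' ->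
        ltw (mx u v) (mx u' v) /\ ltw (mx v u) (mx v u')) a a' b :
  (wsize a' + wsize b < N.-1)%N -> ltw a a' ->
  ltw (wmax (mx a [:: Bracket b]) (mx [:: Bracket a] b))
      (wmax (mx a' [:: Bracket b]) (mx [:: Bracket a'] b)) /\
  ltw (wmax (mx b [:: Bracket a]) (mx [:: Bracket b] a))
      (wmax (mx b [:: Bracket a']) (mx [:: Bracket b] a')).
Proof.
move=> leN lt_a; have s0 : wsize ([::] : bword Y) = 0%N by [].
have lt_Pa : ltw [:: Bracket a] [:: Bracket a'] by rewrite ltw_bracket.
have [|l1 r1] := IH a a' [:: Bracket b] _ lt_a.
  rewrite wsize_bracket s0; move: leN; case: (N) => // N'; rewrite /=.
  by move: (wsize a') (wsize b); lia.
have [|l2 r2] := IH [:: Bracket a] [:: Bracket a'] b _ lt_Pa.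
  rewrite wsize_bracket s0; move: leN; case: (N) => // N'; rewrite /=.
  by move: (wsize a') (wsize b); lia.
split; apply: wmax_lt.
- exact: ltw_lew_trans l1 (lew_maxl _ _).
- exact: ltw_lew_trans l2 (lew_maxr _ _).
- exact: ltw_lew_trans r2 (lew_maxl _ _).
- exact: ltw_lew_trans r1 (lew_maxr _ _).
Qed.

(** Degrees add up, so only words of equal degree matter, and these first differ at some [f] below
    [g]. Away from the meeting point both factors survive. If both are merged with a bracket of [v],
    the induction hypothesis compares the results; if only [g] is, its size grows beyond that of
    [f]. *)
Lemma mx_mono u u' v : ltw u u' ->
  ltw (mx u v) (mx u' v) /\ ltw (mx v u) (mx v u').
Proof.
have [N] := ubnP (wsize u' + wsize v); elim: N u u' v => // N IH u u' v leN lt_u.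
have brk a a' b v' p q : ltw a a' -> u' = p ++ Bracket a' :: q ->
    v = v' ++ [:: Bracket b] \/ v = Bracket b :: v' ->
    (wsize a' + wsize b < N.-1)%N.
  move=> _ eu' ev; have : (wsize a' + wsize b + 2 <= wsize u' + wsize v)%N.
    have : (wsize a' < wsize u')%N.
      by rewrite eu' wsize_cat wsize_bracket; move: (wsize a') (wsize q) (wsize p); lia.
    have : (wsize b < wsize v)%N.
      case: ev => ->; rewrite ?wsize_cat wsize_bracket ?addnS ltnS ?leq_addr //.
      by apply: leq_trans (leq_addr _ _) (leq_addl _ _).
    by move: (wsize a') (wsize u') (wsize b) (wsize v); lia.
  by move: leN; move: (wsize a') (wsize u') (wsize b) (wsize v); case: (N) => [|?] /=; lia.
split; apply: (ltw_shift (c := wdeg v) lt_u); rewrite ?wdeg_mx //;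
  rewrite ?[((wdeg v).1 + _)%N]addnC ?[((wdeg v).2 + _)%N]addnC // => eu.
all: have lex : ltlex u u' by rewrite -(ltw_deg_lex eu).
all: have [p [f [g [u1 [u1' [eqx eqx' fg]]]]]] := ltlex_split (wdeg_wsize eu) lex.
all: have es : (fsize f + wsize u1 = fsize g + wsize u1')%N
  by move: (wdeg_wsize eu); rewrite eqx eqx' !wsize_cat !wsize_cons => /addnI.
all: have eb : (fbrackets f + wbrackets u1 = fbrackets g + wbrackets u1')%N
  by case: eu => _; rewrite -!/(wbrackets _) eqx eqx' !wbrackets_cat !wbrackets_cons => /addnI.
all: have lt_lex s t : ltlex (p ++ f :: s) (p ++ g :: t) by rewrite ltlex_catl /= fg.
- have [jv|] := boolP (starts_with_bracket v); last first.
    move=> jv; have ju w : junction w v by rewrite /junction (negbTE jv) andbF.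
    rewrite !mx_cat // eqx eqx' -!catA; exact: lt_lex.
  case: v jv leN brk => [|[y|b] v'] // _ leN brk.
  have cons_p h w : p ++ h :: w = (p ++ [:: h]) ++ w by rewrite -catA.
  case: u1 eqx es eb => [|h u1] eqx es eb; case: u1' eqx' es eb => [|h' u1'] eqx' es eb.
  + move: fg es eb; rewrite eqx eqx' !mx_catl // ltlex_catl.
    (* A last letter cannot face a last bracket: the equality [eb] of bracket counts forbids it. *)
    case: (f) (g) (eqx') => [x|a] [x'|a'] eqa; rewrite ?ltf_bracket_letter //.
    * by move=> fg _ _; rewrite !mx_cat //; apply/orP; left.
    * rewrite ltf_bracket => lt_a _ _; have lt_ab := brk _ _ _ _ _ _ lt_a eqa (or_intror erefl).
      have [lt_m _] := ltw_brackets_mx IH lt_ab lt_a.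
      by rewrite (mx_brackets [::]) (mx_brackets [::]) /= -/(ltw _ _) lt_m.
  (* Here [f] alone has the size of [g] and further factors together, against [ltf_fsize]. *)
  + have := ltf_fsize fg; rewrite leqNgt; move: es; rewrite wsize_cons.
    have := fsize_gt0 h'; have -> : wsize ([::] : bword Y) = 0%N by [].
    by move: (fsize f) (fsize g) (fsize h') (wsize u1'); lia.
  + rewrite eqx eqx' cons_p (mx_catl (p ++ _)) // -catA mx_catl //.
    case: (g) fg => [y|a] fg; first by rewrite (mx_cat (u := [:: Letter y])) // ltlex_catl /= fg.
    rewrite (mx_brackets [::]) ltlex_catl /= fsize_ltf //=.
    apply: leq_ltn_trans (ltf_fsize fg) _; rewrite /= !ltnS -/(wsize _) -/(wsize _) wsize_wmax_mx.
    by rewrite ltnS leq_addr.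
  + rewrite eqx eqx' (cons_p f) (cons_p g) (mx_catl (p ++ _)) // (mx_catl (p ++ _)) //.
    by rewrite -!catA; apply: lt_lex.
- have [jv|] := boolP (ends_with_bracket v); last first.
    move=> jv; have ju w : junction v w by rewrite /junction (negbTE jv).
    by rewrite !mx_cat // ltlex_catl.
  case/lastP: v jv leN brk => [//|v' y]; rewrite ends_rcons; case: y => [//|b] _.
  rewrite -cats1 => leN brk; have := eqx; have := eqx'.
  (* On the left the reduction concerns the first factor, so a nonempty common prefix shields [f]
     and [g]. *)
  case: p lt_lex {eqx eqx'} => [|h p] lt_lex eqx' eqx; last first.
    rewrite eqx eqx' -[h :: p]cat1s -!catA mx_catr // mx_catr // ltlex_catl.
    by rewrite ltlex_catl /= fg.
  rewrite eqx eqx' -[f :: u1]cat1s -[g :: u1']cat1s (@mx_catr _ [:: f]) // (@mx_catr _ [:: g]) //.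
  case: (f) (g) fg (eqx') => [x|a] [x'|a'] fg eqa; rewrite ?ltf_bracket_letter // in fg *.
  + by rewrite !mx_cat /junction ?andbF // -!catA !ltlex_catl; apply/orP; left.
  + rewrite mx_cat /junction ?andbF // mx_brackets -!catA ltlex_catl.
    apply/orP; left; apply: fsize_ltf; rewrite /= !ltnS -/(wsize _) -/(wsize _) wsize_wmax_mx.
    by rewrite ltnS leq_addr.
  + rewrite !mx_brackets -!catA ltlex_catl; apply/orP; left; rewrite ltf_bracket.
    rewrite ltf_bracket in fg; have lt_ab := brk _ _ _ _ [::] _ fg eqa (or_introl erefl).
    by have [] := ltw_brackets_mx IH lt_ab fg.
Qed.

Lemma mx_monol u u' v : ltw u u' -> ltw (mx u v) (mx u' v).
Proof. by move/mx_mono=> /(_ v) []. Qed.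

Lemma mx_monor u u' v : ltw u u' -> ltw (mx v u) (mx v u').
Proof. by move/mx_mono=> /(_ v) []. Qed.

Lemma mx_lel u u' v : lew u u' -> lew (mx u v) (mx u' v).
Proof.
by move=> /orP [/eqP -> | /mx_monol /lewW]; [apply: lew_refl | apply].
Qed.

Lemma mx_ler u u' v : lew u u' -> lew (mx v u) (mx v u').
Proof.
by move=> /orP [/eqP -> | /mx_monor /lewW]; [apply: lew_refl | apply].
Qed.

End WordOrderTheory.

Section ProductBound.
Variables (k : comPzRingType) (lam : k).
Variables (disp : Order.disp_t) (X : orderType disp) (n : nat).
Local Notation Y := (diffvar n X).
Local Notation A := (rbalg k Y).
Local Notation "f ** g" := (rbp lam f g) (at level 40, left associativity).
Implicit Types (u v w : bword Y) (r : rbword Y) (f g : A).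

Lemma bnd_mulw u v : is_rbword u -> is_rbword v ->
  bnd (fun r => lew r (mx u v)) (wd k u ** wd k v).
Proof.
have [N] := ubnP (wsize u + wsize v); elim: N u v => // N IH u v leN ru rv.
have [ju|/not_junction [u' [a [b [v' [eu ev]]]]]] := boolP (junction u v).
  have ruv : is_rbword (u ++ v) by rewrite rb_cat ru rv.
  by rewrite wd_cat // mx_cat //; apply: bnd_wd => // r ->; apply: lew_refl.
rewrite {}eu {}ev in leN ru rv *; rewrite wd_bracket_mul // mx_brackets.
have s0 : wsize ([::] : bword Y) = 0%N by [].
move: (ru) (rv); rewrite -[Bracket b :: v']cat1s !rb_cat !rb_bracket.
move=> /and3P [_ ra _] /and3P [rb _ _].
set M := wmax _ _.
have ltN1 : (wsize a + wsize [:: Bracket b] < N)%N.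
  move: leN; rewrite wsize_cat !wsize_bracket s0.
  by move: (wsize a) (wsize b) (wsize u') (wsize v'); lia.
have ltN2 : (wsize [:: Bracket a] + wsize b < N)%N.
  move: leN; rewrite wsize_cat !wsize_bracket s0.
  by move: (wsize a) (wsize b) (wsize u') (wsize v'); lia.
have ltN3 : (wsize a + wsize b < N)%N.
  by move: ltN1; rewrite wsize_bracket s0; move: (wsize a) (wsize b); lia.
have bM : bnd (fun r => lew r M)
    (wd k a ** wd k [:: Bracket b] + wd k [:: Bracket a] ** wd k b
     + lam *: (wd k a ** wd k b)).
  apply: bndD; last apply: bndZ; first apply: bndD.
  - apply: bndS (IH _ _ ltN1 ra _); last by rewrite rb_bracket.
    by move=> r le_r; apply: lew_trans le_r (lew_maxl _ _).
  - apply: bndS (IH _ _ ltN2 _ rb); last by rewrite rb_bracket.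
    by move=> r le_r; apply: lew_trans le_r (lew_maxr _ _).
  (* The term in [lam] has one symbol fewer than [M], hence lies below it by size alone. *)
  - apply: bndS (IH _ _ ltN3 ra rb) => r le_r; apply: lewW.
    apply: lew_ltw_trans le_r _; apply: wsize_ltw.
    by rewrite wsize_mx wsize_wmax_mx.
apply: bnd_wrap bM _ _ => [r _|r s le_r ->].
  apply: (rb_subst_bracket (b := b) (valP r)).
  by move: ru; rewrite !rb_cat rv => /and3P [-> _].
rewrite -[Bracket r :: v']cat1s -[Bracket M :: v']cat1s.
by apply: lew_cat; apply: lew_bracket.
Qed.

Lemma bnd_mul u v f g : bnd (fun r => lew r u) f -> bnd (fun r => lew r v) g ->
  bnd (fun r => lew r (mx u v)) (f ** g).
Proof.
move=> bf bg; elim/bnd_ind: f / bf => [|c r f le_r IH].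
  by rewrite mul0b; apply: bnd0.
rewrite mulDb mulZb; apply: bndD IH; apply: bndZ.
elim/bnd_ind: g / bg => [|d s g le_s IH]; first by rewrite mulb0; apply: bnd0.
rewrite mulbD mulbZ; apply: bndD IH; apply: bndZ.
rewrite -!wd_val; apply: bndS (bnd_mulw (valP r) (valP s)) => t le_t.
by apply: lew_trans le_t (lew_trans (mx_lel _ le_r) (mx_ler _ le_s)).
Qed.
End ProductBound.

(** * Leading words *)

Section LeadingWords.
Variables (k : comPzRingType) (lam : k).
Variables (disp : Order.disp_t) (X : orderType disp) (n : nat).
Local Notation Y := (diffvar n X).
Local Notation A := (rbalg k Y).
Local Notation "f ** g" := (rbp lam f g) (at level 40, left associativity).
Local Notation wd := (@wd k Y).
Local Notation rbo := (@rbo k Y).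
Local Notation rbd := (@rbd k lam X n).
Local Notation lt v := (fun r : rbword Y => is_true (ltw r v)).
Local Notation le v := (fun r : rbword Y => is_true (lew r v)).
Implicit Types (u v w : bword Y) (r s : rbword Y) (f g h : A).

Lemma lew_antisym u v : lew u v -> lew v u -> u = v.
Proof.
move=> /orP [/eqP -> //|uv] /orP [/eqP -> //|vu].
by have := ltw_trans uv vu; rewrite ltw_irr.
Qed.

Lemma lead_max f r : r \in msupp f -> lew r (lead f).
Proof.
rewrite /lead -[r \in msupp f]/(r \in enum_fset (msupp f)).
elim: (enum_fset (msupp f)) => // s ws IH.
rewrite inE big_cons /maxw => /orP [/eqP ->|/IH le_r].
  by case: ifP => [/lewW|_] //; apply: lew_refl.
case: ifP => // lt_s; apply: lew_trans le_r _.
by case: (lew_total s (\big[@maxw _ X n/rb1 Y]_(w <- ws) w)) => //; rewrite lt_s.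
Qed.

Lemma lead_mem f : f != 0 -> lead f \in msupp f.
Proof.
rewrite /lead => nz.
have : enum_fset (msupp f) != [::].
  apply: contraNneq nz => e; apply/eqP/rbalgP => w; rewrite coeff0.
  by apply: mcoeff_outdom; rewrite -[w \in msupp f]/(w \in enum_fset (msupp f)) e.
rewrite -[_ \in msupp f]/(_ \in enum_fset (msupp f)).
elim: (enum_fset (msupp f)) => // s [|t ws] IH _; rewrite big_cons.
  rewrite big_nil /maxw; case: ifP; rewrite ?mem_head // => lt_s.
  by case: (ltw_lew_false lt_s (lew_nil _)).
rewrite {1}/maxw; case: ifP => _; last exact: mem_head.
by rewrite inE IH ?orbT.
Qed.

Lemma eq_lead f r : f@_r != 0 -> bnd (le r) f -> lead f = r.
Proof.
move=> fr bf; have rf : r \in msupp f by rewrite -mcoeff_neq0.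
have nz : f != 0 by apply: contraNneq fr => ->; rewrite coeff0.
by apply/val_inj/lew_antisym; [apply/bf/lead_mem | apply: lead_max].
Qed.

(** To be monic with leading word [v], expressed through the support of the remainder: this form
    passes through sums and products and makes sense without 1 != 0 in [k]. *)
Definition leads v f := is_rbword v /\ bnd (lt v) (f - wd v).

Lemma leads_expand v f : leads v f -> exists2 g, f = wd v + g & bnd (lt v) g.
Proof. by case=> _ bf; exists (f - wd v); rewrite // addrC subrK. Qed.

Lemma leads_le v f : leads v f -> bnd (le v) f.
Proof.
move=> lf; have [g -> bg] := leads_expand lf; apply: bndD.
  by apply: (bnd_wd lf.1) => r ->; apply: lew_refl.
by apply: bndS bg => r /lewW.
Qed.

Lemma leads_coeff v f r : leads v f -> r = v :> bword Y -> f@_r = 1.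
Proof.
move=> lf er; have [g -> /bnd_coeff bg] := leads_expand lf.
rewrite coeffD -er wd_val coeff_mono eqxx.
have [->|/bg] := eqVneq g@_r 0; first by rewrite addr0.
by rewrite er ltw_irr.
Qed.

Lemma leads_lead v f : (1 : k) != 0 -> leads v f ->
  [/\ f != 0, lead f = v :> bword Y & is_monic f].
Proof.
move=> nz lf; pose r := RBWord lf.1.
have fr : f@_r = 1 by apply: (leads_coeff lf).
have f0 : f != 0 by apply: contraNneq nz => f0; rewrite -fr f0 coeff0.
have ef : lead f = r.
  by apply: eq_lead; [rewrite fr | apply: (leads_le lf)].
by split; rewrite // ?ef //; split=> //; rewrite ef.
Qed.

Lemma monic_leads f : is_monic f -> leads (lead f) f.
Proof.
move=> [nz f1]; split; first exact: valP.
apply/bnd_coeff => r; rewrite wd_val coeffD coeffN coeff_mono.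
have [<-|ne] := eqVneq (lead f) r; first by rewrite f1 subrr eqxx.
rewrite subr0 mcoeff_neq0 => /lead_max /orP [/eqP e|//].
by move: ne; rewrite -(inj_eq val_inj) /= e eqxx.
Qed.

Lemma is_monic_one_neq0 f : is_monic f -> (1 : k) != 0.
Proof. by move=> [nz <-]; rewrite mcoeff_neq0 lead_mem. Qed.

Lemma bnd_mul_ltr u v f g : bnd (le u) f -> bnd (lt v) g -> bnd (lt (mx u v)) (f ** g).
Proof.
move=> bf bg; elim/bnd_ind: g / bg => [|c r g lt_r IH].
  by rewrite mulb0; apply: bnd0.
rewrite mulbD mulbZ; apply: bndD IH; apply: bndZ.
have br : bnd (le r) (mono r : A) by apply: bnd_mono; apply: lew_refl.
apply: bndS (bnd_mul bf br) => t le_t.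
exact: lew_ltw_trans le_t (mx_monor _ lt_r).
Qed.

Lemma bnd_mul_ltl u v f g : bnd (lt u) f -> bnd (le v) g -> bnd (lt (mx u v)) (f ** g).
Proof.
move=> bf bg; elim/bnd_ind: f / bf => [|c r f lt_r IH].
  by rewrite mul0b; apply: bnd0.
rewrite mulDb mulZb; apply: bndD IH; apply: bndZ.
have br : bnd (le r) (mono r : A) by apply: bnd_mono; apply: lew_refl.
apply: bndS (bnd_mul br bg) => t le_t.
exact: lew_ltw_trans le_t (mx_monol _ lt_r).
Qed.

Lemma bnd_wd_le v : is_rbword v -> bnd (le v) (wd v).
Proof. by move=> rv; apply: bnd_wd => // r ->; apply: lew_refl. Qed.

Lemma leads_mul u v f g : leads u f -> leads v g -> is_rbword (u ++ v) ->
  leads (u ++ v) (f ** g).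
Proof.
move=> lf lg ruv; split=> //; have := ruv; rewrite rb_cat => /and3P [ru rv juv].
have [f' -> bf] := leads_expand lf; have [g' -> bg] := leads_expand lg.
rewrite !(mulDb, mulbD) wd_cat // -!addrA addrC -!addrA addNr addr0 -(mx_cat juv).
apply: bndD; first by apply: bnd_mul_ltr => //; apply: bnd_wd_le.
apply: bndD; first by apply: bnd_mul_ltl => //; apply: bnd_wd_le.
by apply: bnd_mul_ltl => //; apply: bndS bg => r /lewW.
Qed.

Lemma leads_wd v : is_rbword v -> leads v (wd v).
Proof. by move=> rv; split; rewrite // subrr; apply: bnd0. Qed.

Lemma leads_ctx a b v f : leads v f -> is_rbword (a ++ v ++ b) ->
  leads (a ++ v ++ b) (wd a ** (f ** wd b)).
Proof.
move=> lf r; have := r; rewrite rb_cat => /and3P [ra rvb _].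
have := rvb; rewrite rb_cat => /and3P [_ rb _].
by apply: leads_mul => //; [apply: leads_wd | apply: leads_mul => //; apply: leads_wd].
Qed.

Lemma bnd_rbo_lt v f : bnd (lt v) f -> bnd (lt [:: Bracket v]) (rbo f).
Proof.
elim/bnd_ind: f / => [|c r f lt_r IH]; first by rewrite rbo0; apply: bnd0.
rewrite rboD rboZ; apply: bndD IH; apply: bndZ.
by rewrite rbo_mono; apply: bnd_mono; rewrite ltw_bracket.
Qed.

Lemma rboN f : rbo (- f) = - rbo f.
Proof. by rewrite -scaleN1r rboZ scaleN1r. Qed.

Lemma leads_rbo v f : leads v f -> leads [:: Bracket v] (rbo f).
Proof.
move=> [rv bf]; split; first by rewrite rb_bracket.
by rewrite -rbo_wd // -rboN -rboD; apply: bnd_rbo_lt.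
Qed.
End LeadingWords.

(** * Normal substitutions and their span *)

Section NormalCombinations.
Variables (k : comPzRingType) (lam : k).
Variables (disp : Order.disp_t) (X : orderType disp) (n : nat).
Local Notation Y := (diffvar n X).
Local Notation A := (rbalg k Y).
Local Notation "f ** g" := (rbp lam f g) (at level 40, left associativity).
Local Notation wd := (@wd k Y).
Local Notation rbo := (@rbo k Y).
Local Notation rbd := (@rbd k lam X n).
Local Notation lt v := (fun u : bword Y => is_true (ltw u v)).
Local Notation le v := (fun u : bword Y => is_true (lew u v)).
Local Notation ltr v := (fun r : rbword Y => is_true (ltw r v)).
Local Notation ler v := (fun r : rbword Y => is_true (lew r v)).
Variable S : A -> Prop.
Hypothesis S_monic : forall s, S s -> is_monic s \/ s = 0.
Hypothesis S_der : forall s, S s -> S (rbd s).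
Implicit Types (a b t u v w : bword Y) (c : k) (r : rbword Y) (f g h s x y : A).

(* [normal_at h v]: h is a normal q|_s, for a star of order 0, and v is its
   leading word q|_v with v the leading word of s. *)
Inductive normal_at : A -> bword Y -> Prop :=
  | NormalStar s a b of S s & s != 0 & is_rbword (a ++ lead s ++ b) :
      normal_at (wd a ** (s ** wd b)) (a ++ lead s ++ b)
  | NormalBracket h v a b of normal_at h v &
      is_rbword (a ++ [:: Bracket v] ++ b) :
      normal_at (wd a ** (rbo h ** wd b)) (a ++ [:: Bracket v] ++ b).

(** The part of a normal element that remains after removing the words on both sides at the
    outermost level: an element of [S], or one bracket with a normal element inside. Positions of
    two occurrences are compared at this level. *)
Definition core x t : Prop :=
  [/\ S x, x != 0 & t = lead x :> bword Y] \/
  exists h v, [/\ normal_at h v, x = rbo h & t = [:: Bracket v]].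

Lemma normal_atP h v : normal_at h v <->
  exists a t b x, [/\ core x t, is_rbword (a ++ t ++ b),
                      h = wd a ** (x ** wd b) & v = a ++ t ++ b].
Proof.
split=> [[s a b Ss s0 r|h' v' a b N' r]|].
- by exists a, (lead s : bword Y), b, s; split=> //; left.
- by exists a, [:: Bracket v'], b, (rbo h'); split=> //; right; exists h', v'.
- move=> [a [t [b [x [[[Sx x0 ->]|[h' [v' [N' -> ->]]]] r -> ->]]]]].
    exact: NormalStar.
  exact: NormalBracket.
Qed.

Lemma S_leads s : S s -> s != 0 -> leads (lead s) s.
Proof.
move=> Ss s0; apply: monic_leads.
by case: (S_monic Ss) => // e; rewrite e eqxx in s0.
Qed.

Lemma normal_at_leads h v : normal_at h v -> leads v h.
Proof.
elim=> {h v} [s a b Ss s0 r|h v a b N lN r]; first by apply: leads_ctx => //; apply: S_leads.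
by apply: leads_ctx => //; apply: leads_rbo.
Qed.

Lemma core_leads x t : core x t -> leads t x.
Proof.
case=> [[Sx x0 ->]|[h [v [N -> ->]]]]; first exact: S_leads.
exact/leads_rbo/normal_at_leads.
Qed.

Lemma wd1b f : wd [::] ** f = f. Proof. by rewrite wd_nil mul1b. Qed.
Lemma wdb1 f : f ** wd [::] = f. Proof. by rewrite wd_nil mulb1. Qed.

Lemma core_normal_at x t : core x t -> normal_at x t.
Proof.
move=> cx; apply/normal_atP; exists [::], t, [::], x.
by rewrite wd1b wdb1 cats0; split=> //; case: (core_leads cx).
Qed.

Lemma normal_at_rbo h v : normal_at h v -> normal_at (rbo h) [:: Bracket v].
Proof. by move=> N; apply: core_normal_at; right; exists h, v. Qed.

Lemma rb_catP u v : is_rbword (u ++ v) ->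
  [/\ is_rbword u, is_rbword v & junction u v].
Proof. by rewrite rb_cat => /and3P. Qed.

Lemma rb_sub a u b : is_rbword (a ++ u ++ b) ->
  [/\ is_rbword a, is_rbword u, is_rbword b, is_rbword (a ++ u) & is_rbword (u ++ b)].
Proof.
move=> r; have [ra rub _] := rb_catP r; have [ru rb _] := rb_catP rub.
by have [rau _ _] : [/\ is_rbword (a ++ u), is_rbword b & junction (a ++ u) b]
  by apply: rb_catP; rewrite -catA.
Qed.

Lemma normal_at_ctx a b h v : normal_at h v -> is_rbword (a ++ v ++ b) ->
  normal_at (wd a ** (h ** wd b)) (a ++ v ++ b).
Proof.
move=> /normal_atP [a' [t [b' [x [cx r -> ->]]]]] ravb.
have ravb' : is_rbword ((a ++ a') ++ t ++ (b' ++ b)).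
  by move: ravb; rewrite -!catA.
apply/normal_atP; exists (a ++ a'), t, (b' ++ b), x; split=> //; last by rewrite -!catA.
have [raa _ rbb _ _] := rb_sub ravb'.
by rewrite -(wd_cat lam raa) -(wd_cat lam rbb) !rbpA.
Qed.

(** [B] constrains the leading word of each summand, not the words of the sum, so it records a bound
    that survives cancellation. Zero coefficients are allowed here, which makes closure under linear
    operations immediate. *)
Inductive comb (B : bword Y -> Prop) : A -> Prop :=
  | CombNil : comb B 0
  | CombCons c h v f of normal_at h v & B v & comb B f : comb B (c *: h + f).

Lemma comb1 B h v : normal_at h v -> B v -> comb B h.
Proof. by move=> N Bv; rewrite -[h]addr0 -[h]scale1r; apply: CombCons N Bv (CombNil _). Qed.

Lemma combD B f g : comb B f -> comb B g -> comb B (f + g).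
Proof.
move=> cf cg; elim: cf => [|c h v f' N Bv _ IH]; first by rewrite add0r.
by rewrite -addrA; apply: CombCons N Bv IH.
Qed.

Lemma combZ B c f : comb B f -> comb B (c *: f).
Proof.
elim=> [|c' h v f' N Bv _ IH]; first by rewrite scaler0; apply: CombNil.
by rewrite scalerDr scalerA; apply: CombCons N Bv IH.
Qed.

Lemma combN B f : comb B f -> comb B (- f).
Proof. by rewrite -scaleN1r; apply: combZ. Qed.

Lemma combB_sym B f g : comb B (f - g) -> comb B (g - f).
Proof. by move/combN; rewrite opprB. Qed.

Lemma combS (B C : bword Y -> Prop) f :
  (forall v, B v -> C v) -> comb B f -> comb C f.
Proof.
move=> BC; elim=> [|c h v f' N Bv _ IH]; first exact: CombNil.
by apply: CombCons N (BC _ Bv) IH.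
Qed.

Lemma comb_map (B C : bword Y -> Prop) (L : A -> A) f :
  L 0 = 0 -> (forall c x y, L (c *: x + y) = c *: L x + L y) ->
  (forall h v, normal_at h v -> B v -> comb C (L h)) -> comb B f -> comb C (L f).
Proof.
move=> L0 LD LN; elim=> [|c h v f' N Bv _ IH]; first by rewrite L0; apply: CombNil.
by rewrite LD; apply: combD IH; apply/combZ/(LN _ _ N).
Qed.

Lemma comb_bnd (B : bword Y -> Prop) (L : A -> A) (C : bword Y -> Prop) f :
  L 0 = 0 -> (forall c x y, L (c *: x + y) = c *: L x + L y) ->
  (forall r, B r -> comb C (L (mono r))) -> bnd (fun r => B r) f -> comb C (L f).
Proof.
move=> L0 LD LN; elim/bnd_ind: f / => [|c r f Br IH]; first by rewrite L0; apply: CombNil.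
by rewrite LD; apply: combD IH; apply/combZ/LN.
Qed.

Lemma comb_leads B f : comb B f ->
  (forall W : bword Y, (forall v, B v -> ltw v W) -> bnd (ltr W) f) /\
  (forall W : bword Y, (forall v, B v -> lew v W) -> bnd (ler W) f).
Proof.
elim=> [|c h v f' N Bv _ [IH1 IH2]]; first by split=> *; apply: bnd0.
have lN := normal_at_leads N; split=> W BW.
  apply: bndD (IH1 _ BW); apply: bndZ; apply: bndS (leads_le lN) => r le_r.
  exact: lew_ltw_trans le_r (BW _ Bv).
apply: bndD (IH2 _ BW); apply: bndZ; apply: bndS (leads_le lN) => r le_r.
exact: lew_trans le_r (BW _ Bv).
Qed.

(* Then s = 1 and every word is normal; elsewhere leading words can be assumed to
   be nonempty. *)
Definition has_unit := exists s, [/\ S s, s != 0 & lead s = [::] :> bword Y].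

Lemma unit_comb (B : bword Y -> Prop) f : has_unit -> bnd (fun r => B r) f -> comb B f.
Proof.
move=> [s [Ss s0 es]].
have s1 : s = wd [::].
  have [_ bs] := S_leads Ss s0; rewrite es in bs.
  apply/eqP; rewrite -subr_eq0; apply/eqP/rbalgP => r; rewrite coeff0.
  apply/eqP; apply: contraT => nz.
  have /bs : r \in msupp (s - wd [::]) by rewrite -mcoeff_neq0.
  by move=> lt_r; case: (ltw_lew_false lt_r (lew_nil _)).
apply: (comb_bnd (L := id)) => // r Br.
suff N : normal_at (mono r) r by apply: comb1 N Br.
have := @NormalStar s r [::] Ss s0; rewrite es s1 wd1b wdb1 wd_val.
by rewrite !cats0; apply; apply: valP.
Qed.

Lemma core_nil x t : core x t -> t = [::] -> has_unit.
Proof. by case=> [[Sx x0 ->] e|[h [v [_ _ ->]]] //]; exists x. Qed.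

Lemma mx_ends u v : u != [::] -> v != [::] ->
  starts_with_bracket (mx u v) = starts_with_bracket u /\
  ends_with_bracket (mx u v) = ends_with_bracket v.
Proof.
move=> nu nv; have [ju|/not_junction [u' [a [b [v' [-> ->]]]]]] := boolP (junction u v).
  by rewrite mx_cat // starts_cat ends_cat; case: (u) nu => //; case: (v) nv.
rewrite mx_brackets starts_cat ends_cat /= !ends_cons starts_cat /=.
by split.
Qed.

(** * Multiplying normal elements by words *)

Hypothesis right_mult_comb : forall s u, S s -> s != 0 -> is_rbword u ->
  ends_with_bracket (lead s) -> starts_with_bracket u ->
  comb (le (mx (lead s) u)) (s ** wd u).
Hypothesis left_mult_comb : forall s u, S s -> s != 0 -> is_rbword u ->
  ends_with_bracket u -> starts_with_bracket (lead s) ->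
  comb (le (mx u (lead s))) (wd u ** s).

Definition mult_closed_below (W : bword Y) :=
  forall u h v, ltw (mx u v) W -> is_rbword u -> normal_at h v ->
    comb (le (mx u v)) (wd u ** h).
Definition rmult_closed_below (W : bword Y) :=
  forall u h v, ltw (mx v u) W -> is_rbword u -> normal_at h v ->
    comb (le (mx v u)) (h ** wd u).

Lemma unit_mult u h v : has_unit -> is_rbword u -> normal_at h v ->
  comb (le (mx u v)) (wd u ** h) /\ comb (le (mx v u)) (h ** wd u).
Proof.
move=> un ru N; have lN := leads_le (normal_at_leads N).
by split; apply: unit_comb => //; apply: bnd_mul => //; apply: bnd_wd_le.
Qed.

Lemma junction_ncatl u v w : v != [::] -> junction (u ++ v) w = junction v w.
Proof. by rewrite /junction ends_cat; case: v. Qed.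

Lemma comb_bracket_ctx B C a b e f : is_rbword (a ++ [:: Bracket e] ++ b) ->
  (forall v, B v -> C (a ++ [:: Bracket v] ++ b)) -> comb B f ->
  comb C (wd a ** (rbo f ** wd b)).
Proof.
move=> r BC; apply: (comb_map (L := fun f => wd a ** (rbo f ** wd b))) => [|c x y|h v N Bv].
- by rewrite rbo0 mul0b mulb0.
- by rewrite rboD rboZ mulDb mulZb mulbD mulbZ.
- apply: comb1 (BC _ Bv); apply: NormalBracket => //.
  by apply: rb_subst_bracket (normal_at_leads N).1 r.
Qed.

Lemma ltw_mx_brackets a e b v :
  [/\ ltw (mx e [:: Bracket b]) (mx (a ++ [:: Bracket e]) ([:: Bracket b] ++ v)),
      ltw (mx [:: Bracket e] b) (mx (a ++ [:: Bracket e]) ([:: Bracket b] ++ v)) &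
      ltw (mx e b) (mx (a ++ [:: Bracket e]) ([:: Bracket b] ++ v))].
Proof.
have s0 : wsize ([::] : bword Y) = 0%N by [].
by split; apply: wsize_ltw; rewrite !wsize_mx ?wsize_cat !wsize_bracket s0;
  move: (wsize a) (wsize e) (wsize b) (wsize v); lia.
Qed.

(** Write h = a x b with core [x]. If [a] is nonempty, the words of u a end like [a], so x b is
    attached to them without reduction. If [a] is empty and [x] is in [S], a composition of left
    multiplication applies, and its summands must still be multiplied by [b] on the right; this
    forces the joint induction for both sides. If x = P(h'), the Rota-Baxter relation leaves three
    products with smaller bounds. *)
Lemma mult_step W : mult_closed_below W -> rmult_closed_below W ->
  forall u h v, mx u v = W -> is_rbword u -> normal_at h v ->
  comb (le W) (wd u ** h).
Proof.
move=> IHl IHr u h v eW ru N.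
have [un|not_unit] := Classical_Prop.classic has_unit.
  by rewrite -eW; case: (unit_mult un ru N).
have [juv|njuv] := boolP (junction u v).
  rewrite -eW mx_cat //.
  have ruv : is_rbword (u ++ v ++ [::]).
    by rewrite cats0 rb_cat ru juv (normal_at_leads N).1.
  by apply: comb1 (lew_refl _); have := normal_at_ctx N ruv; rewrite wdb1 cats0.
have /normal_atP [a [t [b [x [cx ratb eh ev]]]]] := N.
have nt : t != [::].
  by apply/negP => /eqP e; apply: not_unit; apply: core_nil cx e.
have [ra rt rb rat rtb] := rb_sub ratb.
have [ea|na] := eqVneq a [::]; last first.
  rewrite eh -rbpA; apply: (comb_bnd
      (B := fun w => [/\ w != [::], ends_with_bracket w = ends_with_bracket a
                      & lew w (mx u a)])
      (L := fun f => f ** (x ** wd b))) => [|c y z|r [nr er le_r]|].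
  - by rewrite mul0b.
  - by rewrite mulDb mulZb.
  - rewrite -wd_val; apply: (comb1 (v := r ++ t ++ b)).
      apply/normal_atP; exists r, t, b, x; split=> //.
      rewrite rb_cat (valP r) rtb; have [_ _] := rb_catP ratb.
      by rewrite (junction_eql _ er).
    rewrite -eW ev mx_catr //.
    by have := lew_cat [::] (t ++ b) le_r.
  - have nu : u != [::] by apply: contraNneq njuv => ->.
    move=> r rin; have [nr _ er] := bnd_mul_ends ru ra nu na rin.
    by split=> //; apply: bnd_mulw rin.
rewrite ea wd1b in eh; rewrite ea in ev ratb; rewrite {a ea ra rat} /= in ev ratb.
have [u' [e [b' [v' [eu ev']]]]] := not_junction njuv.
have ru' : is_rbword (u' ++ [:: Bracket e]) by rewrite -eu.
have [ru0 re ju0] := rb_catP ru'; rewrite rb_bracket in re.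
case: cx => [[Sx x0 et]|[h' [v'' [N' ex et]]]].
  have st : starts_with_bracket t.
    by move: ev; rewrite ev'; case: (t) nt => // f t' _ [<-].
  have eu_b : ends_with_bracket u by rewrite eu ends_cat.
  have cs := left_mult_comb Sx x0 ru eu_b; rewrite -et in cs.
  rewrite eh -rbpA; apply: (comb_map (L := fun f => f ** wd b)) (cs st) => [|c y z|h0 v0 N0].
  - by rewrite mul0b.
  - by rewrite mulDb mulZb.
  - have nu : u != [::] by apply: contraNneq njuv => ->.
    have jtb : junction t b by case: (rb_catP ratb).
    have eWt : W = mx u t ++ b by rewrite -eW ev mx_catr.
    (* The induction on [W] terminates: a summand of [wd u ** x] whose leading
       word reaches the bound [mx u t] ends like [t], so multiplying it by [b] on
       the right needs no reduction; all other summands lie below [W]. *)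
    case/orP=> [/eqP ev0|lt0].
      have jv0b : junction v0 b.
        by rewrite ev0 (junction_eql _ (mx_ends nu nt).2).
      have rv0b : is_rbword ([::] ++ v0 ++ b).
        by rewrite /= rb_cat (normal_at_leads N0).1 rb jv0b.
      have := normal_at_ctx N0 rv0b; rewrite wd1b => /comb1; apply.
      by rewrite eWt -ev0; apply: lew_refl.
    have ltW : ltw (mx v0 b) W.
      rewrite eWt -[mx u t ++ b]mx_cat; first exact: mx_monol.
      by rewrite (junction_eql _ (mx_ends nu nt).2).
    apply: combS (IHr _ _ _ ltW rb N0) => w le_w.
    by apply: lewW; apply: lew_ltw_trans le_w ltW.
move: eh ev; rewrite ex et => eh ev.
have eW' : W = mx (u' ++ [:: Bracket e]) ([:: Bracket v''] ++ b) by rewrite -eW eu ev.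
have [lt1 lt2 lt3] := ltw_mx_brackets u' e v'' b; rewrite -eW' in lt1 lt2 lt3.
have rPe : is_rbword [:: Bracket e] by rewrite rb_bracket.
have c1 := IHl _ _ _ lt1 re (normal_at_rbo N').
have c2 := IHl _ _ _ lt2 rPe N'.
have c3 := IHl _ _ _ lt3 re N'.
rewrite eh eu -(wd_cat lam ru') rbpA -[wd [:: Bracket e] ** (rbo h' ** _)]rbpA.
rewrite -{1}rbo_wd // rbo_mul rbo_wd // eW' mx_brackets.
set M := wmax _ _; apply: (@comb_bracket_ctx (le M) _ _ _ e).
- by rewrite catA rb_cat ru' rb junction_ncatl //; have [_ _] := rb_catP ratb; rewrite et.
- by move=> w le_w; apply: (lew_cat u' b (lew_bracket le_w)).
- apply: combD; first apply: combD.
  + by apply: combS c1 => w le_w; apply: lew_trans le_w (lew_maxl _ _).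
  + by apply: combS c2 => w le_w; apply: lew_trans le_w (lew_maxr _ _).
  + apply: combZ; apply: combS c3 => w le_w; apply/lewW/(lew_ltw_trans le_w).
    by apply: wsize_ltw; rewrite wsize_mx wsize_wmax_mx.
Qed.

(** The mirror image of [mult_step]: the case distinction is on [b], and the summands of a
    composition of right multiplication are passed to left multiplication by [a] below [W]. *)
Lemma rmult_step W : mult_closed_below W -> rmult_closed_below W ->
  forall u h v, mx v u = W -> is_rbword u -> normal_at h v ->
  comb (le W) (h ** wd u).
Proof.
move=> IHl IHr u h v eW ru N.
have [un|not_unit] := Classical_Prop.classic has_unit.
  by rewrite -eW; case: (unit_mult un ru N).
have [jvu|njvu] := boolP (junction v u).
  rewrite -eW mx_cat //.
  have rvu : is_rbword ([::] ++ v ++ u) by rewrite /= rb_cat ru jvu (normal_at_leads N).1.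
  by have := normal_at_ctx N rvu; rewrite wd1b => /comb1; apply; apply: lew_refl.
have /normal_atP [a [t [b [x [cx ratb eh ev]]]]] := N.
have nt : t != [::].
  by apply/negP => /eqP e; apply: not_unit; apply: core_nil cx e.
have nu : u != [::].
  by apply: contraNneq njvu => ->; rewrite /junction andbF.
have [ra rt rb rat rtb] := rb_sub ratb.
have [eb|nb] := eqVneq b [::]; last first.
  rewrite eh !rbpA; apply: (comb_bnd
      (B := fun w => [/\ w != [::], starts_with_bracket w = starts_with_bracket b
                      & lew w (mx b u)])
      (L := fun f => wd a ** (x ** f))) => [|c y z|r [nr sr le_r]|].
  - by rewrite !mulb0.
  - by rewrite !(mulbD, mulbZ).
  - rewrite -wd_val; apply: (comb1 (v := a ++ t ++ r)).
      apply/normal_atP; exists a, t, r, x; split=> //.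
      rewrite catA rb_cat (valP r) rat; move: ratb; rewrite catA => /rb_catP [_ _].
      by rewrite (junction_eqr _ sr).
    rewrite -eW ev !catA mx_catl //.
    by have := lew_cat (a ++ t) [::] le_r; rewrite !cats0.
  - move=> r rin; have [nr sr _] := bnd_mul_ends rb ru nb nu rin.
    by split=> //; apply: bnd_mulw rin.
rewrite eb wdb1 in eh; rewrite eb cats0 in ev ratb; rewrite {b eb rb rtb} in ev ratb.
have [v' [b' [e [u' [ev' eu]]]]] := not_junction njvu.
have ru' : is_rbword ([:: Bracket e] ++ u') by move: ru; rewrite eu.
have [re ru0 ju0] := rb_catP ru'; rewrite rb_bracket in re.
case: cx => [[Sx x0 et]|[h' [v'' [N' ex et]]]].
  have et_b : ends_with_bracket (lead x).
    have : ends_with_bracket v by rewrite ev' ends_cat.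
    by rewrite ev ends_cat -et; case: (t) nt.
  have su_b : starts_with_bracket u by rewrite eu.
  have cs := right_mult_comb Sx x0 ru et_b su_b; rewrite -et in cs.
  rewrite eh rbpA; apply: (comb_map (L := fun f => wd a ** f)) cs => [|c y z|h0 v0 N0].
  - by rewrite mulb0.
  - by rewrite mulbD mulbZ.
  - have jat : junction a t by case: (rb_catP ratb).
    have eWt : W = a ++ mx t u by rewrite -eW ev mx_catl.
    case/orP=> [/eqP ev0|lt0].
      have jav0 : junction a v0.
        by rewrite ev0 (junction_eqr _ (mx_ends nt nu).1).
      have rav0 : is_rbword (a ++ v0 ++ [::]).
        by rewrite cats0 rb_cat (normal_at_leads N0).1 ra jav0.
      have := normal_at_ctx N0 rav0; rewrite wdb1 cats0 => /comb1; apply.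
      by rewrite eWt -ev0; apply: lew_refl.
    have ltW : ltw (mx a v0) W.
      rewrite eWt -[a ++ mx t u]mx_cat; first exact: mx_monor.
      by rewrite (junction_eqr _ (mx_ends nt nu).1).
    apply: combS (IHl _ _ _ ltW ra N0) => w le_w.
    by apply: lewW; apply: lew_ltw_trans le_w ltW.
move: eh ev; rewrite ex et => eh ev.
have eW' : W = mx (a ++ [:: Bracket v'']) ([:: Bracket e] ++ u') by rewrite -eW eu ev.
have [lt1 lt2 lt3] := ltw_mx_brackets a v'' e u'; rewrite -eW' in lt1 lt2 lt3.
have rPe : is_rbword [:: Bracket e] by rewrite rb_bracket.
have c1 := IHr _ _ _ lt1 rPe N'.
have c2 := IHr _ _ _ lt2 re (normal_at_rbo N').
have c3 := IHr _ _ _ lt3 re N'.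
have -> : wd u = wd [:: Bracket e] ** wd u' by rewrite wd_cat // eu.
rewrite eh rbpA -[rbo h' ** (_ ** _)]rbpA.
rewrite -{1}rbo_wd // rbo_mul rbo_wd // eW' mx_brackets.
set M := wmax _ _; apply: (@comb_bracket_ctx (le M) _ _ _ v'').
- rewrite catA rb_cat ru0 junction_ncatl //; apply/and3P; split=> //.
  by rewrite -et.
- by move=> w le_w; apply: (lew_cat a u' (lew_bracket le_w)).
- apply: combD; first apply: combD.
  + by apply: combS c1 => w le_w; apply: lew_trans le_w (lew_maxl _ _).
  + by apply: combS c2 => w le_w; apply: lew_trans le_w (lew_maxr _ _).
  + apply: combZ; apply: combS c3 => w le_w; apply/lewW/(lew_ltw_trans le_w).
    by apply: wsize_ltw; rewrite wsize_mx wsize_wmax_mx.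
Qed.

Hypothesis ltw_acc : forall u, Acc (fun v w : bword Y => is_true (ltw v w)) u.

Lemma mult_closed W : mult_closed_below W /\ rmult_closed_below W.
Proof.
elim/Acc_ind: W / (ltw_acc W) => W _ IH.
by split=> u h v /IH [IHl IHr] ru N; [apply: mult_step N | apply: rmult_step N].
Qed.

Lemma normal_mul u h v : is_rbword u -> normal_at h v ->
  comb (le (mx u v)) (wd u ** h).
Proof. by move=> ru N; have [IHl IHr] := mult_closed (mx u v); apply: mult_step N. Qed.

Lemma normal_rmul u h v : is_rbword u -> normal_at h v ->
  comb (le (mx v u)) (h ** wd u).
Proof. by move=> ru N; have [IHl IHr] := mult_closed (mx v u); apply: rmult_step N. Qed.

Lemma comb_bnd_mul u f h v : bnd (ltr u) f -> normal_at h v ->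
  comb (lt (mx u v)) (f ** h).
Proof.
move=> bf N; apply: (comb_bnd (B := lt u) (L := fun f => f ** h)) bf => [|c y z|r lt_r].
- by rewrite mul0b.
- by rewrite mulDb mulZb.
- rewrite -wd_val; apply: combS (normal_mul (valP r) N) => w le_w.
  exact: lew_ltw_trans le_w (mx_monol _ lt_r).
Qed.

Lemma comb_bnd_rmul u f h v : bnd (ltr u) f -> normal_at h v ->
  comb (lt (mx v u)) (h ** f).
Proof.
move=> bf N; apply: (comb_bnd (B := lt u) (L := fun f => h ** f)) bf => [|c y z|r lt_r].
- by rewrite mulb0.
- by rewrite mulbD mulbZ.
- rewrite -wd_val; apply: combS (normal_rmul (valP r) N) => w le_w.
  exact: lew_ltw_trans le_w (mx_monor _ lt_r).
Qed.

Lemma comb_lt_mul u v f : is_rbword u -> comb (lt v) f -> comb (lt (mx u v)) (wd u ** f).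
Proof.
move=> ru; apply: (comb_map (L := fun f => wd u ** f)) => [|c y z|h v' N lt_v].
- by rewrite mulb0.
- by rewrite mulbD mulbZ.
- apply: combS (normal_mul ru N) => w le_w.
  exact: lew_ltw_trans le_w (mx_monor _ lt_v).
Qed.

Lemma comb_lt_rmul u v f : is_rbword u -> comb (lt v) f -> comb (lt (mx v u)) (f ** wd u).
Proof.
move=> ru; apply: (comb_map (L := fun f => f ** wd u)) => [|c y z|h v' N lt_v].
- by rewrite mul0b.
- by rewrite mulDb mulZb.
- apply: combS (normal_rmul ru N) => w le_w.
  exact: lew_ltw_trans le_w (mx_monol _ lt_v).
Qed.

Lemma mx_ctx a v b : is_rbword (a ++ v ++ b) -> mx a (mx v b) = a ++ v ++ b.
Proof.
by move=> r; have [_ rvb jl] := rb_catP r; have [_ _ jr] := rb_catP rvb; rewrite !mx_cat.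
Qed.

Lemma comb_lt_ctx a b v f : is_rbword (a ++ v ++ b) -> comb (lt v) f ->
  comb (lt (a ++ v ++ b)) (wd a ** (f ** wd b)).
Proof.
move=> r cf; have [ra _ rb _ _] := rb_sub r; rewrite -mx_ctx //.
by apply: comb_lt_mul => //; apply: comb_lt_rmul.
Qed.

Lemma comb_lt_rbo v f : comb (lt v) f -> comb (lt [:: Bracket v]) (rbo f).
Proof.
apply: (comb_map (L := rbo)) => [|c y z|h v' N lt_v].
- exact: rbo0.
- by rewrite rboD rboZ.
- by apply: comb1 (normal_at_rbo N) _; rewrite ltw_bracket.
Qed.

(** * The span as a differential Rota-Baxter ideal *)

Local Notation combT := (comb (fun=> True)).

Lemma combT_of B f : comb B f -> combT f. Proof. exact: combS. Qed.

Lemma combT_mul f g : combT g -> combT (f ** g).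
Proof.
elim=> [|c h v g' N _ _ IH]; first by rewrite mulb0; apply: CombNil.
rewrite mulbD mulbZ; apply: combD IH; apply: combZ.
elim/rbalg_ind: f => [|d r f IH]; first by rewrite mul0b; apply: CombNil.
rewrite mulDb mulZb; apply: combD IH; apply: combZ.
by rewrite -wd_val; apply: combT_of (normal_mul (valP r) N).
Qed.

Lemma combT_rmul f g : combT g -> combT (g ** f).
Proof.
elim=> [|c h v g' N _ _ IH]; first by rewrite mul0b; apply: CombNil.
rewrite mulDb mulZb; apply: combD IH; apply: combZ.
elim/rbalg_ind: f => [|d r f IH]; first by rewrite mulb0; apply: CombNil.
rewrite mulbD mulbZ; apply: combD IH; apply: combZ.
by rewrite -wd_val; apply: combT_of (normal_rmul (valP r) N).
Qed.

Lemma combT_rbo f : combT f -> combT (rbo f).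
Proof.
apply: (comb_map (L := rbo)) => [|c y z|h v' N _].
- exact: rbo0.
- by rewrite rboD rboZ.
- exact: comb1 (normal_at_rbo N) _.
Qed.

Lemma combT_S s : S s -> combT s.
Proof.
move=> Ss; have [->|s0] := eqVneq s 0; first exact: CombNil.
by apply: comb1 (core_normal_at _) _ => //; left.
Qed.

Lemma combT_leibniz f g x : x = f ** g -> combT f -> combT (rbd f) -> combT (rbd x).
Proof.
move=> -> cf cdf; rewrite rbdM; apply: combD; first apply: combD.
- exact: combT_rmul.
- exact: combT_rmul.
- by apply: combZ; apply: combT_rmul.
Qed.

Lemma combT_leibniz_r f g x : x = f ** g -> combT g -> combT (rbd g) -> combT (rbd x).
Proof.
move=> -> cf cdf; rewrite rbdM; apply: combD; first apply: combD.
- exact: combT_mul.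
- exact: combT_mul.
- by apply: combZ; apply: combT_mul.
Qed.

(** The Leibniz rule moves d to the core, where either d(s) is again in [S] or d(P(h)) = h; what
    remains are products, which stay in the span. *)
Lemma combT_rbd f : combT f -> combT (rbd f).
Proof.
apply: (comb_map (L := rbd)) => [|c y z|h v N _].
- exact: rbd0.
- by rewrite rbdD rbdZ.
case: N => {h v} [s a b Ss s0 _|h v a b N _]; apply: combT_leibniz_r erefl _ _.
- by apply: combT_rmul; apply: combT_S.
- by apply: combT_leibniz erefl _ _; apply: combT_S => //; apply: S_der.
- by apply: combT_rmul; apply: combT_rbo; apply: comb1 N _.
- apply: combT_leibniz erefl _ _; first by apply: combT_rbo; apply: comb1 N _.
  by rewrite rbd_rbo; apply: comb1 N _.
Qed.

(** * Two normal elements with the same leading word *)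

Lemma comb_disjoint a v1 b v2 e h1 h2 : normal_at h1 v1 -> normal_at h2 v2 ->
  is_rbword (a ++ v1 ++ b ++ v2 ++ e) ->
  comb (lt (a ++ v1 ++ b ++ v2 ++ e))
    (wd a ** (h1 ** wd (b ++ v2 ++ e)) - wd (a ++ v1 ++ b) ** (h2 ** wd e)).
Proof.
move=> N1 N2 r; have [ra r1 rbve rav rvbve] := rb_sub r.
have [rb r2 re rbv rve] := rb_sub rbve.
have ravb : is_rbword (a ++ v1 ++ b).
  have : is_rbword ((a ++ v1 ++ b) ++ (v2 ++ e)) by rewrite -!catA.
  by case/rb_catP.
have [g1 e1 b1] := leads_expand (normal_at_leads N1).
have [g2 e2 b2] := leads_expand (normal_at_leads N2).
(* Replacing v1 by h1 - g1 and v2 by h2 - g2 makes the products of [h1] with [h2] cancel; each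
   remaining term pairs a normal element with a remainder below the other leading word. *)
pose F := wd a ** (g1 ** wd b); pose G := wd b ** (g2 ** wd e).
have -> : wd a ** (h1 ** wd (b ++ v2 ++ e)) - wd (a ++ v1 ++ b) ** (h2 ** wd e) =
    F ** (h2 ** wd e) - (wd a ** h1) ** G.
  have -> : wd (b ++ v2 ++ e) = wd b ** (h2 ** wd e) - G.
    by rewrite /G e2 mulDb mulbD !wd_cat // addrK.
  have -> : wd (a ++ v1 ++ b) = wd a ** (h1 ** wd b) - F.
    have [_ _ _ _ rvb] := rb_sub ravb.
    by rewrite /F e1 mulDb mulbD !wd_cat // addrK.
  by rewrite !mulbB mulBb !rbpA opprB addrC addrA subrK.
apply: combD.
  have N2e := normal_at_ctx N2 (a := [::]) (b := e) rve; rewrite wd1b in N2e.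
  have bF : bnd (ltr (a ++ v1 ++ b)) F.
    have [_ _ _ _ rvb] := rb_sub ravb.
    rewrite -mx_ctx //; apply: bnd_mul_ltr; first exact: bnd_wd_le.
    by apply: bnd_mul_ltl => //; apply: bnd_wd_le.
  apply: combS (comb_bnd_mul bF N2e) => w; rewrite mx_cat /= -?catA //.
  have : is_rbword ((a ++ v1 ++ b) ++ (v2 ++ e)) by rewrite -!catA.
  by case/rb_catP.
apply: combN; have N1a : normal_at (wd a ** h1) (a ++ v1).
  have := @normal_at_ctx a [::] _ _ N1; rewrite wdb1 cats0; exact.
have bG : bnd (ltr (b ++ v2 ++ e)) G.
  rewrite -mx_ctx //; apply: bnd_mul_ltr; first exact: bnd_wd_le.
  by apply: bnd_mul_ltl => //; apply: bnd_wd_le.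
apply: combS (comb_bnd_rmul bG N1a) => w; rewrite mx_cat -?catA //.
have : is_rbword ((a ++ v1) ++ (b ++ v2 ++ e)) by rewrite -!catA.
by case/rb_catP.
Qed.

Hypothesis inclusion_comb : forall s h, S s -> s != 0 -> normal_at h (lead s) ->
  comb (lt (lead s)) (s - h).
Hypothesis intersection_comb : forall f g u v w, S f -> S g -> f != 0 -> g != 0 ->
  is_rbword w -> w = lead f ++ u -> w = v ++ lead g ->
  (maxn (size (lead f)) (size (lead g)) < size w < size (lead f) + size (lead g))%N ->
  comb (lt w) (f ** wd u - wd v ** g).

Definition same_lead_below (N : nat) := forall h1 h2 v, (wsize v < N)%N ->
  normal_at h1 v -> normal_at h2 v -> comb (lt v) (h1 - h2).

(** For [x1] in [S] this is an inclusion composition. For x1 = P(h1) the word [t1] has one factor,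
    so [a] and [b] are empty: either [x2] is in [S] and the roles are exchanged, or both are
    brackets and the induction applies to their contents. *)
Lemma comb_core_inclusion N x1 x2 a t1 t2 b : same_lead_below N ->
  (wsize t1 <= N)%N -> core x1 t1 -> core x2 t2 -> t2 != [::] -> t1 = a ++ t2 ++ b ->
  comb (lt t1) (x1 - wd a ** (x2 ** wd b)).
Proof.
move=> IH leN c1 c2 nt2 et1; have l1 := core_leads c1; have rt1 := l1.1.
have N2 : normal_at (wd a ** (x2 ** wd b)) t1.
  by rewrite et1; apply: normal_at_ctx (core_normal_at c2) _; rewrite -et1.
case: (c1) => [[S1 nz1 e1]|[h1 [v1 [N1 ex1 e1]]]].
  by rewrite e1; apply: inclusion_comb; rewrite -?e1.
have [ea eb] : a = [::] /\ b = [::].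
  move: et1; rewrite e1; case: (a) => [|y [|z a']]; case: (t2) nt2 => [//|z' [|w' t']] _ //;
  by case: (b).
rewrite ea eb cats0 /= in et1; rewrite ea eb wd1b wdb1 {a b ea eb N2}.
case: c2 => [[S2 nz2 e2]|[h2 [v2 [N2 ex2 e2]]]].
  apply: combB_sym; rewrite et1 e2; apply: inclusion_comb => //.
  by rewrite -e2 -et1; apply: core_normal_at.
rewrite e2 e1 in et1; case: et1 => ev; rewrite ex1 ex2 e1 -rboN -rboD.
apply/comb_lt_rbo/IH => //; last by rewrite ev.
by rewrite e1 wsize_bracket in leN; apply: leq_ltn_trans (leq_addr _ _) leN.
Qed.

(** The relative position of the two cores decides: disjoint, the second inside the first, the first
    a prefix of the second, or a proper overlap. Lengths of prefixes distinguish the cases, and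
    [size a1 <= size a2] fixes which core starts first. *)
Lemma comb_cores N x1 x2 a1 t1 b1 a2 t2 b2 : same_lead_below N ->
  (wsize (a1 ++ t1 ++ b1) <= N)%N ->
  core x1 t1 -> core x2 t2 -> t1 != [::] -> t2 != [::] ->
  is_rbword (a1 ++ t1 ++ b1) -> a1 ++ t1 ++ b1 = a2 ++ t2 ++ b2 ->
  (size a1 <= size a2)%N ->
  comb (lt (a1 ++ t1 ++ b1))
    (wd a1 ** (x1 ** wd b1) - wd a2 ** (x2 ** wd b2)).
Proof.
move=> IH leN c1 c2 nt1 nt2 r e le_a.
have cat_split p q p' q' : p ++ q = p' ++ q' -> (size p <= size p')%N ->
    exists m, p' = p ++ m /\ q = m ++ q' :> bword Y.
  move=> epq le_p; exists (drop (size p) p').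
  have ep : p = take (size p) p'.
    by rewrite -(takel_cat q' le_p) -epq take_size_cat.
  split; first by rewrite {1}ep cat_take_drop.
  have : p ++ q = p ++ (drop (size p) p' ++ q').
    by rewrite epq catA {1}ep cat_take_drop.
  by move/eqP; rewrite eqseq_cat // eqxx => /eqP.
have [a [ea2 e']] := cat_split _ _ _ _ e le_a.
have [ra1 rt1 rb1 ra1t1 rt1b1] := rb_sub r.
have [le_t|lt_t] := leqP (size t1) (size a).
  have [b [ea eb1]] := cat_split _ _ _ _ e' le_t.
  rewrite ea2 ea eb1; apply: comb_disjoint; [exact: core_normal_at|exact: core_normal_at|].
  by rewrite -eb1.
have [t1' [et1 e'']] := cat_split _ _ _ _ (esym e') (ltnW lt_t).
have r2 : is_rbword (a2 ++ t2 ++ b2) by rewrite -e.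
have [ra2 _ rb2 _ _] := rb_sub r2.
have wda2 : wd a2 = wd a1 ** wd a by rewrite wd_cat -?ea2.
have [le_t2|lt_t2] := leqP (size t2) (size t1').
  have [b [et1' eb2]] := cat_split _ _ _ _ e'' le_t2.
  have wdb2 : wd b2 = wd b ** wd b1 by rewrite wd_cat -?eb2.
  have et : t1 = a ++ t2 ++ b by rewrite et1 et1'.
  have le_t1 : (wsize t1 <= N)%N.
    apply: leq_trans leN; rewrite !wsize_cat.
    by apply: leq_trans (leq_addl _ _); apply: leq_addr.
  have := comb_lt_ctx r (comb_core_inclusion IH le_t1 c1 c2 nt2 et).
  by rewrite mulBb mulbB wda2 wdb2 !rbpA.
have [t2' [et2 eb1]] := cat_split _ _ _ _ (esym e'') (ltnW lt_t2).
have wdb1' : wd b1 = wd t2' ** wd b2 by rewrite wd_cat -?eb1.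
(* Both cores start together and the second is longer: an inclusion with the roles exchanged. *)
have [ea|na] := eqVneq a [::].
  rewrite ea /= in et1; have et : t2 = [::] ++ t1 ++ t2' by rewrite et1.
  have le_t2 : (wsize t2 <= N)%N.
    apply: leq_trans leN; rewrite e !wsize_cat.
    by apply: leq_trans (leq_addl _ _); apply: leq_addr.
  have := comb_lt_ctx r2 (comb_core_inclusion IH le_t2 c2 c1 nt1 et).
  rewrite e mulBb mulbB => /combB_sym.
  by rewrite ea2 ea cats0 wdb1' wd1b !rbpA.
have nt1' : t1' != [::].
  by apply: contraTneq lt_t => e0; rewrite et1 e0 cats0 ltnn.
have nt2' : t2' != [::].
  by apply: contraTneq lt_t2 => e0; rewrite et2 e0 cats0 ltnn.
have [size_a size_t1' size_t2'] : [/\ 0 < size a, 0 < size t1' & 0 < size t2']%N.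
  by rewrite !lt0n !size_eq0.
(* In a proper overlap each core has at least two factors, so neither is a single bracket and both
   lie in [S]. *)
case: c1 => [[S1 nz1 el1]|[? [? [_ _ el1]]]]; last first.
  have := congr1 size et1; rewrite el1 size_cat /=.
  by case: (size a) (size t1') size_a size_t1' => [|?] [|?] // _ _; rewrite addSn addnS.
case: c2 => [[S2 nz2 el2]|[? [? [_ _ el2]]]]; last first.
  have := congr1 size et2; rewrite el2 size_cat /=.
  by case: (size t1') (size t2') size_t1' size_t2' => [|?] [|?] // _ _; rewrite addSn addnS.
have ew : t1 ++ t2' = a ++ t2 by rewrite et1 et2 catA.
have rw : is_rbword (t1 ++ t2').
  have : is_rbword (a1 ++ (t1 ++ t2') ++ b2) by move: r; rewrite eb1 -!catA.
  by case/rb_sub.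
have cw : comb (lt (t1 ++ t2')) (x1 ** wd t2' - wd a ** x2).
  apply: intersection_comb => //; rewrite -?el1 -?el2 //.
  have -> : size t2 = (size t1' + size t2')%N by rewrite et2 size_cat.
  rewrite size_cat; have -> : size t1 = (size a + size t1')%N by rewrite et1 size_cat.
  by move: size_a size_t1' size_t2'; move: (size a) (size t1') (size t2'); clear; lia.
have rw' : is_rbword (a1 ++ (t1 ++ t2') ++ b2) by move: r; rewrite eb1 -!catA.
have := comb_lt_ctx rw' cw; rewrite eb1 -!catA.
by rewrite mulBb mulbB wda2 -(wd_cat lam (u := t2')) ?rbpA // -eb1.
Qed.

Lemma same_lead_comb h1 h2 v : normal_at h1 v -> normal_at h2 v -> comb (lt v) (h1 - h2).
Proof.
have [N] := ubnP (wsize v); elim: N h1 h2 v => // N IH h1 h2 v; rewrite ltnS => leN N1 N2.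
have [un|not_unit] := Classical_Prop.classic has_unit.
  apply: unit_comb => //; have [_ b1] := normal_at_leads N1.
  have [_ b2] := normal_at_leads N2.
  rewrite -(subrK (wd v) h1) -addrA; apply: bndD => //.
  rewrite -opprB -scaleN1r; exact: bndZ.
have /normal_atP [a1 [t1 [b1 [x1 [c1 r1 eh1 ev1]]]]] := N1.
have /normal_atP [a2 [t2 [b2 [x2 [c2 r2 eh2 ev2]]]]] := N2.
have nt1 : t1 != [::] by apply/negP => /eqP e; apply: not_unit; apply: core_nil c1 e.
have nt2 : t2 != [::] by apply/negP => /eqP e; apply: not_unit; apply: core_nil c2 e.
have e12 : a1 ++ t1 ++ b1 = a2 ++ t2 ++ b2 by rewrite -ev1.
rewrite eh1 eh2; have [le12|/ltnW le21] := leqP (size a1) (size a2).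
  by rewrite ev1; apply: (comb_cores IH _ c1 c2) => //; rewrite -ev1.
by rewrite ev2; apply: combB_sym; apply: (comb_cores IH _ c2 c1) => //; rewrite -ev2.
Qed.

(** Summands with leading word [W] agree modulo lower ones, so they merge into a single multiple of
    one of them; its coefficient then tells whether [W] survives in [f]. *)
Lemma comb_top W f : comb (le W) f ->
  comb (lt W) f \/ exists h c g, [/\ normal_at h W, comb (lt W) g & f = c *: h + g].
Proof.
elim=> [|c h v f' N le_v _ IH]; first by left; apply: CombNil.
case/orP: le_v => [/eqP ev|lt_v]; last first.
  case: IH => [cf|[h' [c' [g [N' cg ->]]]]]; first by left; apply: CombCons N lt_v cf.
  right; exists h', c', (c *: h + g); split=> //; first exact: CombCons N lt_v cg.
  by rewrite addrCA.
rewrite ev in N; case: IH => [cf|[h' [c' [g [N' cg ->]]]]]; right.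
  by exists h, c, f'.
exists h', (c + c'), (c *: (h - h') + g); split=> //.
  by apply: combD cg; apply: combZ; apply: same_lead_comb.
by rewrite scalerDl scalerBr [RHS]addrACA [X in _ = X + _]addrC subrK.
Qed.

(** A strict bound by [W] is turned into a weak bound by the largest leading word that occurs, the
    form in which well-founded induction can be continued. *)
Lemma comb_lt_max W f : comb (lt W) f -> f = 0 \/ exists2 V, ltw V W & comb (le V) f.
Proof.
elim=> [|c h v f' N lt_v _ IH]; first by left.
right; case: IH => [->|[V lt_V cf]].
  by exists v => //; rewrite addr0; apply: combZ; apply: comb1 N (lew_refl _).
exists (wmax v V); first exact: wmax_lt.
apply: CombCons N (lew_maxl _ _) _.
by apply: combS cf => w le_w; apply: lew_trans le_w (lew_maxr _ _).
Qed.

Lemma comb_lead W f : comb (le W) f -> f != 0 -> exists h, normal_at h (lead f).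
Proof.
elim/Acc_ind: W / (ltw_acc W) f => W _ IH f cf nz.
have lower g : comb (lt W) g -> g != 0 -> exists h, normal_at h (lead g).
  by case/comb_lt_max=> [->|[V /IH lead_g cg]]; [rewrite eqxx | apply: lead_g].
case: (comb_top cf) => [/lower|[h [c [g [N cg ef]]]]]; first exact.
have [c0|nc] := eqVneq c 0.
  by rewrite ef c0 scale0r add0r in nz *; apply: lower.
pose r := RBWord (normal_at_leads N).1.
have [/(_ W (fun v lv => lv)) bg _] := comb_leads cg.
(* The coefficient of [f] at [W] is [c], because [h] is monic there and [g] stays strictly below. *)
have er : lead f = r.
  apply: eq_lead.
    rewrite ef coeffD coeffZ (leads_coeff (normal_at_leads N)) // mulr1.
    have -> : g@_r = 0; last by rewrite addr0.
    move/bnd_coeff: bg => bg; apply/eqP; apply: contraT => /bg.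
    by rewrite ltw_irr.
  rewrite ef; apply: bndD; last by apply: bndS bg => s /lewW.
  by apply: bndZ; apply: leads_le (normal_at_leads N).
by exists h; rewrite er.
Qed.

Lemma combT_lead f : combT f -> f != 0 -> exists h, normal_at h (lead f).
Proof.
move=> cf; suff [W cW] : exists W, comb (le W) f by apply: comb_lead cW.
elim: cf => [|c h v f' N _ _ [W cW]]; first by exists [::]; apply: CombNil.
exists (wmax v W); apply: CombCons N (lew_maxl _ _) _.
by apply: combS cW => w le_w; apply: lew_trans le_w (lew_maxr _ _).
Qed.
End NormalCombinations.

(** * Contexts with a star *)

Lemma foldr_and (T : Type) (K : T -> Prop) (s : seq T) :
  (forall x, K x) -> foldr (fun x => and (K x)) True s.
Proof. by move=> Kx; elim: s. Qed.

Section StarEmbedding.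
Variables (X : Type) (n : nat).
Local Notation Y := (diffvar n X).
Local Notation Z := (diffvar n (option X)).
Implicit Types (a b u v w : bword Y) (p q : bword Z).

Fixpoint embf (f : factor Y) : factor Z :=
  match f with
  | Letter y => Letter (Some y.1, y.2)
  | Bracket w => Bracket (map embf w)
  end.

Definition emb w : bword Z := map embf w.

Lemma emb_cat u v : emb (u ++ v) = emb u ++ emb v.
Proof. exact: map_cat. Qed.

Lemma stars_cat p q : stars (p ++ q) = stars p ++ stars q.
Proof. by rewrite /stars map_cat flatten_cat. Qed.

Lemma repl_cat p q v : repl (p ++ q) v = repl p v ++ repl q v.
Proof. by rewrite /repl map_cat flatten_cat. Qed.

Lemma repl_letter i v : repl [:: Letter (None, i)] v = v.
Proof. exact: cats0. Qed.

Lemma repl_bracket q v : repl [:: Bracket q] v = [:: Bracket (repl q v)].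
Proof. by []. Qed.

Lemma stars_emb w : stars (emb w) = [::].
Proof.
suff fstars_emb f : fstars (embf f) = [::] by elim: w => //= f w; rewrite /stars /= fstars_emb.
elim: f => [[x i]|u IH] //=; elim: u IH => //= f u IHu [-> /IHu]; exact.
Qed.

Lemma repl_emb w v : repl (emb w) v = w.
Proof.
suff replf_emb f : replf v (embf f) = [:: f] by elim: w => //= f w; rewrite /repl /= replf_emb => ->.
elim: f => [[x i]|u IH] //=; congr [:: Bracket _].
by elim: u IH => //= f u IHu [-> /IHu ->].
Qed.

Lemma rb_emb w : is_rbword (emb w) = is_rbword w.
Proof.
have brk f : is_bracket (embf f) = is_bracket f by case: f.
have adj u : no_adjacent_brackets (emb u) = no_adjacent_brackets u.
  by rewrite /no_adjacent_brackets /emb sorted_map; apply: eq_sorted => f g /=; rewrite !brk.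
have factors u : foldr (fun f => and (rb_factor (embf f) = rb_factor f)) True u ->
    all (@rb_factor _) (emb u) = all (@rb_factor _) u.
  by elim: u => //= f u IHu [-> /IHu ->].
have factor1 f : rb_factor (embf f) = rb_factor f.
  by elim: f => //= u /factors; rewrite -/(emb u) adj => ->.
by rewrite /is_rbword adj factors //; apply: foldr_and.
Qed.

Lemma no_stars_emb q : stars q = [::] -> exists w, q = emb w.
Proof.
have factors p : foldr (fun f => and (fstars f = [::] -> exists g, f = embf g)) True p ->
    stars p = [::] -> exists w, p = emb w.
  elim: p => [|f p IHp]; first by exists [::].
  move=> [Kf Kp]; rewrite /stars /= => e.
  have [ef ep] : fstars f = [::] /\ stars p = [::].
    by case: (fstars f) e => //= ->.
  by have [g ->] := Kf ef; have [w ->] := IHp Kp ep; exists (g :: w).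
have factor1 f : fstars f = [::] -> exists g, f = embf g.
  elim: f => [[[x|] i] // _|p IHp /= /(factors _ IHp) [w ->]]; first by exists (Letter (x, i)).
  by exists (Bracket w).
by apply: factors; apply: foldr_and.
Qed.

(** The two alternatives correspond to the constructors of [normal_at]: the star stands at the
    outermost level, or inside exactly one bracket. *)
Lemma stars_split q l : stars q = [:: l] ->
  (exists a b, q = emb a ++ [:: Letter (None, l)] ++ emb b) \/
  exists a p b, stars p = [:: l] /\ q = emb a ++ [:: Bracket p] ++ emb b.
Proof.
elim: q => // f q IH; rewrite /stars /= -/(stars q).
case ef: (fstars f) => [|i t] /=.
  have [[|g w] // ew] : exists w, [:: f] = emb w by apply: no_stars_emb; rewrite /stars /= ef.
  case: ew => -> _ /IH [[a [b ->]]|[a [p [b [sp ->]]]]].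
    by left; exists (g :: a), b.
  by right; exists (g :: a), p, b.
case=> ei et; have [{}et eq] : t = [::] /\ stars q = [::] by case: (t) et => //= ->.
have [b ->] := no_stars_emb eq; move: ef; rewrite et ei.
case: f => [[[x|] j] // [->]|p ep]; first by left; exists [::], b.
by right; exists [::], p, b.
Qed.
End StarEmbedding.

Section LinearMaps.
Variables (k : comPzRingType) (Y : choiceType).
Local Notation A := (rbalg k Y).

Lemma linext_comp (L : A -> A) (phi : rbword Y -> A) f : L 0 = 0 ->
  (forall c x y, L (c *: x + y) = c *: L x + L y) ->
  linext (fun w => L (phi w)) f = L (linext phi f).
Proof.
move=> L0 LD; elim/rbalg_ind: f => [|c w f IH]; first by rewrite !linext0.
by rewrite !linextD !linextZ !linext_mono IH LD.
Qed.

Lemma linext_id f : linext mono f = f :> A.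
Proof.
elim/rbalg_ind: f => [|c w f IH]; first by rewrite linext0.
by rewrite linextD linextZ linext_mono IH.
Qed.
End LinearMaps.

(** * Derivatives of elements led by a letter *)

Section Shift.
Variables (k : comPzRingType) (lam : k).
Variables (disp : Order.disp_t) (X : orderType disp) (n : nat).
Local Notation Y := (diffvar n X).
Local Notation A := (rbalg k Y).
Local Notation rbd := (@rbd k lam X n).
Implicit Types (y z : Y) (r : rbword Y) (f : A).

Lemma iter_der l f : iter l (der lam) f = iter l rbd f.
Proof. by elim: l => //= l ->; rewrite rbdE. Qed.

Lemma shiftvP l y z : shiftv l y = Some z <-> z.1 = y.1 /\ z.2 = (y.2 + l)%N :> nat.
Proof.
rewrite /shiftv; case: z y => [x j] [x' i] /=; split.
  by case: insubP => //= j' _ ej [<- <-].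
case=> -> ej; case: insubP => [j' _ ej'|] /=; last by rewrite -ej ltn_ord.
by congr (Some (_, _)); apply: val_inj; rewrite /= ej'.
Qed.

Lemma shiftv_lt y z y' z' : ltletter y y' ->
  shiftv 1 y = Some z -> shiftv 1 y' = Some z' -> ltletter z z'.
Proof.
move=> lt_y /shiftvP [e1 e2] /shiftvP [e1' e2'].
by rewrite /ltletter e1 e1' e2 e2' ltn_add2r.
Qed.

Lemma ltw_letter (u : bword Y) y : ltw u [:: Letter y] ->
  u = [::] \/ exists2 z, u = [:: Letter z] & ltletter z y.
Proof.
case/orP=> [|/andP [/eqP e]].
  rewrite /ltdeg /= => /orP [|/andP [_ //]].
  by rewrite ltnS leqn0 => /eqP /wsize0; left.
case: u e => [|f u] e; first by left.
case/orP=> [|/andP [_]]; last by case: u {e}.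
case: f e => [z|w] e; last by rewrite ltf_bracket_letter.
have /wsize0 -> : wsize u = 0%N by move: (wdeg_wsize e) => /= [].
by right; exists z.
Qed.

Lemma ltw_letters y z : ltletter y z -> ltw [:: Letter y] [:: Letter z].
Proof. by move=> lt_y; rewrite ltw_deg_lex //; apply/orP; left. Qed.

(** Below a letter there are only the empty word and smaller letters. On these d vanishes or shifts
    the index, and shifting preserves the order of letters, so the leading letter keeps leading. *)
Lemma leads_shift1 y z f : leads [:: Letter y] f -> shiftv 1 y = Some z ->
  leads [:: Letter z] (rbd f).
Proof.
move=> lf ez; split=> //; have [g -> bg] := leads_expand lf.
rewrite rbdD rbd_letter ez addrAC subrr add0r.
elim/bnd_ind: g / bg => [|c r g lt_r IH]; first by rewrite rbd0; apply: bnd0.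
rewrite rbdD rbdZ; apply: bndD IH; apply: bndZ; rewrite -wd_val.
have [->|[y' -> lt_y]] := ltw_letter lt_r; first by rewrite rbd_nil; apply: bnd0.
rewrite rbd_letter; case ez' : shiftv => [z'|]; last exact: bnd0.
by apply: bnd_wd => // t ->; apply: ltw_letters; apply: shiftv_lt lt_y ez' ez.
Qed.

Lemma leads_shift l y z f : leads [:: Letter y] f -> shiftv l y = Some z ->
  leads [:: Letter z] (iter l rbd f).
Proof.
elim: l z => [|l IH] z lf /shiftvP [e1 e2].
  suff -> : z = y by [].
  by case: z y e1 e2 {lf} => [? ?] [? ?] /= -> e; congr pair; apply: val_inj; rewrite /= e addn0.
have lt_l : (y.2 + l < n.+1)%N by rewrite (leq_trans _ (ltn_ord z.2)) // e2 addnS.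
have ey : shiftv l y = Some (y.1, Ordinal lt_l) by apply/shiftvP.
rewrite iterS; apply: leads_shift1 (IH _ lf ey) _.
by apply/shiftvP; rewrite e1 e2 addnS addn1.
Qed.
End Shift.

(** * The theorem *)

Section Conversion.
Variables (k : comPzRingType) (lam : k).
Variables (disp : Order.disp_t) (X : orderType disp) (n : nat).
Local Notation Y := (diffvar n X).
Local Notation Z := (diffvar n (option X)).
Local Notation A := (rbalg k Y).
Local Notation "f ** g" := (rbp lam f g) (at level 40, left associativity).
Local Notation wd := (@wd k Y).
Local Notation rbo := (@rbo k Y).
Local Notation rbd := (@rbd k lam X n).
Local Notation lt v := (fun u : bword Y => is_true (ltw u v)).
Local Notation le v := (fun u : bword Y => is_true (lew u v)).
Local Notation ltr v := (fun r : rbword Y => is_true (ltw r v)).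
Local Notation ler v := (fun r : rbword Y => is_true (lew r v)).
Variable S : A -> Prop.
Hypothesis S_monic : forall s, S s -> is_monic s \/ s = 0.
Hypothesis S_der : forall s, S s -> S (rbd s).
Implicit Types (a b t u v w : bword Y) (p q : bword Z) (c : k) (r : rbword Y).
Implicit Types (f g h s x y : A).
Local Notation normal_at := (normal_at lam S).
Local Notation comb := (comb lam S).
Local Notation combT := (comb (fun=> True)).

(** Substitution without the derivatives: [subst q s] is [subst_raw] at the derivative of [s]
    prescribed by the star. *)
Definition subst_raw q s : A := linext (fun w : rbword Y => Red lam (repl q w)) s.

Lemma subst_raw_star a b i s : is_rbword a -> is_rbword b ->
  subst_raw (emb a ++ [:: Letter (None, i)] ++ emb b) s = wd a ** (s ** wd b).
Proof.
move=> ra rb; rewrite -{2}[s]linext_id.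
rewrite -(linext_comp (L := fun x => wd a ** (x ** wd b))) => [||c x y].
- apply: eq_linext => w _; rewrite !repl_cat !repl_emb repl_letter !Red_cat.
  by rewrite (Red_rb _ ra) (Red_rb _ rb) (Red_rb _ (valP w)) wd_val.
- by rewrite mul0b mulb0.
- by rewrite mulDb mulZb mulbD mulbZ.
Qed.

Lemma subst_raw_bracket a b q s : is_rbword a -> is_rbword b ->
  subst_raw (emb a ++ [:: Bracket q] ++ emb b) s =
  wd a ** (rbo (subst_raw q s) ** wd b).
Proof.
move=> ra rb.
rewrite -(linext_comp (L := fun x => wd a ** (rbo x ** wd b))) => [||c x y].
- apply: eq_linext => w _; rewrite !repl_cat !repl_emb repl_bracket !Red_cat.
  by rewrite (Red_rb _ ra) (Red_rb _ rb) Red_bracket.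
- by rewrite rbo0 mul0b mulb0.
- by rewrite rboD rboZ mulDb mulZb mulbD mulbZ.
Qed.

Lemma repl_star a b i v :
  repl (emb a ++ [:: Letter (None, i)] ++ emb b) v = a ++ v ++ b.
Proof. by rewrite !repl_cat !repl_emb repl_letter. Qed.

Lemma repl_star_bracket a b q v :
  repl (emb a ++ [:: Bracket q] ++ emb b) v = a ++ [:: Bracket (repl q v)] ++ b.
Proof. by rewrite !repl_cat !repl_emb repl_bracket. Qed.

Lemma subst_raw_normal_at q l s : stars q = [:: l] -> S s -> s != 0 ->
  is_rbword (repl q (lead s)) -> normal_at (subst_raw q s) (repl q (lead s)).
Proof.
move=> sq Ss s0; have [N] := ubnP (wsize q); elim: N q sq => // N IH q sq; rewrite ltnS => leN.
case: (stars_split sq) => [[a [b eq]]|[a [p [b [sp eq]]]]]; rewrite eq.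
  rewrite repl_star => r; have [ra _ rb _ _] := rb_sub r.
  by rewrite subst_raw_star //; apply: NormalStar.
rewrite repl_star_bracket => r; have [ra rpv rb _ _] := rb_sub r.
rewrite subst_raw_bracket //; apply: NormalBracket => //; apply: IH => //.
  apply: leq_trans leN; rewrite eq !wsize_cat wsize_bracket.
  apply: leq_trans (leq_addl _ _); rewrite addSn ltnS -addnA.
  exact: leq_addr.
by rewrite rb_bracket in rpv.
Qed.

Lemma normal_at_subst_raw h v : normal_at h v ->
  exists q s, [/\ is_rbword q, stars q = [:: ord0], S s, s != 0 &
                  repl q (lead s) = v /\ subst_raw q s = h].
Proof.
elim=> {h v} [s a b Ss s0 r|h v a b N [q [s [rq sq Ss s0 [<- <-]]]] r].
  have [ra _ rb _ _] := rb_sub r.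
  exists (emb a ++ [:: Letter (None, ord0)] ++ emb b), s.
  rewrite repl_star subst_raw_star //; split=> //.
    by rewrite !rb_cat !rb_emb ra rb /junction /= andbF.
  by rewrite !stars_cat !stars_emb.
have [ra _ rb _ _] := rb_sub r.
exists (emb a ++ [:: Bracket q] ++ emb b), s.
rewrite repl_star_bracket subst_raw_bracket //; split=> //.
  have : is_rbword (emb (a ++ [:: Bracket (repl q (lead s))] ++ b)) by rewrite rb_emb.
  by rewrite !emb_cat; apply: rb_subst_bracket.
by rewrite !stars_cat !stars_emb /stars /= cats0 -/(stars q) sq.
Qed.

Lemma normal_subst (q : starword X n) s : S s -> s != 0 -> normal q s ->
  normal_at (subst lam q s) (subst_lead q s).
Proof.
case: q => q l sq Ss s0; rewrite /normal /subst_lead /subst_word /subst /= iter_der.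
case ev: (shiftw l (lead s)) => [v|] //=.
case: insubP => //= r rqv er _; rewrite er.
have lS i : S (iter i rbd s) by elim: i => // i; apply: S_der.
suff [t0 et] : iter l rbd s != 0 /\ lead (iter l rbd s) = v :> bword Y.
  rewrite -et; apply: subst_raw_normal_at sq (lS l) t0 _.
  by rewrite et.
have mon_s : is_monic s by case: (S_monic Ss) => // e; rewrite e eqxx in s0.
(* A monic element forces 1 != 0 in [k], so the iterated derivative led by the shifted letter is
   nonzero and has that letter as its [lead]. *)
have nz := is_monic_one_neq0 mon_s; have ls := monic_leads mon_s.
move: ev; rewrite /shiftw; case: (l : nat) => [|i] //; first by case=> <-.
case: (lead s : bword Y) ls => [|[y|w] [|? ?]] // ls.
case ez: (shiftv i.+1 y) => [z|] //= [<-].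
by have [] := leads_lead nz (leads_shift lam ls ez).
Qed.

Lemma normal_atE h v : normal_at h v <->
  exists (q : starword X n) s,
    [/\ S s, s != 0, normal q s, subst lam q s = h & v = subst_lead q s].
Proof.
split=> [N|[q [s [Ss s0 nq <- ->]]]]; last exact: normal_subst.
have [q [s [rq sq Ss s0 [eq <-]]]] := normal_at_subst_raw N.
exists (StarWord (starword_val := RBWord rq) sq), s.
have rv : is_rbword (repl q (lead s)) by rewrite eq; case: (normal_at_leads S_monic N).
rewrite /normal /subst_lead /subst_word /= insubT /=.
by split.
Qed.

Lemma subst_lead_irr h v r : normal_at h v -> r = v :> bword Y -> ~ Irr S r.
Proof.
move=> /normal_atE [q [s [Ss s0 nq _ ->]]] er; apply; exists q, s.
by split=> //; apply: val_inj.
Qed.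

Lemma not_Irr r : ~ Irr S r -> exists h, normal_at h r.
Proof.
move=> /Classical_Prop.NNPP [q [s [Ss s0 nq ->]]].
by exists (subst lam q s); apply: normal_subst.
Qed.

Lemma normal_combination_comb (bound : rbword Y -> bool) (B : bword Y -> Prop) h :
  (forall r, bound r -> B r) -> normal_combination lam S bound h -> comb B h.
Proof.
move=> bB [m [c [q [s [H ->]]]]].
apply: big_ind => [|x y|i _]; [exact: CombNil|exact: combD|].
have [_ Ss s0 nq bnd_i] := H i; apply: combZ.
by apply: comb1 (normal_subst Ss s0 nq) (bB _ bnd_i).
Qed.

Lemma comb_normal_combination (bound : rbword Y -> bool) (B : bword Y -> Prop) h :
  (forall r, B r -> bound r) -> comb B h -> normal_combination lam S bound h.
Proof.
move=> Bb; elim=> [|c f v g N Bv _ [m [c' [q' [s' [H ->]]]]]].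
  exists 0%N, (fun=> 0), (fun i : 'I_0 => False_rect _ (notF (ltn_ord i))), (fun=> 0).
  by split=> [[]|]; rewrite ?big_ord0.
(* [normal_combination] demands nonzero coefficients, so vanishing summands are dropped here. *)
have [->|nc] := eqVneq c 0; first by rewrite scale0r add0r; exists m, c', q', s'.
have /normal_atE [q [s [Ss s0 nq ef ev]]] := N.
exists m.+1, (fun i => oapp c' c (unlift ord0 i)), (fun i => oapp q' q (unlift ord0 i)),
  (fun i => oapp s' s (unlift ord0 i)); split=> [i|].
  case: unliftP => [j _|_] /=; first exact: H.
  by split=> //; apply: Bb; rewrite -ev.
rewrite big_ord_recl unlift_none /= ef; congr (_ + _).
by apply: eq_bigr => i _; rewrite liftK.
Qed.

(** * The generated ideal and irreducible words *)

Lemma Id_ideal : drb_ideal lam (Id lam S).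
Proof.
split=> [|f g If Ig|c f If|f g Ig|f g If|f If|f If] J JI JS.
- exact: drb_ideal0 JI.
- by apply: (drb_idealD JI); [apply: If | apply: Ig].
- by apply: (drb_idealZ JI); apply: If.
- by apply: (drb_idealMl JI); apply: Ig.
- by apply: (drb_idealMr JI); apply: If.
- by apply: (drb_idealP JI); apply: If.
- by apply: (drb_idealDer JI); apply: If.
Qed.

Lemma IdD f g : Id lam S f -> Id lam S g -> Id lam S (f + g).
Proof. exact: drb_idealD Id_ideal _ _. Qed.

Lemma IdZ c f : Id lam S f -> Id lam S (c *: f).
Proof. exact: drb_idealZ Id_ideal _ _. Qed.

Lemma Id0 : Id lam S 0. Proof. exact: drb_ideal0 Id_ideal. Qed.

Lemma IdB f g : Id lam S f -> Id lam S g -> Id lam S (f - g).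
Proof. by move=> If Ig; apply: IdD => //; rewrite -scaleN1r; apply: IdZ. Qed.

Lemma IdMl f g : Id lam S g -> Id lam S (f ** g).
Proof. by move=> Ig; rewrite rbpE; apply: (drb_idealMl Id_ideal). Qed.

Lemma IdMr f g : Id lam S f -> Id lam S (f ** g).
Proof. by move=> If; rewrite rbpE; apply: (drb_idealMr Id_ideal). Qed.

Lemma Id_S s : S s -> Id lam S s. Proof. by move=> Ss J _; apply. Qed.

Lemma Id_normal_at h v : normal_at h v -> Id lam S h.
Proof.
elim=> {h v} [s a b Ss _ _|h v a b _ Ih _]; apply: IdMl; apply: IdMr.
  exact: Id_S.
by rewrite rboE; apply: (drb_idealP Id_ideal).
Qed.

Lemma leads_sub_lt v f g : leads v f -> leads v g -> bnd (ltr v) (f - g).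
Proof.
move=> [_ bf] [_ bg].
have -> : f - g = (f - wd v) + (-1) *: (g - wd v).
  by rewrite scaleN1r opprB addrA subrK.
by apply: bndD => //; apply: bndZ.
Qed.

Lemma lead_lt (v : bword Y) f : bnd (ltr v) f -> f != 0 -> ltw (lead f) v.
Proof. by move=> bf nz; apply/bf/lead_mem. Qed.

Definition lead_reducible := forall f, f != 0 -> Id lam S f ->
  exists h, normal_at h (lead f).

Hypothesis ltw_acc : forall u, Acc (fun v w : bword Y => is_true (ltw v w)) u.

Lemma lead_reducible_comb f : lead_reducible -> Id lam S f -> comb (le (lead f)) f.
Proof.
move=> red; move: {2}(lead f : bword Y) (lew_refl (lead f)) => W.
elim/Acc_ind: W / (ltw_acc W) f => W _ IH f le_W If.
have [->|nz] := eqVneq f 0; first exact: CombNil.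
have [h N] := red f nz If; have lN := normal_at_leads S_monic N.
(* [h] is monic with the same leading word, so the top term is removed without division. *)
pose g := f - f@_(lead f) *: h.
have Ig : Id lam S g by apply: IdB => //; apply: IdZ; apply: Id_normal_at N.
have bg : bnd (ltr (lead f)) g.
  apply/bnd_coeff => r; rewrite /g coeffD coeffN coeffZ => gr.
  have le_r : lew r (lead f).
    have [fr|] := eqVneq f@_r 0; last by rewrite mcoeff_neq0 => /lead_max.
    have: h@_r != 0 by apply: contraNneq gr => ->; rewrite fr mulr0 subrr.
    by rewrite mcoeff_neq0 => /(leads_le lN).
  case/orP: le_r => // /eqP er; move: gr.
  by rewrite (leads_coeff lN er) mulr1 (val_inj er) subrr eqxx.
have ef : f@_(lead f) *: h + g = f by rewrite addrC subrK.
suff cg : comb (le (lead f)) g.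
  by have := CombCons f@_(lead f) N (lew_refl _ : (le (lead f)) (lead f)) cg; rewrite ef.
have [->|ng] := eqVneq g 0; first exact: CombNil.
have lt_g := lead_lt bg ng.
have := IH (lead g) (ltw_lew_trans lt_g le_W) g (lew_refl _) Ig.
by apply: combS => v le_v; apply/lewW/(lew_ltw_trans le_v).
Qed.

Lemma Id_lift (B C : rbword Y -> Prop) f :
  (forall r, B r -> exists2 g, bnd C g & Id lam S (mono r - g)) -> bnd B f ->
  exists2 g, bnd C g & Id lam S (f - g).
Proof.
move=> BC; elim/bnd_ind: f / => [|c r f /BC [g bg Ig] [g' bg' Ig']].
  by exists 0; [exact: bnd0 | rewrite subrr; apply: Id0].
exists (c *: g + g'); first by apply: bndD bg'; apply: bndZ.
rewrite opprD addrACA -scalerBr; apply: IdD => //; exact: IdZ.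
Qed.

(** The bound by [r] on the words of [g] is carried along so that reducing a tail cannot disturb a
    leading term above it. *)
Lemma Irr_reduce (W : bword Y) r : lew r W ->
  exists2 g, bnd (fun t : rbword Y => Irr S t /\ lew t r) g & Id lam S (mono r - g).
Proof.
elim/Acc_ind: W / (ltw_acc W) r => W _ IH r le_W.
have [irr_r|nirr] := Classical_Prop.classic (Irr S r).
  exists (mono r); last by rewrite subrr; apply: Id0.
  by apply: bnd_mono; split=> //; apply: lew_refl.
have [h N] := not_Irr nirr.
have bh : bnd (ltr r) (mono r - h).
  by rewrite -wd_val; apply: leads_sub_lt (normal_at_leads S_monic N); apply/leads_wd/valP.
have [|g bg Ig] := Id_lift (C := fun t : rbword Y => Irr S t /\ lew t r) _ bh.
  move=> t lt_t; have [g bg Ig] := IH t (ltw_lew_trans lt_t le_W) t (lew_refl _).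
  exists g => //; apply: bndS bg => t' [irr_t' le_t']; split=> //.
  by apply: lewW; apply: lew_ltw_trans le_t' lt_t.
exists g => //; have -> : mono r - g = h + (mono r - h - g).
  by rewrite addrA [h + _]addrC subrK.
by apply: IdD Ig; apply: Id_normal_at N.
Qed.

Lemma Irr_span (B : rbword Y -> Prop) f :
  (forall r (t : rbword Y), B r -> lew t r -> B t) -> bnd B f ->
  exists2 g, bnd (fun t : rbword Y => Irr S t /\ B t) g & Id lam S (f - g).
Proof.
move=> BB; apply: Id_lift => r Br; have [g bg Ig] := Irr_reduce (lew_refl r).
by exists g => //; apply: bndS bg => t [irr_t le_t]; split=> //; apply: BB Br le_t.
Qed.

Definition Irr_independent := forall f, bnd (Irr S) f -> Id lam S f -> f = 0.

(** For the converse, if [lead f] were irreducible, reducing the tail of [f] would give an element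
    of the ideal made of irreducible words, with the leading coefficient of [f] intact; independence
    would make it vanish. *)
Lemma lead_reducible_independent : lead_reducible <-> Irr_independent.
Proof.
split=> [red f irr_f If|indep f nz If].
  have [//|nz] := eqVneq f 0; have [h N] := red f nz If.
  by case: (subst_lead_irr N erefl); apply/irr_f/lead_mem.
apply: not_Irr => irr_f.
pose g := f - f@_(lead f) *: mono (lead f).
have bg : bnd (ltr (lead f)) g.
  apply/bnd_coeff => r; rewrite /g coeffD coeffN coeffZ coeff_mono.
  have [<-|ne] := eqVneq (lead f) r; first by rewrite mulr1 subrr eqxx.
  rewrite mulr0 subr0 mcoeff_neq0 => /lead_max /orP [/eqP e|//].
  by move: ne; rewrite -(inj_eq val_inj) /= e eqxx.
have [|g' bg' Ig'] := Irr_span _ bg; first by move=> r t lt_r le_t; apply: lew_ltw_trans le_t lt_r.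
pose f' := f@_(lead f) *: mono (lead f) + g'.
have If' : Id lam S f'.
  have -> : f' = f - (g - g').
    by rewrite /f' /g !opprB [RHS]addrC -addrA subrK addrC.
  exact: IdB.
have f'0 : f' = 0.
  apply: indep If'; apply: bndD; first by apply: bndZ; apply: bnd_mono.
  by apply: bndS bg' => r [].
have : f@_(lead f) = 0.
  have := congr1 (fun x => x@_(lead f)) f'0; rewrite coeff0 /f' coeffD coeffZ coeff_mono eqxx mulr1.
  have -> : g'@_(lead f) = 0; last by rewrite addr0.
  move/bnd_coeff: bg' => bg'; apply/eqP; apply: contraT => /bg' [_].
  by rewrite ltw_irr.
by apply/eqP; rewrite mcoeff_neq0 lead_mem.
Qed.

Lemma coeff_comb (ws : seq (rbword Y)) (c : rbword Y -> k) r : uniq ws ->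
  (\sum_(w <- ws) c w *: (mono w : A))@_r = if r \in ws then c r else 0.
Proof.
move=> uws; rewrite coeff_sum; case: ifPn => [rws|nrws].
  rewrite (bigD1_seq r) //= big1 ?addr0 => [|w /negPf nw].
    by rewrite coeffZ coeff_mono eqxx mulr1.
  by rewrite coeffZ coeff_mono nw mulr0.
rewrite big1_seq // => w /= wws; rewrite coeffZ coeff_mono.
by case: eqP wws nrws => [-> ->|] //; rewrite mulr0.
Qed.

Lemma eq0_coeff f : (forall r, r \in msupp f -> f@_r = 0) -> f = 0.
Proof.
move=> f0; apply/rbalgP => r; rewrite coeff0.
by have [/f0 //|] := boolP (r \in msupp f); apply: mcoeff_outdom.
Qed.

Lemma basis_direct_sum :
  basis_of_quotient (Irr S) (Id lam S) <-> direct_sum (kspan (Irr S)) (Id lam S).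
Proof.
split=> [[indep span]|[span indep]]; split.
- move=> f; have [ws [c [irr_ws If]]] := span f.
  exists (\sum_(w <- ws) c w *: mono w), (f - \sum_(w <- ws) c w *: mono w).
  split=> //; last by rewrite addrC subrK.
  rewrite big_seq; apply: bnd_sum => w /irr_ws irr_w; by apply: bndZ; apply: bnd_mono.
- move=> f irr_f If; rewrite (mono_expand f) in If.
  apply: eq0_coeff => r rf.
  exact: (indep (enum_fset (msupp f)) (fun r => f@_r) (fset_uniq _) irr_f If r rf).
- move=> ws c uws irr_ws Is w wws.
  have := coeff_comb c w uws; rewrite wws => <-.
  rewrite (indep _ _ Is) ?coeff0 //.
  rewrite big_seq; apply: bnd_sum => r /irr_ws irr_r; by apply: bndZ; apply: bnd_mono.
- move=> f; have [g [h [irr_g Ih ef]]] := span f.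
  exists (enum_fset (msupp g)), (fun r => g@_r); split=> //.
  by rewrite -mono_expand ef addrC addKr.
Qed.

Lemma lead_reducible_direct_sum :
  lead_reducible <-> direct_sum (kspan (Irr S)) (Id lam S).
Proof.
rewrite lead_reducible_independent; split=> [indep|[_ indep]]; last exact: indep.
split=> [f|f]; last exact: indep.
have [//|g bg Ig] := @Irr_span (fun=> True) f _ (fun _ _ => I).
exists g, (f - g); split=> //; last by rewrite addrC subrK.
by apply: bndS bg => r [].
Qed.

(** * Compositions and leading words of the ideal *)

Lemma groebner_shirshov_reducible : groebner_shirshov lam S -> lead_reducible.
Proof.
move=> [mult inter incl] f nz If.
(* Triviality bounds the summands by [lead h], hence by any [W] above the words of [h]. The case h =
   0 is separate because [lead 0] is a default value. *)
have mult_comb W h : bnd (ler W) h -> trivial_mod lam S h -> comb (le W) h.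
  move=> bh [->|nc]; first exact: CombNil.
  have [->|h0] := eqVneq h 0; first exact: CombNil.
  apply: normal_combination_comb nc => r le_r.
  exact: lew_trans le_r (bh _ (lead_mem h0)).
have right_comb s u : S s -> s != 0 -> is_rbword u ->
    ends_with_bracket (lead s) -> starts_with_bracket u ->
    comb (le (mx (lead s) u)) (s ** wd u).
  move=> Ss s0 ru es su; apply: mult_comb.
    exact: bnd_mul (leads_le (S_leads S_monic Ss s0)) (bnd_wd_le ru).
  by have [/(_ es su)] := mult s Ss s0 (RBWord ru); rewrite -rbpE -wd_val.
have left_comb s u : S s -> s != 0 -> is_rbword u ->
    ends_with_bracket u -> starts_with_bracket (lead s) ->
    comb (le (mx u (lead s))) (wd u ** s).
  move=> Ss s0 ru eu ss; apply: mult_comb.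
    exact: bnd_mul (bnd_wd_le ru) (leads_le (S_leads S_monic Ss s0)).
  by have [_ /(_ ss eu)] := mult s Ss s0 (RBWord ru); rewrite -rbpE -wd_val.
have word_comb (w : rbword Y) h : trivial_mod_word lam S w h -> comb (lt w) h.
  by case=> [->|]; [exact: CombNil | apply: normal_combination_comb].
apply: (combT_lead S_monic right_comb left_comb ltw_acc) nz.
- move=> s h Ss s0 /normal_atE [q [g [Sg g0 nq <- es]]]; apply: word_comb.
  by apply: incl => //; apply: val_inj.
- move=> g1 g2 u v w S1 S2 n1 n2 rw eu ev ov.
  have ru : is_rbword u by move: rw; rewrite eu => /rb_catP [].
  have rv : is_rbword v by move: rw; rewrite ev => /rb_catP [].
  apply: (word_comb (RBWord rw)).
  have [/(_ eu ev) + _] := inter g1 g2 S1 S2 n1 n2 (RBWord ru) (RBWord rv) (RBWord rw) ov.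
  by rewrite -!rbpE -!wd_val.
(* [Id] is the intersection of all ideals containing [S], so it suffices that the span of the normal
   elements is one of them. *)
- apply: If; last by move=> s Ss; apply: combT_S.
  split=> [|x y|c x|x y cy|x y cx|x cx|x cx].
  + exact: CombNil.
  + exact: combD.
  + exact: combZ.
  + by rewrite -rbpE; apply: (combT_mul S_monic right_comb left_comb ltw_acc).
  + by rewrite -rbpE; apply: (combT_rmul S_monic right_comb left_comb ltw_acc).
  + by rewrite -rboE; apply: combT_rbo.
  + by rewrite -rbdE; apply: (combT_rbd S_monic S_der right_comb left_comb ltw_acc).
Qed.

Lemma reducible_groebner_shirshov : lead_reducible -> groebner_shirshov lam S.
Proof.
move=> red.
have triv h : Id lam S h -> trivial_mod lam S h.
  move=> Ih; right; apply: comb_normal_combination (lead_reducible_comb red Ih).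
  by [].
have triv_word (w : rbword Y) h : bnd (ltr w) h -> Id lam S h -> trivial_mod_word lam S w h.
  move=> bh Ih; have [->|nz] := eqVneq h 0; first by left.
  right; apply: comb_normal_combination (lead_reducible_comb red Ih) => r le_r.
  exact: lew_ltw_trans le_r (lead_lt bh nz).
split.
- move=> f Sf f0 u; split=> _ _; apply: triv; rewrite -rbpE.
    by apply: IdMr; apply: Id_S.
  by apply: IdMl; apply: Id_S.
- move=> f g Sf Sg f0 g0 u v w _; split=> ew ew'; rewrite -!rbpE -!wd_val; apply: triv_word.
  + have lf := S_leads S_monic Sf f0; have lg := S_leads S_monic Sg g0.
    apply: leads_sub_lt.
      by rewrite ew; apply: leads_mul lf (leads_wd _ (valP u)) _; rewrite -ew; apply: valP.
    by rewrite ew'; apply: leads_mul (leads_wd _ (valP v)) lg _; rewrite -ew'; apply: valP.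
  + by apply: IdB; [apply: IdMr; apply: Id_S | apply: IdMl; apply: Id_S].
  + have lf := S_leads S_monic Sf f0; have lg := S_leads S_monic Sg g0.
    apply: leads_sub_lt.
      by rewrite ew; apply: leads_mul (leads_wd _ (valP u)) lf _; rewrite -ew; apply: valP.
    by rewrite ew'; apply: leads_mul lg (leads_wd _ (valP v)) _; rewrite -ew'; apply: valP.
  + by apply: IdB; [apply: IdMl; apply: Id_S | apply: IdMr; apply: Id_S].
- move=> f g Sf Sg f0 g0 q nq ef; have N := normal_subst Sg g0 nq.
  apply: triv_word; last by apply: IdB; [apply: Id_S | apply: Id_normal_at N].
  apply: leads_sub_lt (S_leads S_monic Sf f0) _.
  by rewrite ef; apply: normal_at_leads N.
Qed.
End Conversion.

(** Letters descend along [X] or, over a fixed variable, by raising the order of derivation. As that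
    order is at most [n], the number n - i decreases in the second case. *)
Lemma well_ordered_acc (disp : Order.disp_t) (X : orderType disp) (n : nat) :
  well_ordered X -> forall y : diffvar n X, Acc (fun y z => is_true (ltletter y z)) y.
Proof.
move=> wo; have acc_lt x : Acc (fun x y : X => is_true (x < y)%O) x.
  apply: Classical_Prop.NNPP => nacc.
  have [m nm min_m] := wo (fun x => ~ Acc (fun x y : X => is_true (x < y)%O) x)
    (ex_intro _ x nacc).
  apply: nm; constructor=> y lt_y; apply: Classical_Prop.NNPP => ny.
  by have := min_m y ny; rewrite leNgt lt_y.
case=> x i; elim/Acc_ind: x / (acc_lt x) i => x _ IHx i.
have [N] := ubnP (n - i); elim: N i => [|N IHi] i leN; first by move: leN; rewrite ltn0.
constructor=> -[y j]; rewrite /ltletter /= => /orP [lt_y|/andP [/eqP -> lt_ij]].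
  exact: IHx.
apply: IHi; have := ltn_ord j; move: leN lt_ij; move: (i : nat) (j : nat); clear; lia.
Qed.

Theorem theorem4p12 (k : comPzRingType) (lam : k)
    (disp : Order.disp_t) (X : orderType disp)
    (X_nonempty : inhabited X) (X_wo : well_ordered X)
    (n : nat) (n_ge1 : (1 <= n)%N)
    (S : rbalg k (diffvar n X) -> Prop)
    (S_monic : forall s, S s -> is_monic s \/ s = 0)
    (S_der : forall s, S s -> S (der lam s)) :
  let a := groebner_shirshov lam S in
  let b := forall f : rbalg k (diffvar n X), f != 0 -> Id lam S f ->
             exists (q : starword X n) (s : rbalg k (diffvar n X)),
               [/\ S s, s != 0, normal q s & lead f = subst_lead q s] in
  let c := basis_of_quotient (Irr S) (Id lam S) in
  let c' := direct_sum (kspan (Irr S)) (Id lam S) in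
  [/\ a <-> b, b <-> c & c <-> c'].
Proof.
have S_rbd s : S s -> S (rbd lam s) by rewrite rbdE; apply: S_der.
have acc := ltw_wf (well_ordered_acc (n := n) X_wo).
have bE : (forall f : rbalg k (diffvar n X), f != 0 -> Id lam S f ->
             exists (q : starword X n) (s : rbalg k (diffvar n X)),
               [/\ S s, s != 0, normal q s & lead f = subst_lead q s]) <->
          lead_reducible lam S.
  split=> red f nz If.
    have [q [s [Ss s0 nq ef]]] := red f nz If.
    by exists (subst lam q s); rewrite ef; apply: normal_subst.
  have [h /(normal_atE S_monic S_rbd) [q [s [Ss s0 nq _ ef]]]] := red f nz If.
  by exists q, s; split=> //; apply: val_inj.
move=> a b c c'; split; rewrite /a /b /c /c' ?bE.
- split; first exact: groebner_shirshov_reducible.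
  exact: reducible_groebner_shirshov.
- by rewrite basis_direct_sum; apply: lead_reducible_direct_sum.
- exact: basis_direct_sum.
Qed.
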